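(* There is a 1-1 correspondence between $\tilde x\in\tilde L^2_+(D,\gamma)$ and $(a,\mu)\in[0,\infty)\times S_+(D,\gamma)$ which is given by $$\tilde x(s,\cdot)=a\,k_s(\cdot)+\int_Dp_s(z,\cdot)\,\mu(dz),\qquad s>0.$$
   Context: $D=(0,\infty)$ and $\gamma(dy)=(1-e^{-y^2})\,dy$ on $D$. Let $g_1(s,x)=(2\pi s)^{-1/2}\exp\{-x^2/2s\}$ for $s>0$, $x\in\mathbb{R}$; $p_s(x,y)=g_1(s,y-x)-g_1(s,y+x)$ for $s,x,y>0$; and $k_s(y)=\frac12\frac{d}{dx}p_s(x,y)\big|_{x=0^+}=y\,g_1(s,y)/s$ for $s,y>0$. $(T_t)_{t\ge0}$ is the transition semigroup of the absorbing barrier Brownian motion in $D$, acting on $L^2(D,\gamma)$: $T_tf(x)=\int_Dp_t(x,y)f(y)\,dy$ for $t>0$, $T_0=I$. An entrance path for $(T_t)_{t\ge0}$ is a path $\tilde x=\{\tilde x(s):s>0\}$ in $L^2(D,\gamma)$, with $\tilde x(s)=\tilde x(s,\cdot)$, such that $\tilde x(r+t)=T_t\tilde x(r)$ for all $r,t>0$. $\tilde L^2(D,\gamma)$ is the set of entrance paths that are locally square integrable, i.e. $\int_0^l\|\tilde x(s)\|^2_{L^2(D,\gamma)}ds<\infty$ for some $l>0$, and $\tilde L^2_+(D,\gamma)$ is its subset of non-negative elements ($\tilde x(s,\cdot)\ge0$ for all $s>0$). $S(D,\gamma)$ is the set of signed measures $\mu$ on $D$ with total variation measure $|\mu|$ satisfying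 $$\int_0^lds\int_D\Big(\int_Dp_s(x,y)\,|\mu|(dx)\Big)^2\gamma(dy)<\infty$$ for some $l>0$, and $S_+(D,\gamma)$ is its subset of non-negative elements, i.e. the non-negative (not necessarily finite) Borel measures $\mu$ on $D$ satisfying this condition with $|\mu|=\mu$. *)

(* Defs.v *)
From HB Require Import structures.
From mathcomp Require Import all_boot all_order all_algebra.
From mathcomp Require Import all_classical all_reals all_analysis.
From mathcomp Require Import measurable_realfun ring.

Set Implicit Arguments.
Unset Strict Implicit.
Unset Printing Implicit Defensive.
Import Order.TTheory GRing.Theory Num.Theory.
Import numFieldNormedType.Exports.

Local Open Scope classical_set_scope.
Local Open Scope ring_scope.

Section kernels.
Context {R : realType}.
Implicit Types s t x y z : R.

Definition D : set R := `]0, +oo[.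

Definition g1 s x : R :=
  (Num.sqrt (2 * pi * s))^-1 * expR (- x ^+ 2 / (2 * s)).

Definition p s x y : R := g1 s (y - x) - g1 s (y + x).

Definition k s y : R := y * g1 s y / s.

(* The formula for p extends smoothly to x <= 0, so the right derivative at 0
   that defines k is an ordinary derivative. *)
Lemma is_derive_p s y : 0 < s -> is_derive (0 : R) 1 (p s ^~ y) (2 * k s y).
Proof.
move=> s0; rewrite /p /k /g1.
apply: is_derive_eq.
set c := (Num.sqrt _)^-1.
rewrite /GRing.scale/= ?subr0 ?addr0.
field.
by rewrite gt_eqF.
Qed.

End kernels.

Section gamma.
Context {R : realType}.
Local Open Scope ereal_scope.

(* gamma is carried by the whole line, with no mass outside D; likewise for
   the measures in S_plus below *)
Definition gamma (A : set (measurableTypeR R)) : \bar R :=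
  \int[lebesgue_measure]_(y in A `&` D) (1 - expR (- y ^+ 2))%:E.

Let density_ge0 (y : R) : 0 <= (1 - expR (- y ^+ 2))%:E.
Proof. by rewrite lee_fin subr_ge0 expR_le1 lerNl oppr0 sqr_ge0. Qed.

Let gamma0 : gamma set0 = 0.
Proof. by rewrite /gamma set0I integral_set0. Qed.

Let gamma_ge0 A : 0 <= gamma A.
Proof. exact: integral_ge0. Qed.

Let gamma_sigma_additive : semi_sigma_additive gamma.
Proof.
move=> F mF tF mUF.
rewrite {2}/gamma setI_bigcupl.
have mFD i : measurable (F i `&` D) by apply: measurableI => //; exact: measurable_itv.
have tFD : trivIset setT (fun i => F i `&` D) by exact: trivIset_setIr.
apply: (@semi_sigma_additive_nng_induced _ _ _ lebesgue_measure
  (fun y : measurableTypeR R => (1 - expR (- y ^+ 2))%:E)) => //.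
- apply/measurable_EFinP; apply: measurable_funB => //.
  apply: measurableT_comp => //; apply: measurableT_comp => //.
- exact: bigcup_measurable.
Qed.

HB.instance Definition _ := isMeasure.Build _ _ _ gamma
  gamma0 gamma_ge0 gamma_sigma_additive.

End gamma.

Section entrance_paths.
Context {R : realType}.

Definition L2 : Type := LspaceType2 (@gamma R).

Definition T (t : R) (f : R -> R) (x : R) : R :=
  \int[lebesgue_measure]_(y in D) (p t x y * f y).

(* Only the values of a path at s > 0 are meaningful. *)
Definition entrance_path (x : R -> L2) : Prop :=
  forall r t : R, 0 < r -> 0 < t -> x (r + t) = T t (x r) %[ae gamma].

Definition Ltilde2 (x : R -> L2) : Prop :=
  entrance_path x /\
  exists2 l : R, 0 < l &
    (\int[lebesgue_measure]_(s in `]0%R, l[)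
       'N[gamma]_2%:E[EFin \o x s] ^+ 2 < +oo)%E.

Definition Ltilde2_plus (x : R -> L2) : Prop :=
  Ltilde2 x /\ forall s : R, 0 < s -> {ae gamma, forall y, 0 <= x s y}.

Definition S_plus (mu : {measure set (measurableTypeR R) -> \bar R}) : Prop :=
  mu (~` D) = 0%E /\
  exists2 l : R, 0 < l &
    (\int[lebesgue_measure]_(s in `]0%R, l[)
       \int[gamma]_(y in D) (\int[mu]_(x in D) (p s x y)%:E) ^+ 2 < +oo)%E.

Definition represents (a : R)
    (mu : {measure set (measurableTypeR R) -> \bar R}) (x : R -> L2) : Prop :=
  forall s : R, 0 < s ->
    EFin \o x s =
    (fun y => (a * k s y)%:E + \int[mu]_(z in D) (p s z y)%:E)%E %[ae gamma].

End entrance_paths.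

(* Main.v *)
Require Import Defs.
From HB Require Import structures.
From mathcomp Require Import all_boot all_order all_algebra.
From mathcomp Require Import all_classical all_reals all_analysis.
From mathcomp Require Import measurable_realfun ring lra.
Set Implicit Arguments.
Unset Strict Implicit.
Unset Printing Implicit Defensive.
Import Order.TTheory GRing.Theory Num.Theory.
Import numFieldNormedType.Exports.
Local Open Scope classical_set_scope.
Local Open Scope ring_scope.

(** Why the theorem holds. From a pair [(a, mu)] one gets an entrance path,
    because the entrance law [k] and the kernels [p _ z] satisfy the semigroup
    equation ([k_semigroup], [Uint_semigroup]). The condition defining [S_plus]
    makes [mu] finite against the weight [wt T z = z * exp (- z^2 / 2T)] for
    some [T], hence sigma-finite, so that Fubini's theorem applies. It also
    makes the path square integrable at arbitrarily small times, and the
    semigroup is bounded on the weighted space ([sqnorm_Tint_le], a Schur test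
    in which the factor [min (1, y)] gained by absorption matches the density of
    [gamma]), so the path is finite and square integrable at all times. The part
    [a * k] is locally square integrable since the squared norm of [k s] is of
    order [s^(-1/2)].

    Conversely, let [f] be a non-negative entrance path. The measures
    [wt (1/2) y * f s y * dy] have bounded mass as [s] tends to 0, because the
    weight is at most a multiple of [p (1/2) 1 y] and the integral of [f s]
    against this kernel is the value at 1 of the path at time [s + 1/2]. Let
    [nu] be a vague limit point on the closed half-line ([vague_compact]). For
    [t < 1/2] the quotient of [p t z y] by the weight is continuous in [y] up to
    0, where its value is [2 * k t z], and vanishes at infinity ([ratio]).
    Passing to the limit in the identity of the integral of [f s] against
    [p t z] with the value at [z] of the path at time [s + t], the mass of [nu]
    at 0 contributes a multiple of [k t z], and the rest of [nu], divided by the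
    weight, is the measure [mu]. The semigroup extends the representation to all
    times ([entrance_path_representation]).

    For uniqueness, the path is integrated against a Lipschitz test function
    supported in a compact subset of [D]: as the time tends to 0 the part coming
    from [k] disappears and the kernels form an approximate identity, so the
    limit is the integral of the test function against [mu] ([pairing_cvg]).
    This determines [mu], and then [a] ([pair_unique]). *)

(** * The Gaussian kernel and the absorbed kernel *)

Ltac prove_sign := repeat match goal with
  | |- is_true (_ && _) => apply/andP; split
  | |- _ => first [by [] | assumption | by apply/ltW
    | exact: expR_gt0 | exact: expR_ge0 | exact: sqr_ge0 | exact: pi_gt0 | exact: pi_ge0
    | exact: sqrtr_ge0 | exact: normr_ge0 | rewrite sqrtr_gt0
    | rewrite subr_gt0 | rewrite invr_gt0 | rewrite invr_ge0
    | apply: mulr_gt0 | apply: mulr_ge0 | apply: addr_gt0 | apply: addr_ge0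
    | apply: exprn_gt0 | apply: exprn_ge0 | apply: ltW; assumption ]
  end.

Section kernel_bounds.
Context {R : realType}.
Implicit Types s t x y z : R.

Lemma sqrt2pi_gt0 s : 0 < s -> 0 < Num.sqrt (2 * pi * s).
Proof. by move=> s0; rewrite sqrtr_gt0 !mulr_gt0// pi_gt0. Qed.

Lemma g1_gt0 s x : 0 < s -> 0 < g1 s x.
Proof. by move=> s0; rewrite /g1 mulr_gt0 ?expR_gt0// invr_gt0 sqrt2pi_gt0. Qed.

Lemma g1_ge0 s x : 0 <= g1 s x.
Proof. by rewrite /g1 mulr_ge0 ?expR_ge0// invr_ge0 sqrtr_ge0. Qed.

Lemma g1N s x : g1 s (- x) = g1 s x.
Proof. by rewrite /g1 sqrrN. Qed.

Lemma g1_le s x : 0 < s -> g1 s x <= (Num.sqrt (2 * pi * s))^-1.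
Proof.
move=> s0; rewrite /g1 -[leRHS]mulr1 ler_wpM2l// ?invr_ge0 ?sqrtr_ge0//.
rewrite -expR0 ler_expR mulNr oppr_le0 mulr_ge0 ?sqr_ge0// invr_ge0.
by rewrite mulr_ge0// ltW.
Qed.

Lemma pC t x y : p t x y = p t y x.
Proof. by rewrite /p -(g1N t (y - x)) opprB (addrC y x). Qed.

Lemma pNr t x y : p t x (- y) = - p t x y.
Proof. by rewrite /p -(g1N t (- y - x)) -(g1N t (- y + x)) !opprD !opprK addrC. Qed.

Lemma pE t x y : 0 < t ->
  p t x y = g1 t (y - x) * (1 - expR (- (2 * x * y / t))).
Proof.
move=> t0; rewrite /p mulrBr mulr1; congr (_ - _).
rewrite /g1 -[RHS]mulrA -expRD; congr (_ * expR _); field.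
by rewrite gt_eqF.
Qed.

Lemma p_ge0 t x y : 0 < t -> 0 <= x -> 0 <= y -> 0 <= p t x y.
Proof.
move=> t0 x0 y0; rewrite pE// mulr_ge0 ?g1_ge0// subr_ge0 expR_le1 oppr_le0.
by rewrite !mulr_ge0// invr_ge0 ltW.
Qed.

Lemma k_ge0 s y : 0 < s -> 0 <= y -> 0 <= k s y.
Proof. by move=> s0 y0; rewrite /k !mulr_ge0// ?g1_ge0// invr_ge0 ltW. Qed.

Lemma k_gt0 s y : 0 < s -> 0 < y -> 0 < k s y.
Proof. by move=> s0 y0; have := g1_gt0 y s0; rewrite /k => ?; prove_sign. Qed.

Lemma p_le_g1 t x y : p t x y <= g1 t (y - x).
Proof. by rewrite /p gerBl g1_ge0. Qed.

(** Absorption makes the kernel vanish linearly at 0 in each variable, because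
    [1 - exp (- u) <= u]. *)
Lemma p_le_Mg1 t x y : 0 < t -> p t x y <= 2 * x * y / t * g1 t (y - x).
Proof.
move=> t0; rewrite pE// mulrC ler_wpM2r ?g1_ge0//.
rewrite lerBlDr -lerBlDl.
by rewrite (le_trans _ (expR_ge1Dx _))//.
Qed.

(** For [u >= 0], [u <= exp u - exp (- u)]; here [u = x * z / t]. *)
Lemma p_ge_k t x z : 0 < t -> 0 <= x -> 0 <= z ->
  k t x * (z * expR (- z ^+ 2 / (2 * t))) <= p t x z.
Proof.
move=> t0 x0 z0.
have u0 : 0 <= x * z / t by rewrite !mulr_ge0// invr_ge0 ltW.
have t0' : t != 0 by rewrite gt_eqF.
have -> : p t x z = g1 t x * expR (- z ^+ 2 / (2 * t)) *
    (expR (x * z / t) - expR (- (x * z / t))).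
  rewrite mulrBr /p /g1 -!mulrA -!expRD.
  by congr (_ * expR _ - _ * expR _); field.
have -> : k t x * (z * expR (- z ^+ 2 / (2 * t))) =
    g1 t x * expR (- z ^+ 2 / (2 * t)) * (x * z / t) by rewrite /k; field.
rewrite ler_wpM2l ?mulr_ge0 ?g1_ge0 ?expR_ge0//.
rewrite lerBrDl (le_trans _ (expR_ge1Dx _))//.
by rewrite lerD2r expR_le1 oppr_le0.
Qed.

(** Passing to a larger variance costs a constant but gains a factor that
    absorbs polynomials. *)
Lemma g1_le_g1 t T v : 0 < t -> t <= T ->
  g1 t v <= Num.sqrt (T / t) * g1 T v.
Proof.
move=> t0 tT; have T0 := lt_le_trans t0 tT.
rewrite /g1 mulrA.
have -> : Num.sqrt (T / t) * (Num.sqrt (2 * pi * T))^-1 = (Num.sqrt (2 * pi * t))^-1.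
  have -> : Num.sqrt (2 * pi * T) = Num.sqrt (T / t) * Num.sqrt (2 * pi * t).
    rewrite -sqrtrM ?divr_ge0 ?(ltW T0) ?(ltW t0)//; congr Num.sqrt; field.
    by rewrite gt_eqF.
  by rewrite invfM mulrA mulfV ?mul1r// gt_eqF// sqrtr_gt0 divr_gt0.
rewrite ler_wpM2l ?invr_ge0 ?sqrtr_ge0//.
rewrite ler_expR !mulNr lerN2 ler_wpM2l ?sqr_ge0// lef_pV2 ?posrE ?mulr_gt0//.
by rewrite ler_pM2l.
Qed.

Lemma normM_g1_le t T v : 0 < t -> t <= T ->
  (1 + `|v|) * g1 t v <= (2 + T) * Num.sqrt (2 * T / t) * g1 (2 * T) v.
Proof.
move=> t0 tT; have T0 := lt_le_trans t0 tT.
have t20 : t < 2 * T by rewrite (le_lt_trans tT)// ltr_pMl// ltr1n.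
have h1 : g1 t v = (Num.sqrt (2 * pi * t))^-1 * expR (- (v^+2/(2 * (2 * t)))) *
    expR (- (v^+2/(2 * (2 * t)))).
  rewrite /g1 -[RHS]mulrA -expRD; congr (_ * expR _); field.
  by rewrite gt_eqF.
set E := expR (- (v^+2/(2 * (2 * t)))) in h1.
have h2 : (1 + `|v|) * E <= 2 + T.
  rewrite /E expRN ler_pdivrMr ?expR_gt0//.
  rewrite (@le_trans _ _ ((2 + T) * (1 + v ^+ 2 / (2 * (2 * t)))))//; last first.
    by rewrite ler_wpM2l// ?expR_ge1Dx// ltW// addr_gt0.
  rewrite -(real_normK (num_real v)).
  have := normr_ge0 v; move: `|v| => w w0.
  rewrite (@le_trans _ _ ((2 + T) * (1 + w ^+ 2 / (2 * (2 * T)))))//; last first.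
    rewrite ler_wpM2l ?lerD2l ?ler_wpM2l ?sqr_ge0// ?addr_ge0// ?(ltW T0)//.
    by rewrite lef_pV2 ?posrE ?mulr_gt0// !ler_pM2l.
  rewrite mulrDr mulr1 -subr_ge0.
  have -> : 2 + T + (2 + T) * (w ^+ 2 / (2 * (2 * T))) - (1 + w) =
    1 + w ^+ 2 / (4 * T) + w ^+ 2 / 4 + T * (w / (2 * T) - 1) ^+ 2.
    by field; rewrite gt_eqF.
  prove_sign.
rewrite h1.
rewrite [X in X <= _](_ : _ = ((1 + `|v|) * E) * ((Num.sqrt (2 * pi * t))^-1 * E)); last by ring.
rewrite -[X in _ <= X]mulrA ler_pM// ?mulr_ge0 ?expR_ge0// ?invr_ge0 ?sqrtr_ge0 ?addr_ge0//.
rewrite (@le_trans _ _ (Num.sqrt 2 * g1 (2 * t) v))//.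
  rewrite /g1 [leRHS]mulrA.
  have -> : Num.sqrt 2 * (Num.sqrt (2 * pi * (2 * t)))^-1 = (Num.sqrt (2 * pi * t))^-1.
    rewrite [2 * pi * (2 * t)](_ : _ = 2 * (2 * pi * t)); last by ring.
    rewrite [in LHS]sqrtrM// invfM mulrA mulfV ?mul1r//.
  by rewrite mulNr.
have tT2 : 2 * t <= 2 * T by rewrite ler_pM2l.
have t2 : 0 < 2 * t by rewrite mulr_gt0.
apply: (le_trans (ler_wpM2l (sqrtr_ge0 _) (g1_le_g1 v t2 tT2))).
rewrite mulrA ler_wpM2r ?g1_ge0// -sqrtrM// ler_sqrt ?divr_ge0 ?mulr_ge0 ?(ltW T0) ?(ltW t0)//.
rewrite le_eqVlt; apply/orP; left; apply/eqP; field.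
by rewrite gt_eqF.
Qed.

Definition cap1 y : R := Num.min 1 y.

Lemma cap1_ge0 y : 0 <= y -> 0 <= cap1 y.
Proof. by move=> y0; rewrite le_min ler01. Qed.

Lemma cap1_gt0 y : 0 < y -> 0 < cap1 y.
Proof. by move=> y0; rewrite lt_min ltr01. Qed.

(** Absorption at 0 gives the kernel a factor [min(1, y)], uniformly in the
    starting point. *)
Lemma p_le_cap1 t0 t1 : 0 < t0 -> t0 <= t1 -> exists2 C : R, 0 < C &
  forall t x y, t0 <= t <= t1 -> 0 < x -> 0 < y ->
    p t x y <= C * cap1 y * g1 (2 * t1) (y - x).
Proof.
move=> t00 t01; have t10 := lt_le_trans t00 t01.
pose c := (2 + t1) * Num.sqrt (2 * t1 / t0).
have c0 : 0 < c.
  by rewrite mulr_gt0 ?addr_gt0// sqrtr_gt0 divr_gt0// mulr_gt0.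
have cle t v : t0 <= t <= t1 -> (1 + `|v|) * g1 t v <= c * g1 (2 * t1) v.
  move=> /andP[tt0 tt1]; have tgt0 := lt_le_trans t00 tt0.
  rewrite (le_trans (normM_g1_le v tgt0 tt1))// ler_wpM2r ?g1_ge0//.
  rewrite ler_wpM2l ?addr_ge0 ?(ltW t10)//.
  rewrite ler_sqrt ?divr_ge0 ?mulr_ge0 ?(ltW t10) ?(ltW t00)//.
  by rewrite ler_pM2l ?mulr_gt0// lef_pV2 ?posrE.
exists (c * (1 + 2 / t0)).
  by rewrite mulr_gt0// addr_gt0// divr_gt0.
move=> t x y tt x0 y0; have /andP[tt0 tt1] := tt.
have tgt0 := lt_le_trans t00 tt0.
have h := cle t (y - x) tt.
have gv := g1_ge0 t (y - x).
rewrite /cap1; have [y1|y1] := leP 1 y.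
  rewrite mulr1 (le_trans (p_le_g1 _ _ _))//.
  rewrite (@le_trans _ _ ((1 + `|y - x|) * g1 t (y - x)))//.
    by rewrite ler_peMl// lerDl.
  rewrite (le_trans h)// ler_wpM2r ?g1_ge0// ler_peMr ?(ltW c0)//.
  by rewrite lerDl divr_ge0// ltW.
rewrite (le_trans (p_le_Mg1 _ _ tgt0))//.
have xle : x <= 1 + `|y - x|.
  have := ler_norm (x - y); rewrite distrC; lra.
rewrite [leLHS](_ : _ = 2 / t * y * (x * g1 t (y - x))); last first.
  by field; rewrite gt_eqF.
rewrite [leRHS](_ : _ = (1 + 2 / t0) * y * (c * g1 (2 * t1) (y - x))); last first.
  by field; rewrite gt_eqF.
rewrite ler_pM ?mulr_ge0 ?invr_ge0 ?(ltW tgt0) ?(ltW y0) ?(ltW x0)//.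
  rewrite ler_wpM2r ?(ltW y0)// (@le_trans _ _ (2 / t0))// ?lerDr//.
  by rewrite ler_pM2l// lef_pV2 ?posrE.
by rewrite (le_trans _ h)// ler_wpM2r.
Qed.

(** The weight [z * exp(-z^2/2t)] is, up to constants depending on the starting
    point, comparable with the kernel at times just above and below [t]. *)
Definition wt t z : R := z * expR (- z ^+ 2 / (2 * t)).

Lemma wt_ge0 t z : 0 <= z -> 0 <= wt t z.
Proof. by move=> z0; rewrite mulr_ge0// expR_ge0. Qed.

Lemma wt_gt0 t z : 0 < z -> 0 < wt t z.
Proof. by move=> z0; rewrite mulr_gt0// expR_gt0. Qed.

Lemma p_le_wt t0 t1 t' x : 0 < t0 -> t0 <= t1 -> t1 < t' -> 0 < x ->
  exists2 C : R, 0 < C &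
  forall t z, t0 <= t <= t1 -> 0 < z -> p t x z <= C * wt t' z.
Proof.
move=> t00 t01 t1t' x0; have t10 := lt_le_trans t00 t01.
have t'0 := lt_trans t10 t1t'.
pose q := (Num.sqrt (2 * pi * t0))^-1.
have q0 : 0 < q by rewrite invr_gt0 sqrt2pi_gt0.
pose e := expR (x ^+ 2 / (2 * (t' - t1))).
exists (2 * x / t0 * q * e).
  rewrite /e; prove_sign.
move=> t z /andP[tt0 tt1] z0; have tgt0 := lt_le_trans t00 tt0.
rewrite (le_trans (p_le_Mg1 _ _ tgt0))//.
rewrite /wt [leRHS](_ : _ = (2 * x * z / t0) * (q * (e * expR (- z ^+ 2 / (2 * t'))))); last first.
  by field; rewrite gt_eqF.
rewrite ler_pM ?mulr_ge0 ?invr_ge0 ?g1_ge0// ?(ltW tgt0) ?(ltW x0) ?(ltW z0)//.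
  by rewrite ler_wpM2l ?mulr_ge0 ?(ltW x0) ?(ltW z0)// lef_pV2 ?posrE.
rewrite /g1 ler_pM ?invr_ge0 ?sqrtr_ge0 ?expR_ge0//.
  rewrite /q lef_pV2 ?posrE ?sqrt2pi_gt0//.
  rewrite ler_sqrt ?mulr_ge0 ?pi_ge0 ?(ltW tgt0)//.
  by rewrite ler_pM2l// mulr_gt0// pi_gt0.
rewrite /e -expRD ler_expR.
have d0 : 0 < t' - t1 by rewrite subr_gt0.
rewrite (@le_trans _ _ (- (z - x) ^+ 2 / (2 * t1)))//.
  rewrite !mulNr lerN2 ler_wpM2l ?sqr_ge0//.
  by rewrite lef_pV2 ?posrE ?mulr_gt0// ler_pM2l.
rewrite -subr_ge0.
rewrite [leRHS](_ : _ = ((t' - t1) * (z - x) - t1 * x) ^+ 2 / (2 * t1 * t' * (t' - t1))).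
  by rewrite mulr_ge0 ?sqr_ge0// invr_ge0 !mulr_ge0 ?(ltW t10) ?(ltW t'0) ?(ltW d0).
field; rewrite !gt_eqF//.
Qed.

End kernel_bounds.

(** * Integration preliminaries *)

Section integration.
Import HBNNSimple.
Local Open Scope ereal_scope.

(** Both sides agree on simple functions and pass to increasing limits. *)
Lemma integral_density d (T : measurableType d) (R : realType)
    (m mu : {measure set T -> \bar R}) (h : T -> R) :
    (forall x, 0 <= h x)%R -> measurable_fun setT h ->
    (forall A, measurable A -> m A = \int[mu]_(x in A) (h x)%:E) ->
  forall f : T -> \bar R, (forall x, 0 <= f x) -> measurable_fun setT f ->
  \int[m]_x f x = \int[mu]_x ((h x)%:E * f x).
Proof.
move=> h0 mh mE f f0 mf.
have mhE : measurable_fun setT (EFin \o h) by exact/measurable_EFinP.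
pose g := nnsfun_approx measurableT mf.
have gf x : (g n x)%:E @[n --> \oo] --> f x by exact: cvg_nnsfun_approx.
have ndg x : {homo (fun n => (g n x)%:E) : a b / (a <= b)%N >-> a <= b}.
  by move=> a b ab; rewrite lee_fin; exact/lefP/nd_nnsfun_approx.
have mg n : measurable_fun setT (fun x => (g n x)%:E) by exact/measurable_EFinP.
have gE n : \int[m]_x (g n x)%:E = \int[mu]_x ((h x)%:E * (g n x)%:E).
  have gsum x : (g n x)%:E =
      \sum_(y \in range (g n)) (y * \1_(g n @^-1` [set y]) x)%:E.
    by rewrite [in LHS]fimfunE fsumEFin.
  have mind r : measurable_fun setT (fun x => (r * \1_(g n @^-1` [set r]) x)%:E).
    by apply/measurable_EFinP; exact: measurable_funM.
  under eq_integral do rewrite gsum.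
  rewrite ge0_integral_fsum//; last by move=> r x _; exact: nnfun_muleindic_ge0.
  under [RHS]eq_integral => x _.
    rewrite gsum ge0_mule_fsumr; last by move=> r; exact: nnfun_muleindic_ge0.
    over.
  rewrite ge0_integral_fsum//; last 2 first.
  - by move=> r; exact: emeasurable_funM.
  - move=> r x _; apply: mule_ge0; first by rewrite lee_fin.
    exact: nnfun_muleindic_ge0.
  apply: eq_fsbigr => r /[!inE] -[x0 _ rE].
  have r0 : (0 <= r)%R by rewrite -rE.
  under [RHS]eq_integral => x _ do rewrite EFinM muleCA.
  rewrite ge0_integralZl//; last 2 first.
  - by apply: emeasurable_funM => //; exact/measurable_EFinP.
  - by move=> x _; rewrite mule_ge0 ?lee_fin.
  under eq_integral => x _ do rewrite EFinM.
  rewrite ge0_integralZl//; [|exact/measurable_EFinP].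
  rewrite integral_indic// setIT mE//.
  rewrite integral_mkcond; congr (_ * _); apply: eq_integral => x _.
  by rewrite epatch_indic.
transitivity (limn (fun n => \int[m]_x (g n x)%:E)).
  apply/esym/cvg_lim => //.
  rewrite [X in _ --> X](_ : _ = \int[m]_x limn (fun n => (g n x)%:E)); last first.
    by apply: eq_integral => x _; apply/esym/cvg_lim.
  by apply: cvg_monotone_convergence => // n x _; rewrite lee_fin.
rewrite (_ : (fun n => _) = fun n => \int[mu]_x ((h x)%:E * (g n x)%:E));
  last by apply/funext => n; exact: gE.
apply/cvg_lim => //.
rewrite [X in _ --> X](_ : _ =
    \int[mu]_x limn (fun n => (h x)%:E * (g n x)%:E)); last first.
  by apply: eq_integral => x _; apply/esym/cvg_lim => //; exact: cvgeZl.
apply: cvg_monotone_convergence => //.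
- by move=> n; exact: emeasurable_funM.
- by move=> n x _; rewrite mule_ge0 ?lee_fin.
- move=> x _ a b ab; rewrite lee_wpmul2l//; first by rewrite lee_fin.
  exact: ndg.
Qed.

Lemma tonelli_on d1 d2 (T1 : measurableType d1) (T2 : measurableType d2)
    (R : realType) (m1 : {sigma_finite_measure set T1 -> \bar R})
    (m2 : {sigma_finite_measure set T2 -> \bar R})
    (A : set T1) (B : set T2) (f : T1 -> T2 -> \bar R) :
  measurable A -> measurable B ->
  measurable_fun (A `*` B) (fun z => f z.1 z.2) ->
  (forall x y, A x -> B y -> 0 <= f x y) ->
  \int[m1]_(x in A) \int[m2]_(y in B) f x y =
  \int[m2]_(y in B) \int[m1]_(x in A) f x y.
Proof.
move=> mA mB mf f0.
pose F (z : T1 * T2) := ((fun z => f z.1 z.2) \_ (A `*` B)) z.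
have mF : measurable_fun setT F.
  by apply/(measurable_restrictT _ _).1 => //; exact: measurableX.
have F0 z : 0 <= F z.
  by rewrite /F patchE; case: ifPn => // /[!inE] -[? ?]; exact: f0.
transitivity (\int[m1]_x \int[m2]_y F (x, y)).
  rewrite integral_mkcond.
  apply: eq_integral => x _; rewrite patchE; case: ifPn => xA.
    rewrite integral_mkcond; apply: eq_integral => y _.
    by rewrite /F !patchE/= in_setX xA.
  by apply/esym/integral0_eq => y _; rewrite /F patchE in_setX/= (negbTE xA).
rewrite (@fubini_tonelli _ _ _ _ _ m1 m2 _ mF F0) [RHS]integral_mkcond.
apply: eq_integral => y _; rewrite [RHS]patchE; case: ifPn => yB.
  rewrite [RHS]integral_mkcond; apply: eq_integral => x _.
  by rewrite /F !patchE/= in_setX yB andbT.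
by apply: integral0_eq => x _; rewrite /F patchE in_setX/= (negbTE yB) andbF.
Qed.

Lemma measurable_integral_on d1 d2 (T1 : measurableType d1)
    (T2 : measurableType d2) (R : realType)
    (m2 : {sigma_finite_measure set T2 -> \bar R})
    (A : set T1) (B : set T2) (f : T1 -> T2 -> \bar R) :
  measurable A -> measurable B ->
  measurable_fun (A `*` B) (fun z => f z.1 z.2) ->
  (forall x y, A x -> B y -> 0 <= f x y) ->
  measurable_fun A (fun x => \int[m2]_(y in B) f x y).
Proof.
move=> mA mB mf f0.
pose F (z : T1 * T2) := ((fun z => f z.1 z.2) \_ (A `*` B)) z.
have mF : measurable_fun setT F.
  by apply/(measurable_restrictT _ _).1 => //; exact: measurableX.
have F0 z : 0 <= F z.
  by rewrite /F patchE; case: ifPn => // /[!inE] -[? ?]; exact: f0.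
have := @measurable_fun_fubini_tonelli_F _ _ _ _ _ m2 _ mF F0.
move=> /(measurable_funS measurableT (@subsetT _ A)).
apply: eq_measurable_fun => x xA; rewrite /fubini_F [RHS]integral_mkcond.
by apply: eq_integral => y _; rewrite /F !patchE/= in_setX xA.
Qed.

Lemma measurable_integral_on_fst d1 d2 (T1 : measurableType d1)
    (T2 : measurableType d2) (R : realType)
    (m1 : {sigma_finite_measure set T1 -> \bar R})
    (A : set T1) (B : set T2) (f : T1 -> T2 -> \bar R) :
  measurable A -> measurable B ->
  measurable_fun (A `*` B) (fun z => f z.1 z.2) ->
  (forall x y, A x -> B y -> 0 <= f x y) ->
  measurable_fun B (fun y => \int[m1]_(x in A) f x y).
Proof.
move=> mA mB mf f0.
pose F (z : T1 * T2) := ((fun z => f z.1 z.2) \_ (A `*` B)) z.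
have mF : measurable_fun setT F.
  by apply/(measurable_restrictT _ _).1 => //; exact: measurableX.
have F0 z : 0 <= F z.
  by rewrite /F patchE; case: ifPn => // /[!inE] -[? ?]; exact: f0.
have := @measurable_fun_fubini_tonelli_G _ _ _ _ _ m1 _ mF F0.
move=> /(measurable_funS measurableT (@subsetT _ B)).
apply: eq_measurable_fun => y yB; rewrite /fubini_G [RHS]integral_mkcond.
by apply: eq_integral => x _; rewrite /F !patchE/= in_setX yB andbT.
Qed.

End integration.

Section almost_everywhere.
Context {R : realType} (m : {measure set (measurableTypeR R) -> \bar R}).

Let F := ae_filter_ringOfSetsType m.

Lemma ae_mono (P Q : R -> Prop) : (forall x, P x -> Q x) ->
  {ae m, forall x, P x} -> {ae m, forall x, Q x}.
Proof. by move=> PQ; apply: (@filterS _ _ F). Qed.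

Lemma ae_mono2 (P Q S : R -> Prop) : (forall x, P x -> Q x -> S x) ->
  {ae m, forall x, P x} -> {ae m, forall x, Q x} -> {ae m, forall x, S x}.
Proof. by move=> PQ; apply: (@filterS2 _ _ F). Qed.

End almost_everywhere.

Section kernel_measurability.
Context {R : realType}.
Notation leb := (@lebesgue_measure R).

Lemma measurable_D : measurable (@D R).
Proof. exact: measurable_itv. Qed.

Lemma D_gt0 (x : R) : D x = (0 < x) :> Prop.
Proof. by rewrite /D/= in_itv/= andbT. Qed.

Lemma measurable_g1 d (T : measurableType d) (A : set T) (s x : T -> R) :
  measurable A -> measurable_fun A s -> measurable_fun A x ->
  (forall t, A t -> 0 < s t) -> measurable_fun A (fun t => g1 (s t) (x t)).
Proof.
move=> mA ms mx s0.
pose F t := expR (- (2^-1 * ln (2 * pi * s t)) - x t ^+ 2 * (2^-1 * expR (- ln (s t)))).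
apply: (eq_measurable_fun F) => [t /[!inE] At|].
  have st := s0 _ At.
  rewrite /F /g1 expRD (expRN (2^-1 * _)); congr (_ * _); first congr GRing.inv.
    by rewrite -powR12_sqrt ?mulr_ge0 ?pi_ge0 ?ltW// /powR gt_eqF// ?mulr_gt0 ?pi_gt0.
  rewrite (expRN (ln _)) lnK ?posrE//; congr expR; field.
  by rewrite gt_eqF.
apply: measurableT_comp => //; apply: measurable_funB.
  apply: measurableT_comp => //; apply: measurable_funM => //.
  apply: measurableT_comp; first exact: measurable_ln.
  exact: measurable_funM.
apply: measurable_funM; first exact: measurable_funX.
apply: measurable_funM => //; apply: measurableT_comp => //.
apply: measurableT_comp => //; apply: measurableT_comp => //.
Qed.

Lemma measurable_p d (T : measurableType d) (A : set T) (s x y : T -> R) :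
  measurable A -> measurable_fun A s -> measurable_fun A x -> measurable_fun A y ->
  (forall t, A t -> 0 < s t) -> measurable_fun A (fun t => p (s t) (x t) (y t)).
Proof.
move=> mA ms mx my s0; apply: measurable_funB; apply: measurable_g1 => //.
  exact: measurable_funB.
exact: measurable_funD.
Qed.

Lemma measurable_k d (T : measurableType d) (A : set T) (s y : T -> R) :
  measurable A -> measurable_fun A s -> measurable_fun A y ->
  (forall t, A t -> 0 < s t) -> measurable_fun A (fun t => k (s t) (y t)).
Proof.
move=> mA ms my s0.
pose F t := y t * g1 (s t) (y t) * expR (- ln (s t)).
apply: (eq_measurable_fun F) => [t /[!inE] At|].
  by rewrite /F /k expRN lnK// posrE s0.
apply: measurable_funM; first by apply: measurable_funM => //; exact: measurable_g1.
apply: measurableT_comp => //; apply: measurableT_comp => //.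
by apply: measurableT_comp => //; exact: measurable_ln.
Qed.

Lemma measurable_g1_cst (A : set R) s (m : R) : measurable A -> 0 < s ->
  measurable_fun A (fun y => g1 s (y - m)).
Proof.
by move=> mA s0; apply: measurable_g1 => //; exact: measurable_funB.
Qed.

Lemma measurable_p_cst (A : set R) s (x : R) : measurable A -> 0 < s ->
  measurable_fun A (p s x).
Proof. by move=> mA s0; exact: measurable_p. Qed.

Lemma integral_g1 s m : 0 < s -> (\int[leb]_y (g1 s (y - m))%:E = 1)%E.
Proof.
move=> s0; rewrite -(integral_normal_pdf m (Num.sqrt s)).
apply: eq_integral => y _; congr EFin.
have s1 : Num.sqrt s != 0 by rewrite gt_eqF// sqrtr_gt0.
rewrite normal_pdfE// /g1 /normal_peak /normal_fun sqr_sqrtr ?(ltW s0)//.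
by rewrite -mulrA !mulr_natl (mulrC pi).
Qed.

Lemma integrable_g1 s m : 0 < s ->
  leb.-integrable setT (fun y => (g1 s (y - m))%:E).
Proof.
move=> s0; apply/integrableP; split.
  by apply/measurable_EFinP; exact: measurable_g1_cst.
under eq_integral do rewrite gee0_abs ?lee_fin ?g1_ge0//.
by rewrite integral_g1// ltry.
Qed.

Lemma integrable_g1_D s m : 0 < s ->
  leb.-integrable D (fun y => (g1 s (y - m))%:E).
Proof.
move=> s0; apply: (@integrableS _ _ _ leb setT) => //.
  exact: measurable_D.
exact: integrable_g1.
Qed.

Lemma integral_D_le (f : R -> \bar R) : (forall x, 0 <= f x)%E ->
  measurable_fun setT f -> (\int[leb]_(x in D) f x <= \int[leb]_x f x)%E.
Proof. by move=> f0 mf; apply: ge0_subset_integral => //; exact: measurable_D. Qed.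

Lemma integral_g1_D s m : 0 < s -> (\int[leb]_(y in D) (g1 s (y - m))%:E <= 1)%E.
Proof.
move=> s0; rewrite -(integral_g1 m s0); apply: integral_D_le => //.
  by move=> x; rewrite lee_fin g1_ge0.
by apply/measurable_EFinP; exact: measurable_g1_cst.
Qed.

(** Completing the square in [y]. *)
Lemma g1_mul (s t x z y : R) : 0 < s -> 0 < t ->
  g1 s (y - x) * g1 t (z - y) =
  g1 (s + t) (z - x) * g1 (s * t / (s + t)) (y - (t * x + s * z) / (s + t)).
Proof.
move=> s0 t0; have st := addr_gt0 s0 t0.
rewrite /g1 mulrACA [RHS]mulrACA -!expRD.
congr (_ * expR _).
  rewrite -!invfM -!sqrtrM ?mulr_ge0 ?pi_ge0 ?(ltW s0) ?(ltW st)//.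
  by congr (GRing.inv (Num.sqrt _)); field; rewrite gt_eqF.
by field; rewrite !gt_eqF.
Qed.

Lemma integral_g1_mul (s t x z : R) : 0 < s -> 0 < t ->
  (\int[leb]_y (g1 s (y - x) * g1 t (z - y))%:E = (g1 (s + t) (z - x))%:E)%E.
Proof.
move=> s0 t0; have r0 : 0 < s * t / (s + t).
  by rewrite divr_gt0 ?mulr_gt0 ?addr_gt0.
under eq_integral do rewrite g1_mul// EFinM.
rewrite ge0_integralZl_EFin ?g1_ge0//.
- by rewrite integral_g1// mule1.
- by move=> y _; rewrite lee_fin g1_ge0.
- by apply/measurable_EFinP; exact: measurable_g1_cst.
Qed.

Lemma integrable_g1_mul (s t x z : R) : 0 < s -> 0 < t ->
  leb.-integrable setT (fun y => (g1 s (y - x) * g1 t (z - y))%:E).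
Proof.
move=> s0 t0; apply/integrableP; split.
  apply/measurable_EFinP; apply: measurable_funM; first exact: measurable_g1_cst.
  by apply: measurable_g1 => //; exact: measurable_funB.
under eq_integral do rewrite gee0_abs ?lee_fin ?mulr_ge0 ?g1_ge0//.
by rewrite integral_g1_mul// ltry.
Qed.

Lemma continuous_g1 s : continuous (g1 s : R -> R).
Proof.
move=> x; apply: cvgM; first exact: cvg_cst.
apply: continuous_comp; last exact: continuous_expR.
apply: cvgM; last exact: cvg_cst.
by apply: cvgN; exact: sqr_continuous.
Qed.

Lemma continuous_p s x : continuous (p s x : R -> R).
Proof.
move=> y; apply: cvgB.
- apply: (@continuous_comp _ _ _ (fun y => y - x) (g1 s)); last exact: continuous_g1.
  by apply: cvgB; [exact: cvg_id|exact: cvg_cst].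
- apply: (@continuous_comp _ _ _ (fun y => y + x) (g1 s)); last exact: continuous_g1.
  by apply: cvgD; [exact: cvg_id|exact: cvg_cst].
Qed.

Lemma integral_even (f : R -> R) : continuous f -> (forall x, 0 <= f x) ->
  f =1 f \o -%R -> (\int[leb]_x (f x)%:E = 2%:E * \int[leb]_(x in D) (f x)%:E)%E.
Proof.
move=> cf f0 fN; rewrite ge0_symfun_integralT//; congr (_ * _)%E.
rewrite -set_itvcy /D integral_itv_obnd_cbnd//.
by apply/measurable_EFinP; apply: measurable_funS (continuous_measurable_fun cf).
Qed.

(** The product of two absorbed kernels is even in the middle variable, so the
    integral over [D] is half of a sum of four Gaussian convolutions. *)
Lemma chapman_kolmogorov (s t x z : R) : 0 < s -> 0 < t -> 0 < x -> 0 < z ->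
  (\int[leb]_(y in D) (p s x y * p t y z)%:E = (p (s + t) x z)%:E)%E.
Proof.
move=> s0 t0 x0 z0.
have f0 y : 0 <= p s x y * p t y z.
  have [y0|/ltW y0] := leP 0 y; first by rewrite mulr_ge0// p_ge0// ltW.
  rewrite -(opprK y) (pNr s) (pC t) (pNr t) mulrNN (pC t).
  by rewrite mulr_ge0// p_ge0// ?oppr_ge0// ltW.
have cf : continuous (fun y => p s x y * p t y z).
  move=> y; apply: cvgM; first exact: continuous_p.
  under eq_fun do rewrite pC.
  by rewrite pC; exact: continuous_p.
have fN : (fun y => p s x y * p t y z) =1 (fun y => p s x y * p t y z) \o -%R.
  by move=> y /=; rewrite [in RHS]pNr (pC t (- y)) pNr mulrNN (pC t z).
have := integral_even cf f0 fN.
have -> : (\int[leb]_y (p s x y * p t y z)%:E = (2 * p (s + t) x z)%:E)%E.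
  have fE y : ((p s x y * p t y z)%:E =
      ((g1 s (y - x) * g1 t (z - y))%:E - (g1 s (y - x) * g1 t (- z - y))%:E) +
      ((g1 s (y - (- x)) * g1 t (- z - y))%:E - (g1 s (y - (- x)) * g1 t (z - y))%:E))%E.
    rewrite -!EFinB -EFinD; congr EFin; rewrite /p opprK -(g1N t (z + y)).
    by rewrite opprD; ring.
  under eq_integral do rewrite fE.
  have I a b := integrable_g1_mul a b s0 t0.
  rewrite integralD//; [|exact: integrableB|exact: integrableB].
  rewrite !integralB// !integral_g1_mul// -!EFinB -EFinD; congr EFin.
  have -> : g1 (s + t) (- z - x) = g1 (s + t) (z + x) by rewrite -opprD g1N.
  have -> : g1 (s + t) (- z - - x) = g1 (s + t) (z - x) by rewrite -opprD g1N.
  by rewrite /p opprK; ring.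
move=> /esym h.
by apply/le_anti/andP; split; rewrite -(@lee_pmul2l _ 2%:E)// h EFinM.
Qed.

End kernel_measurability.

(** * The weight of the reference measure *)

Section weight.
Context {R : realType}.
Notation leb := (@lebesgue_measure R).
Implicit Types y : R.

Definition hw y : R := 1 - expR (- y ^+ 2).

Lemma hw_ge0 y : 0 <= hw y.
Proof. by rewrite subr_ge0 expR_le1 lerNl oppr0 sqr_ge0. Qed.

Lemma hw_gt0 y : 0 < y -> 0 < hw y.
Proof. by move=> y0; rewrite subr_gt0 expR_lt1 oppr_lt0 exprn_gt0. Qed.

Lemma hw_le1 y : hw y <= 1.
Proof. by rewrite lerBlDr lerDl expR_ge0. Qed.

Lemma hw_le_sqr y : hw y <= y ^+ 2.
Proof. by have := expR_ge1Dx (- y ^+ 2); rewrite /hw; lra. Qed.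

(** The vanishing of the density of [gamma] at 0 is compensated by the
    absorption factor of the kernel: this is what makes the semigroup bounded
    on the weighted space. *)
Lemma cap1_sqr_le y : 0 < y -> cap1 y ^+ 2 <= 2 * hw y.
Proof.
move=> y0; have y20 : 0 < y ^+ 2 by rewrite exprn_gt0.
have : expR (- y ^+ 2) <= (1 + y ^+ 2)^-1.
  by rewrite expRN lef_pV2 ?posrE ?expR_gt0 ?expR_ge1Dx// addr_gt0.
have : (1 + y ^+ 2) * (1 + y ^+ 2)^-1 = 1 by rewrite mulfV// gt_eqF// addr_gt0.
have : 0 <= (1 + y ^+ 2)^-1 by rewrite invr_ge0 addr_ge0// ltW.
rewrite /hw; move: (expR _) (_^-1) => e q q0 qE eq.
have : cap1 y ^+ 2 <= 2 * (1 - q).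
  have qu : 2 * (1 - q) = 2 * (y ^+ 2 * q) by lra.
  rewrite /cap1; have [y1|/ltW y1] := leP 1 y.
    have : 1 <= y ^+ 2 by rewrite exprn_ege1.
    by move=> /(ler_wpM2r q0); lra.
  have y21 : y ^+ 2 <= 1 by rewrite exprn_ile1// ltW.
  by rewrite qu; have := ler_wpM2r q0 y21; nra.
by move/le_trans; apply; rewrite ler_pM2l// lerB.
Qed.

Lemma measurable_hw : measurable_fun setT (hw : R -> R).
Proof.
apply: measurable_funB => //; apply: measurableT_comp => //.
by apply: measurableT_comp => //; exact: measurable_funX.
Qed.

Lemma measurable_cap1 : measurable_fun setT (cap1 : R -> R).
Proof. exact: measurable_minr. Qed.

Local Open Scope ereal_scope.

Lemma integral_gamma (f : R -> \bar R) : (forall x, 0 <= f x) ->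
  measurable_fun setT f ->
  \int[gamma]_x f x = \int[leb]_(x in D) ((hw x)%:E * f x).
Proof.
move=> f0 mf; have mD := @measurable_D R.
pose hD (x : measurableTypeR R) : R := (hw x * \1_(@D R) x)%R.
have mE A : measurable A -> @gamma R A = \int[leb]_(x in A) (hD x)%:E.
  move=> mA; rewrite /gamma integral_mkcondr; apply: eq_integral => x _.
  by rewrite epatch_indic /hD EFinM.
rewrite (@integral_density _ _ _ (@gamma R) leb hD)//.
- rewrite [RHS]integral_mkcond; apply: eq_integral => x _.
  by rewrite epatch_indic /hD EFinM muleAC.
- by move=> x; rewrite /hD mulr_ge0// ?hw_ge0.
- by apply: measurable_funM; [exact: measurable_hw|exact: measurable_indic].
Qed.

Lemma gamma_setCD : @gamma R (~` D) = 0.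
Proof. by rewrite /gamma setICl integral_set0. Qed.

(** The density of [gamma] is positive on [D], so the null sets of [gamma] are
    the sets whose trace on [D] is Lebesgue null. *)
Lemma ae_gammaP (P : R -> Prop) :
  {ae gamma, forall x, P x} <-> {ae leb, forall x, D x -> P x}.
Proof.
have mD := @measurable_D R.
have mhE : measurable_fun setT (fun x : R => (hw x)%:E).
  by apply/measurable_EFinP; exact: measurable_hw.
split=> -[N [mN N0 PN]].
- exists (N `&` D); split; first exact: measurableI.
  + move: N0; rewrite /gamma => h0.
    have mND : measurable (N `&` D) by exact: measurableI.
    have : ae_eq leb (N `&` D) (fun x : R => (hw x)%:E) (cst 0).
      apply/ae_eq_integral_abs => //; first exact: measurable_funS mhE.
      by under eq_integral do rewrite gee0_abs ?lee_fin ?hw_ge0//.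
    move=> [Z [mZ Z0 hZ]]; apply: (subset_measure0 _ _ _ Z0) => //.
    move=> x [Nx Dx]; apply: hZ => /=; apply/not_implyP; split => //.
    by case=> /eqP; rewrite gt_eqF// hw_gt0// -D_gt0.
  + move=> x /= /not_implyP[Dx nPx]; split => //; exact: PN.
- exists (N `|` ~` D); split.
  + by apply: measurableU => //; exact: measurableC.
  + apply/eqP; rewrite eq_le measure_ge0 andbT.
    have -> : @gamma R (N `|` ~` D) = \int[leb]_(y in N `&` D) (hw y)%:E.
      by rewrite /gamma setIUl setICl setU0.
    have mND : measurable (N `&` D) by exact: measurableI.
    apply: (@le_trans _ _ (\int[leb]_(y in N `&` D) (cst 1%E) y)).
      apply: ge0_le_integral => //.
      - by move=> x _; rewrite lee_fin hw_ge0.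
      - exact: measurable_funS mhE.
      - by move=> x _; rewrite lee_fin hw_le1.
    rewrite integral_cst// mul1e -N0 le_measure ?inE//; exact: subIsetl.
  + move=> x /= nPx; case: (pselect (D x)) => Dx; last by right.
    by left; apply: PN => /= h; exact/nPx/h.
Qed.

End weight.

(** * The semigroup on weighted square-integrable functions *)

Section semigroup.
Context {R : realType}.
Notation leb := (@lebesgue_measure R).
Implicit Types (f : R -> R) (s t x y : R).
Local Open Scope ereal_scope.

Let mD := @measurable_D R.

Definition Tint t f x : \bar R := \int[leb]_(y in D) (p t x y * f y)%:E.

Definition sqnorm f : \bar R := \int[leb]_(y in D) (hw y * f y ^+ 2)%:E.

Lemma D_p_ge0 t x y : (0 < t)%R -> D x -> D y -> (0 <= p t x y)%R.
Proof. by rewrite !D_gt0 => t0 x0 y0; rewrite p_ge0// ltW. Qed.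

Lemma Tint_ge0 t f x : (forall y, 0 <= f y)%R -> (0 < t)%R -> D x -> 0 <= Tint t f x.
Proof.
move=> f0 t0 xD; apply: integral_ge0 => y yD.
by rewrite lee_fin mulr_ge0// D_p_ge0.
Qed.

Lemma measurable_Tint t f : (forall y, 0 <= f y)%R -> measurable_fun setT f ->
  (0 < t)%R -> measurable_fun D (Tint t f).
Proof.
move=> f0 mf t0; apply: (@measurable_integral_on _ _ _ _ _ leb) => //.
- apply/measurable_EFinP; apply: measurable_funM.
    apply: (@measurable_p R _ _ _ (cst t) fst snd) => //;
      [exact: measurableX|exact: measurable_funTS|exact: measurable_funTS].
  by apply: measurable_funTS; exact: (measurableT_comp mf measurable_snd).
- by move=> x y xD yD; rewrite lee_fin mulr_ge0// D_p_ge0.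
Qed.

(** Young's inequality with the weights of [p_le_cap1]: a square-integrable
    function is integrable against the kernel, locally uniformly in time. *)
Lemma p_mul_le t0 t1 : (0 < t0 -> t0 <= t1 -> exists2 C : R, 0 < C &
  forall t x y a, t0 <= t <= t1 -> 0 < x -> 0 < y -> 0 <= a ->
    p t x y * a <= C * (hw y * a ^+ 2 + g1 (2 * t1) (y - x)))%R.
Proof.
move=> t00 t01; have t10 := lt_le_trans t00 t01.
have [C C0 pC] := p_le_cap1 t00 t01.
have t120 : (0 < 2 * t1)%R by rewrite mulr_gt0.
pose c := ((Num.sqrt (2 * pi * (2 * t1)))^-1)%R.
have c0 : (0 < c)%R by rewrite invr_gt0 sqrt2pi_gt0.
exists (C * (2 + c))%R; first by rewrite mulr_gt0// addr_gt0.
move=> t x y a tt x0 y0 a0.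
apply: (le_trans (ler_wpM2r a0 (pC _ _ _ tt x0 y0))).
have b0 := cap1_gt0 y0.
have := cap1_sqr_le y0; have := g1_le (y - x)%R t120; rewrite -/c.
have := g1_ge0 (2 * t1)%R (y - x)%R.
move: (g1 _ _) (cap1 y) (hw y) (hw_ge0 y) b0 => g b h h0 b0 g0 gc bh.
rewrite -!mulrA ler_wpM2l ?(ltW C0)//.
have h1 : (b * (g * a) <= b ^+ 2 * a ^+ 2 + g ^+ 2)%R by nra.
have h2 : (b ^+ 2 * a ^+ 2 <= 2 * h * a ^+ 2)%R by rewrite ler_wpM2r// sqr_ge0.
have h3 : (g ^+ 2 <= c * g)%R by rewrite expr2 ler_wpM2r.
have h4 : (0 <= c * (h * a ^+ 2))%R by rewrite !mulr_ge0// ?sqr_ge0// ltW.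
nra.
Qed.

Lemma measurable_hwsqr f : measurable_fun setT f ->
  measurable_fun setT (fun y => hw y * f y ^+ 2)%R.
Proof.
by move=> mf; apply: measurable_funM;
  [exact: measurable_hw|exact: measurable_funX].
Qed.

Lemma sqnorm_dominant_lty f s m : measurable_fun setT f -> (0 < s)%R ->
  sqnorm f < +oo ->
  \int[leb]_(y in D) (hw y * f y ^+ 2 + g1 s (y - m))%:E < +oo.
Proof.
move=> mf s0 foo; under eq_integral do rewrite EFinD.
rewrite ge0_integralD//.
- by rewrite lte_add_pinfty// (le_lt_trans (integral_g1_D _ s0))// ltry.
- by move=> y _; rewrite lee_fin mulr_ge0 ?hw_ge0 ?sqr_ge0.
- by apply/measurable_EFinP; apply: measurable_funTS; exact: measurable_hwsqr.
- by move=> y _; rewrite lee_fin g1_ge0.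
- by apply/measurable_EFinP; exact: measurable_g1_cst.
Qed.

Lemma measurable_pM t f x : (0 < t)%R -> measurable_fun setT f ->
  measurable_fun D (fun y => (p t x y * f y)%:E).
Proof.
move=> t0 mf; apply/measurable_EFinP; apply: measurable_funM.
  exact: measurable_p_cst.
exact: measurable_funTS.
Qed.

Lemma Tint_bounded t0 t1 f x : (forall y, 0 <= f y)%R -> measurable_fun setT f ->
  (0 < t0)%R -> (t0 <= t1)%R -> D x -> sqnorm f < +oo ->
  exists C : R, forall t, (t0 <= t <= t1)%R -> Tint t f x <= C%:E.
Proof.
move=> f0 mf t00 t01 xD foo; have [C C0 pC] := p_mul_le t00 t01.
have t10 := lt_le_trans t00 t01; have t20 : (0 < 2 * t1)%R by rewrite mulr_gt0.
pose I := \int[leb]_(y in D) (C * (hw y * f y ^+ 2 + g1 (2 * t1) (y - x)))%:E.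
have Cg0 y : 0 <= (C * (hw y * f y ^+ 2 + g1 (2 * t1) (y - x)))%:E.
  by rewrite lee_fin mulr_ge0 ?(ltW C0)// addr_ge0 ?g1_ge0// mulr_ge0 ?hw_ge0 ?sqr_ge0.
have mI : measurable_fun D (fun y => hw y * f y ^+ 2 + g1 (2 * t1) (y - x))%R.
  apply: measurable_funD; last exact: measurable_g1_cst.
  by apply: measurable_funTS; exact: measurable_hwsqr.
have Ioo : I \is a fin_num.
  rewrite ge0_fin_numE; last by apply: integral_ge0 => y _; exact: Cg0.
  rewrite /I; under eq_integral do rewrite EFinM.
  rewrite ge0_integralZl_EFin ?(ltW C0)//.
  - by apply: lte_mul_pinfty; rewrite ?lee_fin ?(ltW C0)//; exact: sqnorm_dominant_lty.
  - by move=> y _; rewrite lee_fin addr_ge0 ?g1_ge0// mulr_ge0 ?hw_ge0 ?sqr_ge0.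
  - exact/measurable_EFinP.
exists (fine I) => t tt; have tgt0 : (0 < t)%R by case/andP: tt => /(lt_le_trans t00).
rewrite fineK//; apply: ge0_le_integral => //.
- by move=> y yD; rewrite lee_fin mulr_ge0// D_p_ge0.
- exact: measurable_pM.
- by apply/measurable_EFinP; exact: measurable_funM.
- by move=> y yD; rewrite lee_fin pC// -D_gt0.
Qed.

Lemma Tint_lty t f x : (forall y, 0 <= f y)%R -> measurable_fun setT f ->
  (0 < t)%R -> D x -> sqnorm f < +oo -> Tint t f x < +oo.
Proof.
move=> f0 mf t0 xD foo; have [C hC] := Tint_bounded f0 mf t0 (lexx t) xD foo.
by rewrite (le_lt_trans (hC t _)) ?ltry// !lexx.
Qed.

Lemma Tint_fin_num t f x : (forall y, 0 <= f y)%R -> measurable_fun setT f ->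
  (0 < t)%R -> D x -> sqnorm f < +oo -> Tint t f x \is a fin_num.
Proof. by move=> *; rewrite ge0_fin_numE ?Tint_ge0// Tint_lty. Qed.

Lemma integral_p_le t C y : (0 < t)%R -> (0 < y)%R ->
  (forall x y, 0 < x -> 0 < y -> p t x y <= C * cap1 y * g1 (2 * t) (y - x))%R ->
  (0 <= C)%R ->
  \int[leb]_(x in D) (p t x y)%:E <= (C * cap1 y)%:E.
Proof.
move=> t0 y0 pC C0; have t20 : (0 < 2 * t)%R by rewrite mulr_gt0.
have Cb : (0 <= C * cap1 y)%R by rewrite mulr_ge0// cap1_ge0// ltW.
apply: (@le_trans _ _ (\int[leb]_(x in D) ((C * cap1 y)%:E * (g1 (2 * t) (x - y))%:E))).
  apply: ge0_le_integral => //.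
  - by move=> x xD; rewrite lee_fin D_p_ge0// D_gt0.
  - by apply/measurable_EFinP; exact: measurable_p.
  - by apply/measurable_EFinP; apply: measurable_funM => //; exact: measurable_g1_cst.
  - by move=> x; rewrite D_gt0 => x0; rewrite -EFinM lee_fin -g1N opprB pC.
rewrite ge0_integralZl_EFin//.
- by rewrite -[leRHS]mule1 lee_wpmul2l ?lee_fin// integral_g1_D.
- by move=> x _; rewrite lee_fin g1_ge0.
- by apply/measurable_EFinP; exact: measurable_g1_cst.
Qed.

Lemma measurable_pfin t f : (forall y, 0 <= f y)%R -> measurable_fun setT f ->
  (0 < t)%R -> measurable_fun setT ((fine \o Tint t f) \_ D).
Proof.
move=> f0 mf t0; apply/(measurable_restrictT _ _).1 => //.
by apply: measurableT_comp => //; exact: measurable_Tint.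
Qed.

Lemma measurable_inv_cap1 : measurable_fun D (fun y : R => (cap1 y)^-1)%R.
Proof.
pose w (y : R) : R := expR (- ln (cap1 y)).
apply: (eq_measurable_fun w) => [y /[!inE]|].
  by rewrite D_gt0 => y0; rewrite /w expRN lnK// posrE cap1_gt0.
apply: measurable_funTS; apply: measurableT_comp => //; apply: measurableT_comp => //.
by apply: measurableT_comp; [exact: measurable_ln|exact: measurable_cap1].
Qed.

(** Cauchy-Schwarz against the kernel, obtained from Young's inequality with the
    optimal parameter, which is the value of the integral itself. *)
Lemma sqr_Tint_le t f x K : (0 < K)%R -> (0 < t)%R -> D x ->
  (forall y, 0 <= f y)%R -> measurable_fun setT f -> sqnorm f < +oo ->
  \int[leb]_(y in D) (p t x y / cap1 y)%:E <= K%:E ->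
  Tint t f x * Tint t f x <=
    K%:E * \int[leb]_(y in D) (p t x y * (cap1 y * f y ^+ 2))%:E.
Proof.
move=> K0 t0 xD f0 mf foo pK.
have := Tint_fin_num f0 mf t0 xD foo.
case E : (Tint t f x) => [A| |]// _.
have A0 : (0 <= A)%R by rewrite -lee_fin -E Tint_ge0.
set B := integral _ _ _.
have B0 : 0 <= B.
  apply: integral_ge0 => y yD; rewrite lee_fin mulr_ge0 ?D_p_ge0//.
  by rewrite mulr_ge0 ?sqr_ge0// cap1_ge0// -lee_fin lee_fin ltW// -D_gt0.
have [->|A1] := eqVneq A 0%R; first by rewrite mul0e mule_ge0// lee_fin ltW.
have {A1}A0 : (0 < A)%R by rewrite lt_neqAle eq_sym A1.
pose u y : R := (A / (2 * K) * (p t x y / cap1 y))%R.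
pose v y : R := (K / (2 * A) * (p t x y * (cap1 y * f y ^+ 2)))%R.
have mpD : measurable_fun D (p t x) by exact: measurable_p_cst.
have mb : measurable_fun D (@cap1 R) by apply: measurable_funTS; exact: measurable_cap1.
have mu' : measurable_fun D (fun y => (p t x y / cap1 y)%:E).
  by apply/measurable_EFinP; apply: measurable_funM => //; exact: measurable_inv_cap1.
have mv' : measurable_fun D (fun y => (p t x y * (cap1 y * f y ^+ 2))%:E).
  apply/measurable_EFinP; apply: measurable_funM => //; apply: measurable_funM => //.
  by apply: measurable_funTS; exact: measurable_funX.
have u0 y : D y -> (0 <= p t x y / cap1 y)%R.
  by move=> yD; rewrite divr_ge0 ?D_p_ge0// cap1_ge0// ltW// -D_gt0.
have v0 y : D y -> (0 <= p t x y * (cap1 y * f y ^+ 2))%R.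
  move=> yD; rewrite mulr_ge0 ?D_p_ge0// mulr_ge0 ?sqr_ge0//.
  by rewrite cap1_ge0// ltW// -D_gt0.
have AK : (0 <= A / (2 * K))%R by rewrite divr_ge0 ?mulr_ge0 ?ltW.
have KA : (0 <= K / (2 * A))%R by rewrite divr_ge0 ?mulr_ge0 ?ltW.
have : A%:E <= (A / (2 * K))%:E * K%:E + (K / (2 * A))%:E * B.
  rewrite -E; apply: (@le_trans _ _ (\int[leb]_(y in D) (u y + v y)%:E)).
    apply: ge0_le_integral => //.
    - by move=> y yD; rewrite lee_fin mulr_ge0// D_p_ge0.
    - exact: measurable_pM.
    - apply/measurable_EFinP; apply: measurable_funD; apply: measurable_funM => //;
        exact/measurable_EFinP.
    move=> y yD; rewrite lee_fin /u /v.
    have pp := D_p_ge0 t0 xD yD; have b0 : (0 < cap1 y)%R by rewrite cap1_gt0// -D_gt0.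
    have -> : (A / (2 * K) * (p t x y / cap1 y) +
       K / (2 * A) * (p t x y * (cap1 y * f y ^+ 2)) =
       p t x y * f y + p t x y * (2 * A * K * cap1 y)^-1 * (A - K * cap1 y * f y) ^+ 2)%R.
      by field; rewrite !gt_eqF.
    rewrite lerDl mulr_ge0 ?sqr_ge0// mulr_ge0// invr_ge0.
    by rewrite !mulr_ge0// ltW.
  under eq_integral do rewrite EFinD.
  rewrite ge0_integralD//.
  - under eq_integral do rewrite EFinM.
    rewrite ge0_integralZl_EFin//.
    under [X in _ + X <= _]eq_integral do rewrite EFinM.
    rewrite ge0_integralZl_EFin//.
    by rewrite leeD2r// lee_wpmul2l// lee_fin.
  - by move=> y yD; rewrite lee_fin mulr_ge0// u0.
  - by apply/measurable_EFinP; apply: measurable_funM => //; exact/measurable_EFinP.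
  - by move=> y yD; rewrite lee_fin mulr_ge0// v0.
  - by apply/measurable_EFinP; apply: measurable_funM => //; exact/measurable_EFinP.
rewrite -EFinM; case: B B0 => [B| |]//; last first.
  by move=> _ _; rewrite mulry gtr0_sg// mul1e leey.
rewrite -!EFinM -EFinD !lee_fin => B0 h.
have := ler_wpM2l (ltW A0) h.
have -> : (A * (A / (2 * K) * K + K / (2 * A) * B) = A * A / 2 + K * B / 2)%R.
  by field; rewrite !gt_eqF.
by nra.
Qed.

(** Boundedness of the semigroup on the weighted space, by Schur's test with
    the test function [1 / min(1, y)]. *)
Lemma sqnorm_Tint_le t : (0 < t)%R -> exists2 C : R, (0 < C)%R &
  forall f, (forall y, 0 <= f y)%R -> measurable_fun setT f -> sqnorm f < +oo ->
  sqnorm ((fine \o Tint t f) \_ D) <= C%:E * sqnorm f.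
Proof.
move=> t0; have [C C0 pC] := p_le_cap1 t0 (lexx t).
have {}pC x y : (0 < x -> 0 < y -> p t x y <= C * cap1 y * g1 (2 * t) (y - x))%R.
  by move=> x0 y0; rewrite pC// !lexx.
exists (C * C * 2)%R; first by rewrite !mulr_gt0.
move=> f f0 mf foo; have t20 : (0 < 2 * t)%R by rewrite mulr_gt0.
have pint x : D x -> \int[leb]_(y in D) (p t x y / cap1 y)%:E <= C%:E.
  move=> xD; apply: (@le_trans _ _ (\int[leb]_(y in D) (C%:E * (g1 (2 * t) (y - x))%:E))).
    apply: ge0_le_integral => //.
    - by move=> y yD; rewrite lee_fin divr_ge0 ?D_p_ge0// cap1_ge0// ltW// -D_gt0.
    - apply/measurable_EFinP; apply: measurable_funM; first exact: measurable_p_cst.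
      exact: measurable_inv_cap1.
    - by apply/measurable_EFinP; apply: measurable_funM => //; exact: measurable_g1_cst.
    - move=> y; move: xD; rewrite !D_gt0 => x0 y0; rewrite -EFinM lee_fin.
      by rewrite ler_pdivrMr ?cap1_gt0// mulrAC pC.
  rewrite ge0_integralZl_EFin ?(ltW C0)//.
  - by rewrite -[leRHS]mule1 lee_wpmul2l ?lee_fin ?(ltW C0)// integral_g1_D.
  - by move=> y _; rewrite lee_fin g1_ge0.
  - by apply/measurable_EFinP; exact: measurable_g1_cst.
have mF := measurable_pfin f0 mf t0.
have mpp : measurable_fun (D `*` D) (fun z : R * R => p t z.1 z.2).
  by apply: (@measurable_p R _ _ _ (cst t) fst snd) => //;
      [exact: measurableX|exact: measurable_funTS|exact: measurable_funTS].
have mcf : measurable_fun setT (fun y => cap1 y * f y ^+ 2)%R.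
  by apply: measurable_funM; [exact: measurable_cap1|exact: measurable_funX].
have cf0 y : D y -> (0 <= cap1 y * f y ^+ 2)%R.
  by move=> yD; rewrite mulr_ge0 ?sqr_ge0// cap1_ge0// ltW// -D_gt0.
have mpc : measurable_fun (D `*` D)
    (fun z : R * R => (p t z.1 z.2 * (cap1 z.2 * f z.2 ^+ 2))%:E).
  apply/measurable_EFinP; apply: measurable_funM => //.
  by apply: measurable_funTS; exact: (measurableT_comp mcf measurable_snd).
have pc0 (x y : R) : D x -> D y -> 0 <= (p t x y * (cap1 y * f y ^+ 2))%:E.
  by move=> xD yD; rewrite lee_fin mulr_ge0 ?D_p_ge0 ?cf0.
apply: (@le_trans _ _ (\int[leb]_(x in D) (C%:E *
    \int[leb]_(y in D) (p t x y * (cap1 y * f y ^+ 2))%:E))).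
  apply: ge0_le_integral => //.
  - by move=> y _; rewrite lee_fin mulr_ge0 ?hw_ge0 ?sqr_ge0.
  - by apply/measurable_EFinP; apply: measurable_funTS; exact: measurable_hwsqr.
  - apply: emeasurable_funM => //.
    exact: (@measurable_integral_on _ _ _ _ _ leb).
  - move=> x xD; apply: le_trans (sqr_Tint_le C0 t0 xD f0 mf foo (pint _ xD)).
    rewrite patchE mem_set//= -(fineK (Tint_fin_num f0 mf t0 xD foo)).
    rewrite -EFinM lee_fin -expr2 -[leRHS]mul1r.
    by rewrite ler_wpM2r ?sqr_ge0// hw_le1.
rewrite ge0_integralZl_EFin ?(ltW C0)//; last 2 first.
- by move=> x xD; apply: integral_ge0 => y yD; exact: pc0.
- exact: (@measurable_integral_on _ _ _ _ _ leb).
rewrite (@tonelli_on _ _ _ _ _ leb leb)//.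
rewrite -mulrA EFinM -muleA lee_wpmul2l ?lee_fin ?(ltW C0)//.
apply: (@le_trans _ _ (\int[leb]_(y in D) ((C * 2)%:E * (hw y * f y ^+ 2)%:E))).
  apply: ge0_le_integral => //.
  - by move=> y yD; apply: integral_ge0 => x xD; exact: pc0.
  - exact: (@measurable_integral_on_fst _ _ _ _ _ leb).
  - apply: emeasurable_funM => //.
    by apply/measurable_EFinP; apply: measurable_funTS; exact: measurable_hwsqr.
  move=> y yD; have y0 : (0 < y)%R by rewrite -D_gt0.
  under eq_integral do rewrite mulrC EFinM.
  rewrite ge0_integralZl_EFin ?cf0//; last 2 first.
  - by move=> x xD; rewrite lee_fin D_p_ge0.
  - by apply/measurable_EFinP; exact: measurable_p.
  apply: (@le_trans _ _ ((cap1 y * f y ^+ 2)%:E * (C * cap1 y)%:E)).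
    by rewrite lee_wpmul2l ?lee_fin ?cf0//; apply: integral_p_le => //; exact: ltW.
  rewrite -!EFinM lee_fin.
  rewrite [leLHS](_ : _ = C * f y ^+ 2 * cap1 y ^+ 2)%R; last by ring.
  rewrite [leRHS](_ : _ = C * f y ^+ 2 * (2 * hw y))%R; last by ring.
  by rewrite ler_wpM2l ?cap1_sqr_le// mulr_ge0 ?sqr_ge0// ltW.
rewrite ge0_integralZl_EFin//.
- by move=> y _; rewrite lee_fin mulr_ge0 ?hw_ge0 ?sqr_ge0.
- by apply/measurable_EFinP; apply: measurable_funTS; exact: measurable_hwsqr.
- by rewrite mulr_ge0// ltW.
Qed.

End semigroup.

Section semigroup_laws.
Context {R : realType}.
Notation leb := (@lebesgue_measure R).
Implicit Types (f : R -> R) (s t x y z : R).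

Let mD := @measurable_D R.

Lemma p_slope0 s y : 0 < s -> p s z y / z @[z --> 0^'] --> 2 * k s y.
Proof.
move=> s0; have [df dE] := is_derive_p y s0.
have p0 : p s 0 y = 0 by rewrite /p subr0 addr0 subrr.
rewrite -dE; apply: cvg_trans (df) => /=; apply: near_eq_cvg.
by near=> z; rewrite /= p0 subr0 addr0 /GRing.scale/= mulr1 mulrC.
Unshelve. all: by end_near. Qed.

Lemma p_slope0_seq s y : 0 < s -> p s n.+1%:R^-1 y / n.+1%:R^-1 @[n --> \oo] --> 2 * k s y.
Proof.
move=> s0; have /cvgr_dnbhsP := @p_slope0 s y s0.
by apply; split => [n|]; [rewrite invr_eq0|exact: cvg_harmonic].
Qed.

Local Open Scope ereal_scope.

Lemma Tint_semigroup s t f x : (0 < s)%R -> (0 < t)%R -> D x ->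
  (forall y, 0 <= f y)%R -> measurable_fun setT f ->
  \int[leb]_(y in D) ((p s x y)%:E * Tint t f y) = Tint (s + t) f x.
Proof.
move=> s0 t0 xD f0 mf.
have mpp : measurable_fun (D `*` D) (fun z : R * R => p t z.1 z.2).
  by apply: (@measurable_p R _ _ _ (cst t) fst snd) => //;
      [exact: measurableX|exact: measurable_funTS|exact: measurable_funTS].
transitivity (\int[leb]_(y in D) \int[leb]_(z in D) (p s x y * (p t y z * f z))%:E).
  apply: eq_integral => y /[!inE] yD; rewrite /Tint.
  rewrite -ge0_integralZl_EFin ?D_p_ge0//.
  - by move=> z zD; rewrite lee_fin mulr_ge0// D_p_ge0.
  - exact: measurable_pM.
rewrite (@tonelli_on _ _ _ _ _ leb leb)//; last 2 first.
- apply/measurable_EFinP; apply: measurable_funM; last first.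
    apply: measurable_funM => //.
    by apply: measurable_funTS; exact: (measurableT_comp mf measurable_snd).
  by apply: (@measurable_p R _ _ _ (cst s) (cst x) fst) => //;
      [exact: measurableX|exact: measurable_funTS].
- by move=> y z yD zD; rewrite lee_fin !mulr_ge0// D_p_ge0.
apply: eq_integral => z /[!inE] zD.
under eq_integral do rewrite mulrA mulrC EFinM.
rewrite ge0_integralZl_EFin//.
- by rewrite chapman_kolmogorov//; [rewrite -EFinM mulrC|rewrite -D_gt0..].
- by move=> y yD; rewrite lee_fin mulr_ge0// D_p_ge0.
- apply/measurable_EFinP; apply: measurable_funM; exact: measurable_p.
Qed.

Definition Uint (mu : {measure set (measurableTypeR R) -> \bar R}) t y : \bar R :=
  \int[mu]_(z in D) (p t z y)%:E.

Lemma Uint_ge0 mu t y : (0 < t)%R -> D y -> 0 <= Uint mu t y.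
Proof. by move=> t0 yD; apply: integral_ge0 => z zD; rewrite lee_fin D_p_ge0. Qed.

Lemma Uint_semigroup (mu : {sigma_finite_measure set (measurableTypeR R) -> \bar R}) s t x :
  (0 < s)%R -> (0 < t)%R -> D x ->
  \int[leb]_(y in D) ((p s x y)%:E * Uint mu t y) = Uint mu (s + t) x.
Proof.
move=> s0 t0 xD.
transitivity (\int[leb]_(y in D) \int[mu]_(z in D) (p s x y * p t y z)%:E).
  apply: eq_integral => y /[!inE] yD; rewrite /Uint.
  under [RHS]eq_integral do rewrite (pC t) EFinM.
  rewrite ge0_integralZl_EFin ?D_p_ge0//.
  - by move=> z zD; rewrite lee_fin D_p_ge0.
  - by apply/measurable_EFinP; exact: measurable_p.
rewrite (@tonelli_on _ _ _ _ _ leb mu)//; last 2 first.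
- apply/measurable_EFinP; apply: measurable_funM.
    by apply: (@measurable_p R _ _ _ (cst s) (cst x) fst) => //;
      [exact: measurableX|exact: measurable_funTS].
  by apply: (@measurable_p R _ _ _ (cst t) fst snd) => //;
      [exact: measurableX|exact: measurable_funTS|exact: measurable_funTS].
- by move=> y z yD zD; rewrite lee_fin !mulr_ge0// D_p_ge0.
apply: eq_integral => z /[!inE] zD.
by rewrite chapman_kolmogorov//; [rewrite pC|rewrite -D_gt0..].
Qed.

(** The entrance law [k] is the limit of the normalized kernels started near 0,
    so its semigroup property is the limit of the Chapman-Kolmogorov
    equation. *)
Lemma k_semigroup s t x : (0 < s)%R -> (0 < t)%R -> D x ->
  \int[leb]_(y in D) (p t x y * k s y)%:E = (k (t + s) x)%:E.
Proof.
move=> s0 t0 xD; have x0 : (0 < x)%R by rewrite -D_gt0.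
pose z n : R := (n.+1%:R^-1)%R.
have z0 n : (0 < z n)%R by rewrite invr_gt0.
pose F n y : \bar R := (p t x y * (p s (z n) y / z n))%:E.
pose c := ((Num.sqrt (2 * pi * s))^-1)%R.
have c0 : (0 < c)%R by rewrite invr_gt0 sqrt2pi_gt0.
pose C := (2 / s * c * (1 + x) * ((2 + t) * Num.sqrt (2 * t / t)))%R.
have t20 : (0 < 2 * t)%R by rewrite mulr_gt0.
have FE n : \int[leb]_(y in D) F n y = (p (t + s) (z n) x / z n)%:E.
  transitivity (\int[leb]_(y in D) ((z n)^-1%:E * (p t x y * p s y (z n))%:E)).
    by apply: eq_integral => y _; rewrite /F -EFinM (pC s y); congr EFin; rewrite mulrA mulrC.
  rewrite ge0_integralZl_EFin ?invr_ge0 ?(ltW (z0 _))//.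
  - by rewrite chapman_kolmogorov// -EFinM mulrC pC.
  - by move=> y yD; rewrite lee_fin mulr_ge0// D_p_ge0// D_gt0.
  - apply/measurable_EFinP; apply: measurable_funM; exact: measurable_p.
have F_cvg : \int[leb]_(y in D) F n y @[n --> \oo] -->
    \int[leb]_(y in D) (p t x y * (2 * k s y))%:E.
  apply: (@dominated_cvg _ _ _ leb _ mD _ _ (fun y => (C * g1 (2 * t) (y - x))%:E)) => //.
  - move=> n; apply/measurable_EFinP; apply: measurable_funM; first exact: measurable_p.
    by apply: measurable_funM => //; exact: measurable_p.
  - move=> y yD; apply: cvg_EFin; first exact: nearW.
    by apply: cvgM; [exact: cvg_cst|exact: p_slope0_seq].
  - exact: (@integrableZl _ _ _ leb D mD C _ (integrable_g1_D x t20)).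
  - move=> n y yD; have y0 : (0 < y)%R by rewrite -D_gt0.
    have zn := z0 n.
    rewrite gee0_abs ?lee_fin; last first.
      by rewrite mulr_ge0 ?D_p_ge0// divr_ge0 ?(ltW zn)// p_ge0// ltW.
    rewrite (@le_trans _ _ (p t x y * (2 / s * c * y)))%R//.
      rewrite ler_wpM2l ?D_p_ge0// ler_pdivrMr// (le_trans (p_le_Mg1 _ _ s0))//.
      rewrite [leRHS](_ : _ = 2 * z n * y / s * c)%R; last by ring.
      by rewrite ler_wpM2l ?g1_le// !mulr_ge0 ?invr_ge0// ltW.
    apply: (@le_trans _ _ (g1 t (y - x) * (2 / s * c * ((1 + x) * (1 + `|y - x|))))%R).
      rewrite ler_pM ?p_le_g1 ?D_p_ge0//.
        by rewrite !mulr_ge0 ?invr_ge0// ltW.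
      rewrite ler_wpM2l ?mulr_ge0 ?invr_ge0 ?(ltW s0) ?(ltW c0)//.
      by have := ler_norm (y - x)%R; have := normr_ge0 (y - x)%R; nra.
    rewrite [leLHS](_ : _ = (2 / s * c * (1 + x)) * ((1 + `|y - x|) * g1 t (y - x)))%R; last by ring.
    rewrite /C -[leRHS]mulrA ler_wpM2l ?normM_g1_le//.
    by rewrite !mulr_ge0 ?invr_ge0 ?addr_ge0// ltW.
have : \int[leb]_(y in D) F n y @[n --> \oo] --> (2 * k (t + s) x)%:E.
  rewrite (_ : (fun n => _) = (fun n => (p (t + s) (z n) x / z n)%:E)); last first.
    by apply/funext => n; exact: FE.
  by apply: cvg_EFin; [exact: nearW|apply: p_slope0_seq; exact: addr_gt0].
move=> /(cvg_unique (@ereal_hausdorff R) F_cvg).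
under eq_integral do rewrite mulrCA EFinM.
rewrite ge0_integralZl_EFin//.
- by move=> h; apply/le_anti/andP; split; rewrite -(@lee_pmul2l _ 2%:E)// h EFinM.
- move=> y yD; rewrite lee_fin mulr_ge0 ?D_p_ge0// k_ge0// ltW//.
  by rewrite -D_gt0.
- apply/measurable_EFinP; apply: measurable_funM; first exact: measurable_p.
  exact: measurable_k.
Qed.

Lemma measurable_Uint (mu : {sigma_finite_measure set (measurableTypeR R) -> \bar R}) t :
  (0 < t)%R -> measurable_fun D (Uint mu t).
Proof.
move=> t0; apply: (@measurable_integral_on _ _ _ _ _ mu) => //.
  apply/measurable_EFinP.
  by apply: (@measurable_p R _ _ _ (cst t) snd fst) => //;
    [exact: measurableX|exact: measurable_funTS|exact: measurable_funTS].
by move=> y z yD zD; rewrite lee_fin D_p_ge0.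
Qed.

Section pair.
Variables (mu : {measure set (measurableTypeR R) -> \bar R}) (a : R).

Definition Vint t y : \bar R := (a * k t y)%:E + Uint mu t y.

Lemma Vint_ge0 t y : (0 <= a)%R -> (0 < t)%R -> D y -> 0 <= Vint t y.
Proof.
move=> a0 t0 yD; rewrite adde_ge0 ?Uint_ge0// lee_fin mulr_ge0// k_ge0// ltW//.
by rewrite -D_gt0.
Qed.

End pair.

Lemma measurable_Vint (mu : {sigma_finite_measure set (measurableTypeR R) -> \bar R}) a t :
  (0 < t)%R -> measurable_fun D (Vint mu a t).
Proof.
move=> t0; apply: emeasurable_funD; last exact: measurable_Uint.
by apply/measurable_EFinP; apply: measurable_funM => //; exact: measurable_k.
Qed.

Lemma Vint_semigroup (mu : {sigma_finite_measure set (measurableTypeR R) -> \bar R}) a s t x :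
  (0 <= a)%R -> (0 < s)%R -> (0 < t)%R -> D x ->
  \int[leb]_(y in D) ((p s x y)%:E * Vint mu a t y) = Vint mu a (s + t) x.
Proof.
move=> a0 s0 t0 xD.
have mp : measurable_fun D (fun y => (p s x y)%:E).
  by apply/measurable_EFinP; exact: measurable_p.
have k0 y : D y -> (0 <= k t y)%R by rewrite D_gt0 => /ltW; exact: k_ge0.
have mpk : measurable_fun D (fun y => (p s x y * k t y)%:E).
  apply/measurable_EFinP; apply: measurable_funM; [exact: measurable_p|exact: measurable_k].
transitivity (\int[leb]_(y in D) (a%:E * (p s x y * k t y)%:E +
                                  (p s x y)%:E * Uint mu t y)).
  apply: eq_integral => y /[!inE] yD; rewrite /Vint ge0_muleDr ?Uint_ge0//; last first.
    by rewrite lee_fin; apply: mulr_ge0 => //; exact: k0.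
  by rewrite -!EFinM mulrCA.
rewrite ge0_integralD//.
- rewrite Uint_semigroup// ge0_integralZl_EFin//.
  + by rewrite k_semigroup// -EFinM.
  + by move=> y yD; rewrite lee_fin; apply: mulr_ge0; [exact: D_p_ge0|exact: k0].
- move=> y yD; rewrite -EFinM lee_fin; apply: mulr_ge0 => //.
  by apply: mulr_ge0; [exact: D_p_ge0|exact: k0].
- exact: emeasurable_funM.
- by move=> y yD; rewrite mule_ge0 ?lee_fin ?D_p_ge0// Uint_ge0.
- by apply: emeasurable_funM => //; exact: measurable_Uint.
Qed.

(** The density of [gamma] is at most [y ^ 2], which brings the squared norm of
    [k s] down to the order [s^(-1/2)], integrable at [s = 0]. *)
Lemma sqnorm_k_le s : (0 < s)%R -> sqnorm (k s) <= (8 / Num.sqrt (2 * pi * s))%:E.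
Proof.
move=> s0; pose c := ((Num.sqrt (2 * pi * s))^-1)%R.
have c0 : (0 < c)%R by rewrite invr_gt0 sqrt2pi_gt0.
have pw y : (hw y * k s y ^+ 2 <= 8 * c * g1 s (y - 0))%R.
  apply: (@le_trans _ _ (y ^+ 2 * k s y ^+ 2)%R).
    by rewrite ler_wpM2r ?sqr_ge0// hw_le_sqr.
  pose u := (y ^+ 2 / (2 * s))%R.
  have u0 : (0 <= u)%R by rewrite divr_ge0 ?sqr_ge0// mulr_ge0// ltW.
  have -> : (y ^+ 2 * k s y ^+ 2 = 4 * c * u ^+ 2 * expR (- u) * g1 s (y - 0))%R.
    rewrite subr0 /k /g1 -/c mulNr -/u; have -> : (y ^+ 2 = u * (2 * s))%R.
      by rewrite /u; field; rewrite gt_eqF.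
    rewrite !exprMn (_ : y ^+ 2 = u * (2 * s))%R; last first.
      by rewrite /u; field; rewrite gt_eqF.
    by field; rewrite gt_eqF.
  rewrite ler_wpM2r ?g1_ge0// -mulrA (_ : 8 * c = 4 * c * 2)%R; last by ring.
  rewrite ler_wpM2l ?mulr_ge0 ?(ltW c0)// expRN ler_pdivrMr ?expR_gt0//.
  have := @expR_ge1Dxn R u 1 u0; rewrite (_ : 2`! = 2)%N//; nra.
apply: (@le_trans _ _ (\int[leb]_(y in D) ((8 * c)%:E * (g1 s (y - 0))%:E))).
  apply: ge0_le_integral => //.
  - by move=> y _; rewrite lee_fin mulr_ge0 ?hw_ge0 ?sqr_ge0.
  - apply/measurable_EFinP; apply: measurable_funM.
      by apply: measurable_funTS; exact: measurable_hw.
    by apply: measurable_funX; exact: measurable_k.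
  - by apply: emeasurable_funM => //; apply/measurable_EFinP; exact: measurable_g1_cst.
  - by move=> y _; rewrite -EFinM lee_fin pw.
have c80 : (0 <= 8 * c)%R by rewrite mulr_ge0// ltW.
rewrite ge0_integralZl_EFin//.
- by rewrite -[leRHS]mule1 lee_wpmul2l ?lee_fin// integral_g1_D.
- by move=> y _; rewrite lee_fin g1_ge0.
- by apply/measurable_EFinP; exact: measurable_g1_cst.
Qed.

Lemma ae_eq_Tint t f g x : (0 < t)%R -> measurable_fun setT f -> measurable_fun setT g ->
  {ae leb, forall y, D y -> f y = g y} -> Tint t f x = Tint t g x.
Proof.
move=> t0 mf mg fg; apply: ae_eq_integral => //.
- exact: measurable_pM.
- exact: measurable_pM.
- by apply: ae_mono fg => y fgy yD; rewrite fgy.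
Qed.

(** Right continuity in time of [T_t f(x)], by dominated convergence. *)
Lemma Tint_right_cvg t f x (s_ : nat -> R) : (0 < t)%R -> D x ->
  (forall y, 0 <= f y)%R -> measurable_fun setT f -> sqnorm f < +oo ->
  (forall n, 0 <= s_ n <= 1)%R -> (s_ n @[n --> \oo] --> (0:R))%R ->
  Tint (t + s_ n) f x @[n --> \oo] --> Tint t f x.
Proof.
move=> t0 xD f0 mf foo s01 scvg.
have tt1 : (t <= t + 1)%R by rewrite lerDl.
have t10 := lt_le_trans t0 tt1.
have t120 : (0 < 2 * (t + 1))%R by rewrite mulr_gt0.
have [C C0 pC] := p_mul_le t0 tt1.
pose G y := (C * (hw y * f y ^+ 2 + g1 (2 * (t + 1)) (y - x)))%:E.
have ts n : (t <= t + s_ n <= t + 1)%R by have := s01 n; lra.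
have ts0 n : (0 < t + s_ n)%R by have := ts n; lra.
apply: (@dominated_cvg _ _ _ leb _ mD _ _ G) => //.
- by move=> n; exact: measurable_pM.
- move=> y yD; apply: cvg_EFin; first exact: nearW.
  apply: cvgM; last exact: cvg_cst.
  have tscvg : (t + s_ n @[n --> \oo] --> t)%R.
    by rewrite -[X in _ --> X]addr0; apply: cvgD => //; exact: cvg_cst.
  have g1c v : (g1 (t + s_ n) v @[n --> \oo] --> g1 t v)%R.
    apply: cvgM.
      apply: cvgV; first by rewrite gt_eqF// sqrt2pi_gt0.
      apply: (@continuous_cvg _ _ _ _ _ _ (@Num.sqrt R)); first exact: sqrt_continuous.
      by apply: cvgM => //; exact: cvg_cst.
    apply: (@continuous_cvg _ _ _ _ _ _ (@expR R)); first exact: continuous_expR.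
    apply: cvgM; first exact: cvg_cst.
    apply: cvgV; first by rewrite gt_eqF// mulr_gt0.
    by apply: cvgM => //; exact: cvg_cst.
  by apply: cvgB.
- apply/integrableP; split.
    apply/measurable_EFinP; apply: measurable_funM => //.
    apply: measurable_funD; last exact: measurable_g1_cst.
    by apply: measurable_funTS; exact: measurable_hwsqr.
  under eq_integral => y _.
    rewrite gee0_abs; last first.
      by rewrite lee_fin mulr_ge0 ?(ltW C0)// addr_ge0 ?g1_ge0// mulr_ge0 ?hw_ge0 ?sqr_ge0.
    rewrite /G EFinM; over.
  rewrite ge0_integralZl_EFin ?(ltW C0)//.
  + by apply: lte_mul_pinfty; rewrite ?lee_fin ?(ltW C0)//; exact: sqnorm_dominant_lty.
  + by move=> y _; rewrite lee_fin addr_ge0 ?g1_ge0// mulr_ge0 ?hw_ge0 ?sqr_ge0.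
  + apply/measurable_EFinP; apply: measurable_funD; last exact: measurable_g1_cst.
    by apply: measurable_funTS; exact: measurable_hwsqr.
- move=> n y yD; rewrite gee0_abs ?lee_fin; last by rewrite mulr_ge0// D_p_ge0.
  by rewrite pC// -?D_gt0.
Qed.

End semigroup_laws.

(** * Vague compactness of bounded sequences of measures on the line *)

Section vague_compactness.
Context {R : realType}.

Lemma ultra_bounded_cvg I (U : set_system I) (UU : UltraFilter U) (u : I -> R) a b :
  (forall i, a <= u i <= b) -> exists2 l, a <= l <= b & u i @[i --> U] --> l.
Proof.
move=> uab; have := @segment_compact R a b; rewrite compact_ultra => /(_ (u @ U)).
have Uu : UltraFilter (u @ U).
  split; first exact: fmap_proper_filter.
  move=> G GF UG; apply/seteqP; split => // A GA.
  have [//|UnA] := in_ultra_setVsetC (u @^-1` A) UU.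
  have GnA : G (~` A) by exact: UG.
  by have [x []] := filter_ex (filterI GA GnA).
have Uab : (u @ U) `[a, b]%classic.
  change (U (u @^-1` `[a, b]%classic)).
  by apply: (@filterS _ U _ setT) => [i _ /=|]; [rewrite in_itv/=|exact: filterT].
by move=> /(_ Uu Uab)[l [/=]]; rewrite in_itv/= => ? ?; exists l.
Qed.

Lemma cvg_sum_ord T (U : set_system T) {FU : Filter U} n (u : nat -> T -> R)
    (l : nat -> R) : (forall j, u j i @[i --> U] --> l j) ->
  \sum_(j < n) u j i @[i --> U] --> \sum_(j < n) l j.
Proof.
move=> ul; elim: n => [|n ih].
  rewrite big_ord0 (_ : (fun i => _) = cst 0); first exact: cvg_cst.
  by apply/funext => i; rewrite big_ord0.
rewrite big_ord_recr (_ : (fun i => _) = (fun i => \sum_(j < n) u j i + u n i)).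
  exact: cvgD.
by apply/funext => i; rewrite big_ord_recr.
Qed.

(** Uniform continuity on compact sets: pairs of points violating it converge
    along an ultrafilter to a common limit. *)
Lemma heine (f : R -> R) (A e : R) : continuous f -> 0 < e -> exists2 d, 0 < d &
  forall x y, `|x| <= A -> `|x - y| <= d -> `|f x - f y| <= e.
Proof.
move=> cf e0; apply: contrapT => /forall2NP h.
have /choice [w hw] : forall n : nat, exists xy : R * R,
    [/\ `|xy.1| <= A, `|xy.1 - xy.2| <= n.+1%:R^-1 & e < `|f xy.1 - f xy.2|].
  move=> n; have [|] := h n.+1%:R^-1; first by rewrite invr_gt0.
  move=> /existsNP[x /existsNP[y /not_implyP[xA /not_implyP[xy]]]].
  by move=> /negP; rewrite -ltNge => ?; exists (x, y).
have [U [UU subU]] := ultraFilterLemma (@eventually_filter).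
have [l _ xl] : exists2 l, -A <= l <= A & (w i).1 @[i --> U] --> l.
  by apply: ultra_bounded_cvg => i; have [/ler_normlP[? ?] _ _] := hw i; lra.
have d0 : (w i).1 - (w i).2 @[i --> U] --> (0 : R).
  apply/norm_cvg0P.
  apply: (@squeeze_cvgr _ _ _ _ (cst 0) (fun i => i.+1%:R^-1)).
  - by apply: nearW => i; rewrite normr_ge0/=; case: (hw i).
  - exact: cvg_cst.
  - by apply: cvg_trans (@cvg_harmonic R); exact: cvg_app.
have yl : (w i).2 @[i --> U] --> l.
  rewrite (_ : (fun i => _) = fun i => (w i).1 - ((w i).1 - (w i).2)); last first.
    by apply/funext => i; rewrite opprB addrC subrK.
  by rewrite -[l]subr0; exact: cvgB.
have : f (w i).1 - f (w i).2 @[i --> U] --> f l - f l.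
  by apply: cvgB; apply: continuous_cvg => //; exact: cf.
rewrite subrr => /cvgrPdist_lt/(_ _ e0) hU.
have [i /=] := filter_ex hU.
by case: (hw i) => _ _ /lt_trans; rewrite sub0r normrN => /[apply]; rewrite ltxx.
Qed.

Lemma stieltjes_exists (F : R -> R) :
  {homo F : x y / x <= y} -> (forall x, F @ x^'+ --> F x) ->
  exists nu : {measure set (measurableTypeR R) -> \bar R},
    forall a b, a <= b -> nu `]a, b]%classic = (F b - F a)%:E.
Proof.
move=> nd rc.
pose Fc : cumulative R R := HB.pack F (isCumulative.Build R _ R F nd rc).
exists (lebesgue_stieltjes_measure Fc) => a b ab.
rewrite /= /lebesgue_stieltjes_measure /measure_extension measurable_mu_extE/=; last first.
  exact: is_ocitv.
by rewrite wlength_itv_bnd.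
Qed.

Section steps.
Variables (a c : nat -> R).

Definition step n (x : R) : R :=
  \sum_(j < n) c j * \1_(`]a j, a j.+1]%classic) x.

Lemma stepP n x : (forall j, a j <= a j.+1) ->
  (~~ (a 0%N < x <= a n) /\ step n x = 0) \/
  (exists j, [/\ (j < n)%N, a j < x <= a j.+1 & step n x = c j]).
Proof.
move=> nda; have nda' m : a 0%N <= a m.
  by elim: m => // m; move/le_trans; apply.
have ind j : \1_(`]a j, a j.+1]%classic) x = (((a j < x) && (x <= a j.+1))%R : nat)%:R :> R.
  by rewrite indicE mem_setE in_itv.
elim: n => [|n [[xn s0]|[j [jn xj sE]]]].
- by left; split; [apply/negP; lra|rewrite /step big_ord0].
- rewrite /step big_ord_recr/= -/(step n x) s0 add0r ind.
  have [xn1|xn1] := boolP (a n < x <= a n.+1).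
    by right; exists n; rewrite mulr1.
  left; split; last by rewrite mulr0.
  by apply: contra xn1 => /andP[x1 x2]; rewrite x2 andbT ltNge; apply: contra xn => x3; rewrite x1.
- right; exists j; split => //; first exact: ltn_trans (ltnSn _).
  rewrite /step big_ord_recr/= -/(step n x) sE ind.
  have jn' : a j.+1 <= a n.
    by have /nondecreasing_seqP := nda; apply.
  by rewrite (_ : _ && _ = false) ?mulr0 ?addr0//; apply/negbTE/negP; lra.
Qed.

Section step_integral.
Local Open Scope ereal_scope.
Variable m : {measure set (measurableTypeR R) -> \bar R}.

Lemma integral_step n : (forall j, 0 <= c j)%R ->
  \int[m]_x (step n x)%:E = \sum_(j < n) (c j)%:E * m `]a j, a j.+1]%classic.
Proof.
move=> c0; rewrite /step; under eq_integral do rewrite -sumEFin.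
rewrite ge0_integral_sum//.
- apply: eq_bigr => j _; under eq_integral do rewrite EFinM.
  rewrite ge0_integralZl_EFin//; last exact/measurable_EFinP/measurable_indic.
  by rewrite integral_indic// setIT.
- move=> j; apply/measurable_EFinP; apply: measurable_funM => //.
- by move=> j x _; rewrite lee_fin mulr_ge0.
Qed.

Lemma measurable_step n : measurable_fun setT (step n).
Proof.
by apply: measurable_sum => j; apply: measurable_funM => //; exact: measurable_indic.
Qed.

Lemma step_ge0 n x : (forall j, 0 <= c j)%R -> (0 <= step n x)%R.
Proof. by move=> c0; apply: sumr_ge0 => j _; rewrite mulr_ge0. Qed.

(** The step function differs from [f] by at most [e] on the cells and off the
    grid alike, and the mass is at most [C]. *)
Lemma integral_step_approx n (f : R -> R) (e C : R) :
  (forall j, a j <= a j.+1)%R -> (forall j, 0 <= c j)%R ->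
  (forall x, 0 <= f x)%R -> measurable_fun setT f -> (0 <= e)%R ->
  m setT <= C%:E ->
  (forall j x, (j < n)%N -> (a j < x <= a j.+1)%R -> `|f x - c j| <= e)%R ->
  (forall x, ~~ (a 0%N < x <= a n)%R -> f x <= e)%R ->
  \int[m]_x (f x)%:E <= \sum_(j < n) (c j)%:E * m `]a j, a j.+1]%classic + (e * C)%:E /\
  \sum_(j < n) (c j)%:E * m `]a j, a j.+1]%classic <= \int[m]_x (f x)%:E + (e * C)%:E.
Proof.
move=> nda c0 f0 mf e0 mC fin fout.
have ms := measurable_step n.
have eC (g : R -> R) : (forall x, 0 <= g x)%R -> measurable_fun setT g ->
    \int[m]_x (g x + e)%:E <= \int[m]_x (g x)%:E + (e * C)%:E.
  move=> g0 mg; under eq_integral do rewrite EFinD.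
  rewrite ge0_integralD//; last 2 first.
  - by move=> x _; rewrite lee_fin.
  - exact/measurable_EFinP.
  by rewrite leeD2l// integral_cst// EFinM lee_wpmul2l ?lee_fin.
have close x : (`|f x - step n x| <= e)%R.
  have [[/fout fe ->]|[j [jn xj ->]]] := stepP n x nda; last exact: fin.
  by rewrite subr0 ger0_norm.
rewrite -integral_step//; split.
- apply: le_trans (eC _ (fun x => step_ge0 n x c0) ms).
  apply: ge0_le_integral => //.
  + by move=> x _; rewrite lee_fin.
  + exact/measurable_EFinP.
  + by apply/measurable_EFinP; exact: measurable_funD.
  + by move=> x _; rewrite lee_fin; have /ler_normlP[] := close x; lra.
- apply: le_trans (eC _ f0 mf).
  apply: ge0_le_integral => //.
  + by move=> x _; rewrite lee_fin step_ge0.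
  + exact/measurable_EFinP.
  + by apply/measurable_EFinP; exact: measurable_funD.
  + by move=> x _; rewrite lee_fin; have /ler_normlP[] := close x; lra.
Qed.

End step_integral.

End steps.

(** Bounded sequences of measures on the half-line have a vague limit point:
    take the limits of the distribution functions along an ultrafilter, and the
    Stieltjes measure of their right-continuous version. *)
Lemma vague_compact (N : nat -> {measure set (measurableTypeR R) -> \bar R}) (C : R) :
  (forall n, N n setT <= C%:E)%E -> (forall n, N n `]-oo, 0[%classic = 0%E) ->
  exists nu : {measure set (measurableTypeR R) -> \bar R},
    [/\ (nu setT <= C%:E)%E, nu `]-oo, 0[%classic = 0%E &
      forall f : R -> R, continuous f -> (forall x, 0 <= f x) ->
        (forall e : R, 0 < e -> exists A : R, forall x, A <= `|x| -> f x <= e) ->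
        forall L : R, fine (\int[N n]_x (f x)%:E) @[n --> \oo] --> L ->
        (\int[nu]_x (f x)%:E = L%:E)%E].
Proof.
move=> NC N0.
have C0 : 0 <= C by rewrite -lee_fin (le_trans _ (NC 0%N)).
have Nfin n A : measurable A -> N n A \is a fin_num.
  move=> mA; rewrite ge0_fin_numE// (le_lt_trans _ (ltry C))// (le_trans _ (NC n))//.
  by rewrite le_measure ?inE.
pose M n v := fine (N n `]-oo, v]%classic).
have ME n v : N n `]-oo, v]%classic = (M n v)%:E by rewrite /M fineK// Nfin.
have M01 v n : 0 <= M n v <= C.
  by rewrite -!lee_fin -ME measure_ge0 (le_trans _ (NC n))// le_measure ?inE.
have Mab n a b : a <= b -> N n `]a, b]%classic = (M n b - M n a)%:E.
  move=> ab; have : N n `]-oo, b]%classic = (N n `]-oo, a]%classic + N n `]a, b]%classic)%E.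
    rewrite -measureU//.
      by congr (N n _); rewrite -itv_bndbnd_setU ?bnd_simp.
    by apply/seteqP; split => // x [/=]; rewrite !in_itv/=; lra.
  rewrite !ME; case: (N n `]a, b]%classic) (Nfin n _ (measurable_itv `]a, b])) => // r _.
  by rewrite -EFinD => -[->]; rewrite addrC addKr.
have [U [UU subU]] := ultraFilterLemma (@eventually_filter).
have /choice [F0 F0P] : forall v, exists l, 0 <= l <= C /\ M n v @[n --> U] --> l.
  by move=> v; have [l ? ?] := @ultra_bounded_cvg _ U UU (M ^~ v) _ _ (M01 v); exists l.
have F0cvg v : M n v @[n --> U] --> F0 v by case: (F0P v).
have F0C v : 0 <= F0 v <= C by case: (F0P v).
have F0nd : {homo F0 : x y / x <= y}.
  move=> x y xy; apply: (ler_cvg_to (F0cvg x) (F0cvg y)); apply: nearW => n.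
  by rewrite -lee_fin -!ME le_measure ?inE//; apply: subset_itvl; rewrite bnd_simp.
pose F v := inf (F0 @` `]v, +oo[%classic).
have Fcvg v : F0 x @[x --> v^'+] --> F v.
  apply: (@nondecreasing_at_right_cvgr _ _ _ (BInfty _ false)) => //.
    by move=> x y _ _; exact: F0nd.
  by exists 0 => _ [x _ <-]; case/andP: (F0C x).
have FleF0 v w : v < w -> F v <= F0 w.
  move=> vw; apply: ge_inf; last by exists w => //=; rewrite in_itv/= vw.
  by exists 0 => _ [x _ <-]; case/andP: (F0C x).
have F0leF v : F0 v <= F v.
  apply: lb_le_inf; first by exists (F0 (v + 1)), (v + 1) => //=; rewrite in_itv/= ltrDl andbT.
  by move=> _ [x /= + <-]; rewrite in_itv/= andbT => /ltW/F0nd.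
have Fnd : {homo F : x y / x <= y}.
  move=> x y; rewrite le_eqVlt => /predU1P[->//|xy].
  exact: le_trans (FleF0 _ _ xy) (F0leF y).
have FC v : 0 <= F v <= C.
  have /andP[? _] := F0C v; have /andP[_ ?] := F0C (v + 1).
  by rewrite (le_trans _ (F0leF v))//= (le_trans (FleF0 v (v + 1) _))// ltrDl.
have Frc v : F @ v^'+ --> F v.
  apply/cvgrPdist_le => e e0; have /cvgrPdist_le/(_ _ e0) := Fcvg v.
  move=> [d /= d0 hd]; exists d => //= u vdu vu.
  have [w /andP[uw wd]] : exists w, u < w < v + d.
    exists ((u + (v + d)) / 2); move: vdu; rewrite /= ltr_distlC => /andP[_ ?]; lra.
  have vw := lt_trans vu uw.
  have := hd w; rewrite /= ltr_distlC; have -> : v - d < w < v + d by lra.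
  move=> /(_ isT vw); rewrite !ler_distl => /andP[h1 h2].
  by have := Fnd _ _ (ltW vu); have := FleF0 _ _ uw; lra.
have F_lt0 v : v < 0 -> F v = 0.
  move=> v0; have /andP[F0' _] := FC v; apply/le_anti/andP; split => //.
  apply: (le_trans (FleF0 v (v / 2) _)); first lra.
  apply: (cvgr_to_le (F0cvg (v / 2))); apply: nearW => n.
  rewrite -lee_fin -ME (@le_trans _ _ (N n `]-oo, 0[%classic)) ?N0// -[leRHS](N0 n).
  by rewrite le_measure ?inE//; apply: subset_itvl; rewrite bnd_simp; lra.
have [nu nuE] := stieltjes_exists Fnd Frc.
have nuC : (nu setT <= C%:E)%E.
  have : nu `](- n%:R), n%:R]%classic @[n --> \oo] -->
      nu (\bigcup_n `](- n%:R : R), n%:R]%classic).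
    apply: nondecreasing_cvg_mu => //; first exact: bigcup_measurable.
    by move=> i j ij; apply/subsetPset/subset_itv; rewrite bnd_simp ?lerN2 ler_nat.
  rewrite bigcup_itvT => /cvg_lim <-//; apply: lime_le.
    by apply/cvg_ex; eexists; apply: nondecreasing_cvg_mu => //;
      [exact: bigcup_measurable|move=> i j ij; apply/subsetPset/subset_itv; rewrite bnd_simp ?lerN2 ler_nat].
  apply: nearW => n; rewrite nuE ?lee_fin; last by rewrite ge0_cp.
  by have := FC n%:R; have := FC (- n%:R); lra.
have nu0 : nu `]-oo, 0[%classic = 0%E.
  have -> : `]-oo, 0[%classic = \bigcup_n `](- n.+1%:R : R), (- n.+1%:R^-1)]%classic.
    apply/seteqP; split => x /=; rewrite in_itv/=.
      move=> x0; have nx0 : 0 < - x by rewrite oppr_gt0.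
      have [n1 hn1] : exists n : nat, - x < n.+1%:R.
        by exists (Num.truncn (- x)); rewrite truncnS_gt.
      have [n2 hn2] : exists n : nat, (- x)^-1 < n.+1%:R.
        by exists (Num.truncn (- x)^-1); rewrite truncnS_gt.
      exists (maxn n1 n2) => //=; rewrite in_itv/=; apply/andP; split.
        rewrite ltrNl (lt_le_trans hn1)// ler_nat ltnS leq_maxl//.
      rewrite lerNr invf_ple ?posrE//; apply/ltW/(lt_le_trans hn2).
      by rewrite ler_nat ltnS leq_maxr.
    move=> [n _ /=]; rewrite in_itv/= => /andP[_ /le_lt_trans]; apply.
    by rewrite oppr_lt0 invr_gt0.
  apply/eqP; rewrite eq_le measure_ge0 andbT.
  apply: (le_trans (measure_sigma_subadditive _ _ _ (fun x h => h))) => //.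
    exact: bigcup_measurable.
  rewrite eseries0// => n _ _; rewrite nuE.
    by rewrite !F_lt0 ?subrr// oppr_lt0 ?invr_gt0.
  by rewrite lerN2 (@le_trans _ _ 1)// ?invf_le1// ler1n.
exists nu; split => // f cf f0 fdecay L fL.
have mf : measurable_fun setT f by exact: continuous_measurable_fun.
have unif e : 0 < e -> exists2 d, 0 < d <= 1 &
    forall x y, `|x - y| <= d -> `|f x - f y| <= e.
  move=> e0; have [A hA] := fdecay e e0.
  have [d d0 hd] := heine (A + 1) cf e0.
  exists (Num.min d 1); first by rewrite lt_min d0 ltr01/= ge_min lexx orbT.
  move=> x y; rewrite le_min => /andP[xyd xy1].
  have [xA|xA] := leP `|x| (A + 1); first exact: hd.
  have yA : A <= `|y|.
    by have := ler_normD (x - y) y; rewrite subrK; lra.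
  have := hA _ yA; have := hA x (ltW (lt_trans _ xA)); rewrite ltrDl ltr01 => /(_ isT).
  by have := f0 x; have := f0 y; rewrite ler_norml; lra.
(* One grid serves all measures of mass at most [C], even after a shift by
   [h]: the distribution functions of the [N n] converge to [F0] at the shifted
   grid points, while [F] is only a limit of values of [F0] from the right. *)
have key e : 0 < e -> exists (n : nat) (v c : nat -> R) (d : R), [/\ 0 < d, forall j, v j <= v j.+1 &
    forall (h : R) (m : {measure set (measurableTypeR R) -> \bar R}),
      0 <= h <= d -> (m setT <= C%:E)%E ->
      (\int[m]_x (f x)%:E <= \sum_(j < n) (c j)%:E * m `](v j + h)%R, (v j.+1 + h)%R]%classic
        + (e * C)%:E)%E /\
      (\sum_(j < n) (c j)%:E * m `](v j + h)%R, (v j.+1 + h)%R]%classic <= \int[m]_x (f x)%:E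
        + (e * C)%:E)%E ].
  move=> e0; have [A hA] := fdecay e e0.
  have [d /andP[d0 d1] hd] := unif e e0.
  pose A1 := `|A| + 1; pose dl := d / 2; have dl0 : 0 < dl by rewrite /dl; lra.
  pose n := (Num.truncn (2 * A1 / dl)).+1.
  have ndl : 2 * A1 <= n%:R * dl.
    by rewrite -ler_pdivrMr//; apply/ltW; rewrite truncnS_gt.
  pose v j := - A1 + j%:R * dl.
  have vS j : v j.+1 = v j + dl by rewrite /v -natr1; ring.
  exists n, v, (f \o v), dl; split => //.
    by move=> j; rewrite vS lerDl ltW.
  move=> h m /andP[h0 hdl] mC.
  apply: (@integral_step_approx (fun j => v j + h) (f \o v) m n f e C) => //.
  - by move=> j; rewrite vS; lra.
  - by move=> j; exact: f0.
  - exact: ltW.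
  - move=> j x _; rewrite vS /= => xj; apply: hd.
    by rewrite ler_norml; move: xj; rewrite /dl; move: hdl; rewrite /dl; lra.
  - move=> x xout; apply: hA; have AA := ler_norm A.
    have [xA|xA] := leP x (v 0%N + h).
      rewrite ler_normr; apply/orP; right; move: xA.
      by rewrite /v mul0r addr0 /A1; move: hdl; rewrite /dl; lra.
    move: xout; rewrite xA/= -ltNge => xA'; rewrite ler_normr; apply/orP; left.
    by move: xA'; rewrite {1}/v /A1; move: ndl; rewrite /A1; have := normr_ge0 A; lra.
have fin (m : {measure set (measurableTypeR R) -> \bar R}) : (m setT <= C%:E)%E ->
    (\int[m]_x (f x)%:E)%E \is a fin_num.
  move=> mC; rewrite ge0_fin_numE; last by apply: integral_ge0 => x _; rewrite lee_fin.
  have [n [v [c [d [d0 _ /(_ 0 m)]]]]] := key 1 ltr01.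
  rewrite lexx (ltW d0) => /(_ isT mC)[/le_lt_trans + _]; apply.
  rewrite lte_add_pinfty ?ltry//; apply: lte_sum_pinfty => j _.
  rewrite ltey_eq; apply/orP; left; apply: fin_numM => //.
  rewrite ge0_fin_numE// (le_lt_trans _ (ltry C))// (le_trans _ mC)//.
  by rewrite le_measure ?inE.
rewrite -(fineK (fin nu nuC)); congr EFin; set J := fine _.
pose I i := fine (\int[N i]_x (f x)%:E)%E.
have IE i : (\int[N i]_x (f x)%:E = (I i)%:E)%E by rewrite fineK// fin.
have JE : (\int[nu]_x (f x)%:E = J%:E)%E by rewrite fineK// fin.
have IU : I i @[i --> U] --> L by apply: cvg_trans fL; exact: cvg_app.
apply/eqP; rewrite -subr_eq0 -normr_le0; apply/ler_addgt0Pr => e' e'0; rewrite add0r.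
pose e := e' / (2 * C + 1); have e0 : 0 < e by rewrite divr_gt0//; lra.
have e'E : e' = 2 * (e * C) + e by rewrite /e; field; rewrite gt_eqF//; lra.
have [n [v [c [d [d0 vnd hm]]]]] := key e e0.
pose S (G : R -> R) h := \sum_(j < n) c j * (G (v j.+1 + h) - G (v j + h)).
have SM i h : 0 <= h <= d -> I i <= S (M i) h + e * C /\ S (M i) h <= I i + e * C.
  move=> hd; have [] := hm h (N i) hd (NC i).
  have -> : (\sum_(j < n) (c j)%:E * N i `](v j + h)%R, (v j.+1 + h)%R]%classic = (S (M i) h)%:E)%E.
    rewrite -sumEFin; apply: eq_bigr => j _.
    by rewrite Mab ?EFinM// lerD2r.
  by rewrite IE -!EFinD !lee_fin.
have [SJ1 SJ2] : J <= S F 0 + e * C /\ S F 0 <= J + e * C.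
  have [] := hm 0 nu _ nuC; first by rewrite lexx ltW.
  have -> : (\sum_(j < n) (c j)%:E * nu `](v j + 0)%R, (v j.+1 + 0)%R]%classic = (S F 0)%:E)%E.
    rewrite -sumEFin; apply: eq_bigr => j _.
    by rewrite nuE ?EFinM// lerD2r.
  by rewrite JE -!EFinD !lee_fin.
have SU h : S (M i) h @[i --> U] --> S F0 h.
  apply: (@cvg_sum_ord _ _ _ n (fun j i => c j * (M i (v j.+1 + h) - M i (v j + h)))
    (fun j => c j * (F0 (v j.+1 + h) - F0 (v j + h)))) => j.
  by apply: cvgM; [exact: cvg_cst|exact: cvgB].
have SF : S F0 k.+1%:R^-1 @[k --> \oo] --> S F 0.
  have F0seq w : F0 (w + k.+1%:R^-1) @[k --> \oo] --> F (w + 0).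
    rewrite addr0; have /cvg_at_rightP := Fcvg w; apply; split.
      by move=> k; rewrite ltrDl invr_gt0.
    by rewrite -[X in _ --> X]addr0; apply: cvgD; [exact: cvg_cst|exact: cvg_harmonic].
  apply: (@cvg_sum_ord _ _ _ n
    (fun j k => c j * (F0 (v j.+1 + k.+1%:R^-1) - F0 (v j + k.+1%:R^-1)))
    (fun j => c j * (F (v j.+1 + 0) - F (v j + 0)))) => j.
  by apply: cvgM; [exact: cvg_cst|exact: cvgB].
have [k [kS kd]] : exists k : nat, `|S F 0 - S F0 k.+1%:R^-1| <= e /\ (k.+1%:R^-1 : R) <= d.
  have h1 : \forall k \near \oo, `|S F 0 - S F0 k.+1%:R^-1| <= e.
    by move/cvgrPdist_le : SF; apply.
  have h2 : \forall k \near \oo, (k.+1%:R^-1 : R) <= d.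
    have /cvgrPdist_le/(_ _ d0) := @cvg_harmonic R; apply: filterS => k.
    by rewrite sub0r normrN ger0_norm// invr_ge0.
  by have [k [? ?]] := filter_ex (filterI h1 h2); exists k.
set h := k.+1%:R^-1 in kS kd.
have hd : 0 <= h <= d by rewrite kd invr_ge0 ler0n.
have L1 : L <= S F0 h + e * C.
  apply: (ler_cvg_to IU (cvgD (SU h) (cvg_cst _))); apply: nearW => i.
  by case: (SM i h hd).
have L2 : S F0 h <= L + e * C.
  apply: (ler_cvg_to (SU h) (cvgD IU (cvg_cst _))); apply: nearW => i.
  by case: (SM i h hd).
by move: kS; rewrite !ler_norml e'E; lra.
Qed.

End vague_compactness.

(** * Uniqueness of the representing pair *)

Section uniqueness.
Context {R : realType}.
Notation leb := (@lebesgue_measure R).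
Notation meas := {measure set (measurableTypeR R) -> \bar R}.
Implicit Types (f : R -> R) (s t x y z : R).

Let mD := @measurable_D R.

Lemma abs_g1_le s v : 0 < s -> `|v| * g1 s v <= 2 * Num.sqrt s * g1 (2 * s) v.
Proof.
move=> s0; have r0 : 0 < Num.sqrt s by rewrite sqrtr_gt0.
have rr : Num.sqrt s ^+ 2 = s by rewrite sqr_sqrtr// ltW.
pose u := `|v| / Num.sqrt s.
have vu : `|v| = u * Num.sqrt s by rewrite /u divfK// gt_eqF.
have v2 : v ^+ 2 = u ^+ 2 * s by rewrite -(real_normK (num_real v)) vu exprMn rr.
have u0 : 0 <= u by rewrite divr_ge0// ltW.
have eu : u * expR (- (u ^+ 2 / 4)) <= 1.
  rewrite expRN ler_pdivrMr ?expR_gt0// mul1r.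
  by apply: le_trans (expR_ge1Dx _); have := sqr_ge0 (1 - u / 2); nra.
have -> : g1 s v = (Num.sqrt (2 * pi * s))^-1 * expR (- (u ^+ 2 / 4)) * expR (- (u ^+ 2 / 4)).
  rewrite /g1 -[RHS]mulrA -expRD v2; congr (_ * expR _); field.
  by rewrite gt_eqF.
have -> : g1 (2 * s) v = (Num.sqrt (2 * pi * (2 * s)))^-1 * expR (- (u ^+ 2 / 4)).
  rewrite /g1 v2; congr (_ * expR _); field.
  by rewrite gt_eqF.
have -> : Num.sqrt (2 * pi * (2 * s)) = Num.sqrt 2 * Num.sqrt (2 * pi * s).
  by rewrite -sqrtrM//; congr Num.sqrt; ring.
have s2 : 0 < Num.sqrt (2 : R) by rewrite sqrtr_gt0.
have s22 : Num.sqrt (2 : R) <= 2.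
  have := sqr_sqrtr (ler0n R 2); nra.
have q0 := sqrt2pi_gt0 s0.
set E := expR _ in eu *; have E0 : 0 < E by exact: expR_gt0.
rewrite vu invfM.
rewrite [leLHS](_ : _ = (Num.sqrt s * (Num.sqrt (2 * pi * s))^-1 * E) * (u * E)); last by ring.
rewrite [leRHS](_ : _ = (Num.sqrt s * (Num.sqrt (2 * pi * s))^-1 * E) * (2 / Num.sqrt 2)); last by ring.
rewrite ler_wpM2l ?mulr_ge0 ?invr_ge0 ?(ltW r0) ?(ltW q0) ?(ltW E0)//.
by rewrite (le_trans eu)// ler_pdivlMr// mul1r.
Qed.

(** The entrance law [k] leaves every set at positive distance from 0 as the
    time vanishes. *)
Lemma k_le s b y : 0 < s -> 0 < b -> b <= y -> k s y <= 8 * Num.sqrt s / b ^+ 3.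
Proof.
move=> s0 b0 by_; have y0 := lt_le_trans b0 by_.
have r0 : 0 < Num.sqrt s by rewrite sqrtr_gt0.
have rr : s = Num.sqrt s ^+ 2 by rewrite sqr_sqrtr// ltW.
pose u := y ^+ 2 / (2 * s); have u0 : 0 < u by rewrite divr_gt0 ?exprn_gt0 ?mulr_gt0.
have eu : expR (- u) <= 2 / u ^+ 2.
  have := @expR_ge1Dxn R u 1 (ltW u0); rewrite (_ : 2`! = 2)%N// => h.
  rewrite expRN -[leRHS]invrK lef_pV2 ?posrE ?expR_gt0 ?invr_gt0 ?divr_gt0 ?exprn_gt0//.
  by rewrite invf_div (le_trans _ h)// lerDr.
have q1 : (Num.sqrt (2 * pi * s))^-1 <= (Num.sqrt s)^-1.
  rewrite lef_pV2 ?posrE ?sqrt2pi_gt0// ler_sqrt ?mulr_ge0 ?pi_ge0 ?(ltW s0)//.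
  by rewrite ler_peMl ?(ltW s0)//; have := @pi_ge2 R; lra.
have q0 := sqrt2pi_gt0 s0.
apply: (@le_trans _ _ (y / s * ((Num.sqrt s)^-1 * (2 / u ^+ 2)))).
  rewrite /k /g1 mulrAC ler_wpM2l ?divr_ge0 ?(ltW y0) ?(ltW s0)//.
  by rewrite mulNr ler_pM ?invr_ge0 ?expR_ge0 ?(ltW q0).
have -> : y / s * ((Num.sqrt s)^-1 * (2 / u ^+ 2)) = 8 * Num.sqrt s / y ^+ 3.
  rewrite /u; set r := Num.sqrt s in rr r0 *; clearbody r; rewrite rr; field.
  by rewrite !gt_eqF.
rewrite ler_wpM2l ?mulr_ge0 ?(ltW r0)// lef_pV2 ?posrE ?exprn_gt0//.
by rewrite lerXn2r ?nnegrE ?(ltW b0) ?(ltW y0).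
Qed.

Lemma cvg_of_dist (u v : nat -> R) l : (forall n, `|u n - l| <= v n) ->
  v n @[n --> \oo] --> 0 -> u n @[n --> \oo] --> l.
Proof.
move=> uv v0; apply/cvgrPdistC_le => e e0; have /cvgrPdist_le/(_ _ e0) := v0.
apply: filterS => n; rewrite sub0r normrN => /(le_trans (ler_norm _)).
exact: le_trans (uv n).
Qed.

Lemma cvg_sqrt0 (C : R) (s_ : nat -> R) : s_ n @[n --> \oo] --> 0 ->
  C * Num.sqrt (s_ n) @[n --> \oo] --> 0.
Proof.
move=> s0; rewrite -[X in _ --> X](mulr0 C); apply: cvgM; first exact: cvg_cst.
rewrite -[X in _ --> X](@sqrtr0 R).
by apply: continuous_cvg => //; exact: sqrt_continuous.
Qed.

Lemma ae_D_ex (P : R -> Prop) : {ae leb, forall y, D y -> P y} -> exists2 y, D y & P y.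
Proof.
move=> [N [mN N0 PN]]; apply: contrapT => nP.
have DN : @D R `<=` N by move=> y yD; apply: PN => /= h; apply: nP; exists y => //; exact: h.
have := @lebesgue_measure_itv R `]0, +oo[; rewrite /= ltry.
have -> : leb `]0, +oo[%classic = 0%E.
  by apply/eqP; rewrite eq_le measure_ge0 andbT -N0 le_measure ?inE.
by [].
Qed.

Local Open Scope ereal_scope.

Lemma integral_D_T (F : R -> \bar R) : (forall y, ~ D y -> F y = 0) ->
  \int[leb]_(y in D) F y = \int[leb]_y F y.
Proof.
move=> F0; rewrite integral_mkcond; apply: eq_integral => y _.
by rewrite patchE; case: ifPn => //; rewrite notin_setE => /F0.
Qed.

Lemma integral_abs_g1 s z : (0 < s)%R ->
  \int[leb]_y (`|y - z| * g1 s (y - z))%:E <= (2 * Num.sqrt s)%:E.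
Proof.
move=> s0; have s20 : (0 < 2 * s)%R by rewrite mulr_gt0.
apply: (@le_trans _ _ (\int[leb]_y ((2 * Num.sqrt s)%:E * (g1 (2 * s) (y - z))%:E))).
  apply: ge0_le_integral => //.
  - by move=> y _; rewrite lee_fin mulr_ge0// g1_ge0.
  - apply/measurable_EFinP; apply: measurable_funM; last exact: measurable_g1_cst.
    by apply: measurableT_comp => //; exact: measurable_funB.
  - by apply: emeasurable_funM => //; apply/measurable_EFinP; exact: measurable_g1_cst.
  - by move=> y _; rewrite -EFinM lee_fin abs_g1_le.
rewrite ge0_integralZl_EFin ?mulr_ge0 ?sqrtr_ge0//.
- by rewrite integral_g1// mule1.
- by move=> y _; rewrite lee_fin g1_ge0.
- by apply/measurable_EFinP; exact: measurable_g1_cst.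
Qed.

Section approximate_identity.
Variables (f : R -> R) (L : R).
Hypothesis (L0 : (0 <= L)%R) (f0 : forall y, (0 <= f y)%R).
Hypothesis fL : forall x y, (`|f x - f y| <= L * `|x - y|)%R.
Hypothesis fD : forall y, (y <= 0 -> f y = 0)%R.
Hypothesis mf : measurable_fun setT f.

Let mg s z : (0 < s)%R -> measurable_fun setT (fun y => (g1 s (y - z))%:E).
Proof. by move=> s0; apply/measurable_EFinP; exact: measurable_g1_cst. Qed.

Let mgf s z : (0 < s)%R -> measurable_fun setT (fun y => (g1 s (y - z) * f y)%:E).
Proof.
by move=> s0; apply/measurable_EFinP; apply: measurable_funM => //;
  exact: measurable_g1_cst.
Qed.

Let mag s z : (0 < s)%R -> measurable_fun setT (fun y => (`|y - z| * g1 s (y - z))%:E).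
Proof.
move=> s0; apply/measurable_EFinP; apply: measurable_funM; last exact: measurable_g1_cst.
by apply: measurableT_comp => //; exact: measurable_funB.
Qed.

Let Lag s z : (0 < s)%R -> \int[leb]_y (L%:E * (`|y - z| * g1 s (y - z))%:E) <=
  (L * (2 * Num.sqrt s))%:E.
Proof.
move=> s0; rewrite ge0_integralZl_EFin//.
- by rewrite EFinM lee_wpmul2l ?lee_fin// integral_abs_g1.
- by move=> y _; rewrite lee_fin mulr_ge0// g1_ge0.
- exact: mag.
Qed.

Let G s z := \int[leb]_y (g1 s (y - z) * f y)%:E.

Let G_le s z : (0 < s)%R -> G s z <= (f z + L * (2 * Num.sqrt s))%:E.
Proof.
move=> s0; apply: (@le_trans _ _ (\int[leb]_y
   ((f z)%:E * (g1 s (y - z))%:E + L%:E * (`|y - z| * g1 s (y - z))%:E))).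
  apply: ge0_le_integral => //.
  - by move=> y _; rewrite lee_fin mulr_ge0// g1_ge0.
  - exact: mgf.
  - by apply: emeasurable_funD; apply: emeasurable_funM => //; [exact: mg|exact: mag].
  - move=> y _; rewrite -!EFinM -EFinD lee_fin.
    by have := fL y z; have := g1_ge0 s (y - z)%R; rewrite ler_norml => ? /andP[_ ?]; nra.
rewrite ge0_integralD//.
- rewrite EFinD leeD ?Lag// ge0_integralZl_EFin//.
  + by rewrite integral_g1// mule1.
  + by move=> y _; rewrite lee_fin g1_ge0.
  + exact: mg.
- by move=> y _; rewrite -EFinM lee_fin mulr_ge0// g1_ge0.
- by apply: emeasurable_funM => //; exact: mg.
- by move=> y _; rewrite -EFinM lee_fin !mulr_ge0// g1_ge0.
- by apply: emeasurable_funM => //; exact: mag.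
Qed.

Let le_G s z : (0 < s)%R -> (f z)%:E <= G s z + (L * (2 * Num.sqrt s))%:E.
Proof.
move=> s0; have -> : (f z)%:E = \int[leb]_y ((f z)%:E * (g1 s (y - z))%:E).
  rewrite ge0_integralZl_EFin//.
  + by rewrite integral_g1// mule1.
  + by move=> y _; rewrite lee_fin g1_ge0.
  + exact: mg.
apply: le_trans (leeD2l _ (Lag z s0)).
rewrite -ge0_integralD//.
- apply: ge0_le_integral => //.
  + by move=> y _; rewrite -EFinM lee_fin mulr_ge0// g1_ge0.
  + by apply: emeasurable_funM => //; exact: mg.
  + by apply: emeasurable_funD; [exact: mgf|apply: emeasurable_funM => //; exact: mag].
  + move=> y _; rewrite -!EFinM -EFinD lee_fin.
    by have := fL y z; have := g1_ge0 s (y - z)%R; rewrite ler_norml => ? /andP[? _]; nra.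
- by move=> y _; rewrite lee_fin mulr_ge0// g1_ge0.
- exact: mgf.
- by move=> y _; rewrite -EFinM lee_fin !mulr_ge0// g1_ge0.
- by apply: emeasurable_funM => //; exact: mag.
Qed.

Let G_split s z : (0 < s)%R -> D z -> G s z = Tint s f z + G s (- z).
Proof.
move=> s0 zD; have fnD y : ~ D y -> f y = 0%R.
  by rewrite D_gt0 => /negP; rewrite -leNgt => /fD.
rewrite /G -[LHS]integral_D_T; last by move=> y /fnD ->; rewrite mulr0.
rewrite -[X in _ + X]integral_D_T; last by move=> y /fnD ->; rewrite mulr0.
rewrite -ge0_integralD//.
- by apply: eq_integral => y _; rewrite -EFinD /p opprK; congr EFin; ring.
- by move=> y yD; rewrite lee_fin mulr_ge0// D_p_ge0.
- exact: measurable_pM.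
- by move=> y _; rewrite lee_fin mulr_ge0// g1_ge0.
- by apply: measurable_funTS; exact: mgf.
Qed.

(** The absorbed kernel is the difference of the Gaussian kernels centered at
    [z] and [- z], and the function vanishes at [- z]; both Gaussian integrals
    are within the first moment of their target. *)
Lemma Tint_approx s z : (0 < s)%R -> D z ->
  Tint s f z \is a fin_num /\ (`|fine (Tint s f z) - f z| <= 4 * L * Num.sqrt s)%R.
Proof.
move=> s0 zD; have fz : f (- z) = 0%R by rewrite fD// oppr_le0 ltW// -D_gt0.
have := G_split s0 zD; have := G_le z s0; have := G_le (- z) s0; have := le_G z s0.
have : 0 <= G s (- z) by apply: integral_ge0 => y _; rewrite lee_fin mulr_ge0// g1_ge0.
have : 0 <= Tint s f z by exact: Tint_ge0.
rewrite fz; case: (G s z) => [A| |]//; case: (G s (- z)) => [B| |]//;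
  case: (Tint s f z) => [T0| |]//.
rewrite -!EFinD !lee_fin => T00 B0 h1 h2 h3 [h4]; split => //=.
by rewrite ler_norml; lra.
Qed.

Lemma Tint_cvg (s_ : nat -> R) z : (forall n, 0 < s_ n)%R ->
  (s_ n @[n --> \oo] --> (0 : R))%R -> D z -> Tint (s_ n) f z @[n --> \oo] --> (f z)%:E.
Proof.
move=> s0 scvg zD; apply/fine_cvgP; split.
  by apply: nearW => n; case: (Tint_approx (s0 n) zD).
apply: (@cvg_of_dist _ (fun n => 4 * L * Num.sqrt (s_ n))%R).
  by move=> n /=; case: (Tint_approx (s0 n) zD).
exact: cvg_sqrt0.
Qed.

End approximate_identity.

Lemma measurable_wt T : measurable_fun setT (wt T : R -> R).
Proof.
apply: measurable_funM => //; apply: measurableT_comp => //.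
by apply: measurable_funM => //; apply: measurableT_comp => //; exact: measurable_funX.
Qed.

Lemma Uint_lty (mu : meas) T s y : (0 < s)%R -> (s < T)%R -> D y ->
  \int[mu]_(z in D) (wt T z)%:E < +oo -> Uint mu s y < +oo.
Proof.
rewrite D_gt0 => s0 sT y0 wfin.
have [C C0 hC] := p_le_wt s0 (lexx s) sT y0.
apply: (@le_lt_trans _ _ (\int[mu]_(z in D) (C%:E * (wt T z)%:E))).
  apply: ge0_le_integral => //.
  - by move=> z zD; rewrite lee_fin D_p_ge0// D_gt0.
  - by apply/measurable_EFinP; exact: measurable_p.
  - by apply: emeasurable_funM => //; apply/measurable_EFinP;
      apply: measurable_funTS; exact: measurable_wt.
  - by move=> z; rewrite D_gt0 => z0; rewrite -EFinM lee_fin pC hC// !lexx.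
rewrite ge0_integralZl_EFin ?(ltW C0)//.
- by apply: lte_mul_pinfty; rewrite ?lee_fin ?(ltW C0).
- by move=> z; rewrite D_gt0 => z0; rewrite lee_fin wt_ge0// ltW.
- by apply/measurable_EFinP; apply: measurable_funTS; exact: measurable_wt.
Qed.

(** Finiteness of the potential at one time and one point controls the mass of
    the measure near 0 and near infinity; by [Uint_lty] it then extends to all
    points at earlier times. *)
Lemma wt_lty (mu : meas) s y : (0 < s)%R -> D y -> Uint mu s y < +oo ->
  \int[mu]_(z in D) (wt s z)%:E < +oo.
Proof.
rewrite D_gt0 => s0 y0 ufin; have kp := k_gt0 s0 y0.
apply: (@le_lt_trans _ _ ((k s y)^-1%:E * Uint mu s y)); last first.
  by apply: lte_mul_pinfty; rewrite ?lee_fin ?invr_ge0 ?(ltW kp).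
have mp : measurable_fun D (fun z => (p s z y)%:E).
  by apply/measurable_EFinP; exact: measurable_p.
have p0 z : D z -> 0 <= (p s z y)%:E by move=> zD; rewrite lee_fin D_p_ge0// D_gt0.
rewrite /Uint -ge0_integralZl_EFin ?invr_ge0 ?(ltW kp)//.
apply: ge0_le_integral => //.
- by move=> z; rewrite D_gt0 => z0; rewrite lee_fin wt_ge0// ltW.
- by apply/measurable_EFinP; apply: measurable_funTS; exact: measurable_wt.
- exact: emeasurable_funM.
- move=> z; rewrite D_gt0 => z0; rewrite -EFinM lee_fin mulrC ler_pdivlMr// mulrC.
  by rewrite pC p_ge_k// ltW.
Qed.

Section pairing.
Variables (mu : {sigma_finite_measure set (measurableTypeR R) -> \bar R}).
Variables (a T : R) (a0 : (0 <= a)%R) (T0 : (0 < T)%R).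
Hypothesis wfin : \int[mu]_(z in D) (wt T z)%:E < +oo.
Variables (f : R -> R) (L B b c : R).
Hypothesis (L0 : (0 <= L)%R) (f0 : forall y, (0 <= f y <= B)%R).
Hypothesis fL : forall x y, (`|f x - f y| <= L * `|x - y|)%R.
Hypothesis (b0 : (0 < b)%R) (fbc : forall y, ~~ (b <= y <= c)%R -> f y = 0%R).

Let f0' y : (0 <= f y)%R. Proof. by case/andP: (f0 y). Qed.

Let fD y : (y <= 0)%R -> f y = 0%R.
Proof. by move=> y0; apply: fbc; apply/negP => /andP[]; move: b0; lra. Qed.

Let cf : continuous f.
Proof.
move=> x; apply/cvgrPdist_le => e e0.
have L1 : (0 < L + 1)%R by move: L0; lra.
exists (e / (L + 1))%R; first by rewrite /= divr_gt0.
move=> y /= xy; apply: (le_trans (fL x y)).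
apply: (@le_trans _ _ ((L + 1) * (e / (L + 1)))%R).
  by apply: ler_pM => //; [lra|exact: ltW].
by rewrite mulrC divfK// gt_eqF.
Qed.

Let mf : measurable_fun setT f. Proof. exact: continuous_measurable_fun. Qed.

Let s_ n : R := (T / 4 / n.+1%:R)%R.

Let s_gt0 n : (0 < s_ n)%R. Proof. by rewrite !divr_gt0. Qed.

Let s_le n : (s_ n <= T / 4)%R.
Proof. by rewrite /s_ ler_pdivrMr// ler_peMr ?ler1n// divr_ge0// ltW. Qed.

Let s_cvg : (s_ n @[n --> \oo] --> (0 : R))%R.
Proof.
rewrite -[X in _ --> X](mulr0 (T / 4)%R); apply: cvgM; first exact: cvg_cst.
exact: cvg_harmonic.
Qed.

(* A test function is at most a multiple of [p (T / 4) ^~ 1], and the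
   Chapman-Kolmogorov equation moves the domination to [p (s + T / 4) ^~ 1]. *)
Let Tint_dom : exists2 C : R, (0 < C)%R &
  forall n z, D z -> Tint (s_ n) f z <= (C * wt T z)%:E.
Proof.
have t0 : (0 < T / 4)%R by rewrite divr_gt0.
pose m := (k (T / 4) 1 * (b * expR (- c ^+ 2 / (2 * (T / 4)))))%R.
have m0 : (0 < m)%R by rewrite mulr_gt0 ?k_gt0// mulr_gt0 ?expR_gt0.
have B0 : (0 <= B)%R by case/andP: (f0 0) => /le_trans; apply.
have fp y : D y -> (f y <= B / m * p (T / 4) y 1)%R.
  rewrite D_gt0 => y0; have [/andP[by_ yc]|/fbc ->] := boolP (b <= y <= c)%R; last first.
    by rewrite mulr_ge0 ?divr_ge0 ?(ltW m0)// p_ge0// ltW.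
  case/andP: (f0 y) => _ /le_trans; apply; rewrite -mulrA ler_peMr//.
  rewrite mulrC ler_pdivlMr// mul1r pC.
  apply: le_trans (p_ge_k t0 ler01 (ltW y0)).
  rewrite ler_wpM2l ?k_ge0// ler_pM ?expR_ge0 ?(ltW b0)//.
  rewrite ler_expR !mulNr lerN2; apply: ler_wpM2r.
    by rewrite invr_ge0 mulr_ge0// ltW.
  by rewrite lerXn2r ?nnegrE ?(ltW y0)// (le_trans (ltW y0) yc).
have tt : (T / 4 <= T / 2)%R by lra.
have tT : (T / 2 < T)%R by lra.
have [C C0 hC] := p_le_wt t0 tt tT ltr01.
have Bm0 : (0 <= B / m)%R by rewrite divr_ge0// ltW.
exists (B / m * C + 1)%R; first by rewrite ltr_wpDl// mulr_ge0// ltW.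
move=> n z zD; have z0 : (0 < z)%R by rewrite -D_gt0.
apply: (@le_trans _ _ (\int[leb]_(y in D) ((B / m)%:E * (p (s_ n) z y * p (T / 4) y 1)%:E))).
  apply: ge0_le_integral => //.
  - by move=> y yD; rewrite lee_fin mulr_ge0// D_p_ge0.
  - exact: measurable_pM.
  - apply: emeasurable_funM => //; apply/measurable_EFinP.
    by apply: measurable_funM; exact: measurable_p.
  - move=> y yD; rewrite -EFinM lee_fin mulrCA ler_wpM2l ?fp//.
    by rewrite D_p_ge0.
rewrite ge0_integralZl_EFin//; last 2 first.
- by move=> y yD; rewrite lee_fin mulr_ge0// D_p_ge0// D_gt0.
- by apply/measurable_EFinP; apply: measurable_funM; exact: measurable_p.
rewrite chapman_kolmogorov// -EFinM lee_fin.
have pw : (p (s_ n + T / 4) z 1 <= C * wt T z)%R.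
  by rewrite pC hC//; have := s_gt0 n; have := s_le n; lra.
rewrite (le_trans (ler_wpM2l Bm0 pw))// mulrA ler_wpM2r ?wt_ge0 ?(ltW z0)//.
by rewrite lerDl.
Qed.

Let If_fin : \int[leb]_(y in D) (f y)%:E \is a fin_num.
Proof.
rewrite ge0_fin_numE; last by apply: integral_ge0 => y _; rewrite lee_fin.
have [bc|cb] := leP b c; last first.
  rewrite (_ : integral _ _ _ = 0) ?ltry//; apply: integral0_eq => y _.
  by rewrite fbc//; apply/negP; lra.
apply: (@le_lt_trans _ _ (\int[leb]_(y in `[b, c]) (cst B%:E) y)).
  rewrite integral_mkcond [leRHS]integral_mkcond; apply: ge0_le_integral => //.
  - by move=> y _; apply: erestrict_ge0 => z _; rewrite lee_fin.
  - apply/(measurable_restrictT _ _).1 => //; apply/measurable_EFinP.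
    exact: measurable_funTS.
  - by apply/(measurable_restrictT _ _).1.
  - move=> y _; rewrite !patchE; have [yb|yb] := boolP (y \in `[b, c]%classic).
      have B0 : (0 <= B)%R by case/andP: (f0 0) => /le_trans; apply.
      by case: ifPn => _; rewrite lee_fin//; case/andP: (f0 y).
    case: ifPn => // _; rewrite fbc//.
    by move: yb; rewrite mem_setE in_itv.
rewrite integral_cst//; have := @lebesgue_measure_itv R `[b, c]; rewrite /= => ->.
by case: ifPn => _; rewrite ?mule0 ?ltry// -EFinB -EFinM ltry.
Qed.

Let k_part : \int[leb]_(y in D) (f y * (a * k (s_ n) y))%:E @[n --> \oo] --> 0.
Proof.
pose I := fine (\int[leb]_(y in D) (f y)%:E).
pose v n := (a * 8 / b ^+ 3 * I * Num.sqrt (s_ n))%R.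
have le_v n : \int[leb]_(y in D) (f y * (a * k (s_ n) y))%:E <= (v n)%:E.
  have c0 : (0 <= a * (8 * Num.sqrt (s_ n) / b ^+ 3))%R.
    by rewrite !mulr_ge0 ?sqrtr_ge0// invr_ge0 exprn_ge0// ltW.
  apply: (@le_trans _ _ (\int[leb]_(y in D)
      ((a * (8 * Num.sqrt (s_ n) / b ^+ 3))%:E * (f y)%:E))).
    apply: ge0_le_integral => //.
    - move=> y; rewrite D_gt0 => y0; rewrite lee_fin mulr_ge0// mulr_ge0// k_ge0//.
      exact: ltW.
    - apply/measurable_EFinP; apply: measurable_funM; first exact: measurable_funTS.
      by apply: measurable_funM => //; exact: measurable_k.
    - by apply: emeasurable_funM => //; apply/measurable_EFinP; exact: measurable_funTS.
    - move=> y _; rewrite -EFinM lee_fin mulrC.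
      have [/andP[by_ _]|/fbc ->] := boolP (b <= y <= c)%R; last by rewrite !mulr0.
      by rewrite ler_wpM2r// ler_wpM2l// k_le.
  rewrite ge0_integralZl_EFin//.
  - rewrite -(fineK If_fin) -EFinM lee_fin /v -/I.
    by rewrite le_eqVlt; apply/orP; left; apply/eqP; ring.
  - by move=> y _; rewrite lee_fin.
  - by apply/measurable_EFinP; exact: measurable_funTS.
apply: (@squeeze_cvge _ _ _ _ (cst 0) _ (fun n => (v n)%:E)).
- apply: nearW => n; rewrite le_v andbT; apply: integral_ge0 => y; rewrite D_gt0 => y0.
  by rewrite lee_fin mulr_ge0// mulr_ge0// k_ge0// ltW.
- exact: cvg_cst.
- by apply: cvg_EFin; [exact: nearW|exact: cvg_sqrt0].
Qed.

Let Uint_part : \int[leb]_(y in D) ((f y)%:E * Uint mu (s_ n) y) @[n --> \oo] -->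
  \int[mu]_(z in D) (f z)%:E.
Proof.
have E n : \int[leb]_(y in D) ((f y)%:E * Uint mu (s_ n) y) =
    \int[mu]_(z in D) Tint (s_ n) f z.
  transitivity (\int[leb]_(y in D) \int[mu]_(z in D) (f y * p (s_ n) z y)%:E).
    apply: eq_integral => y /[!inE] yD; rewrite /Uint -ge0_integralZl_EFin//.
    - by move=> z zD; rewrite lee_fin D_p_ge0.
    - by apply/measurable_EFinP; exact: measurable_p.
  rewrite (@tonelli_on _ _ _ _ _ leb mu _ _ _ mD mD); last 2 first.
  - apply/measurable_EFinP; apply: measurable_funM.
      by apply: measurable_funTS; exact: (measurableT_comp mf measurable_fst).
    by apply: (@measurable_p R _ _ _ (cst (s_ n)) snd fst) => //;
      [exact: measurableX|exact: measurable_funTS|exact: measurable_funTS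
      |by move=> *; exact: s_gt0].
  - by move=> y z yD zD; rewrite lee_fin mulr_ge0// D_p_ge0.
  by apply: eq_integral => z _; apply: eq_integral => y _; rewrite mulrC.
under eq_fun do rewrite E.
have [C C0 hC] := Tint_dom.
have mw : measurable_fun D (fun z => (C * wt T z)%:E).
  apply/measurable_EFinP; apply: measurable_funM => //.
  by apply: measurable_funTS; exact: measurable_wt.
apply: (@dominated_cvg _ _ _ mu _ mD _ _ (fun z => (C * wt T z)%:E)) => //.
- by move=> n; exact: measurable_Tint.
- by move=> z zD; apply: (Tint_cvg L0).
- apply/integrableP; split => //.
  under eq_integral => z zD.
    rewrite gee0_abs; last first.
      move: zD; rewrite inE D_gt0 => z0; rewrite lee_fin mulr_ge0 ?wt_ge0// ltW//.
    rewrite EFinM; over.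
  rewrite ge0_integralZl_EFin ?(ltW C0)//.
  + by apply: lte_mul_pinfty; rewrite ?lee_fin ?(ltW C0).
  + by move=> z; rewrite D_gt0 => z0; rewrite lee_fin wt_ge0// ltW.
  + by apply/measurable_EFinP; apply: measurable_funTS; exact: measurable_wt.
- by move=> n z zD; rewrite gee0_abs ?hC// Tint_ge0.
Qed.

(** As [s] tends to 0, the boundary part escapes to 0, away from the support of
    the test function, and the kernels form an approximate identity. *)
Lemma pairing_cvg :
  \int[leb]_(y in D) ((f y)%:E * Vint mu a (T / 4 / n.+1%:R) y) @[n --> \oo] --> \int[mu]_(z in D) (f z)%:E.
Proof.
rewrite -[X in _ --> X]add0e.
rewrite (_ : (fun n => _) = (fun n => \int[leb]_(y in D) (f y * (a * k (s_ n) y))%:E +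
    \int[leb]_(y in D) ((f y)%:E * Uint mu (s_ n) y))).
  by apply: cvgeD; [rewrite fin_num_adde_defr|exact: k_part|exact: Uint_part].
apply/funext => n; rewrite -/(s_ n) -ge0_integralD//.
- apply: eq_integral => y /[!inE] yD; rewrite /Vint ge0_muleDr ?Uint_ge0//.
  by move: yD; rewrite D_gt0 => y0; rewrite lee_fin mulr_ge0// k_ge0// ltW.
- by move=> y; rewrite D_gt0 => y0; rewrite lee_fin mulr_ge0// mulr_ge0// k_ge0// ltW.
- apply/measurable_EFinP; apply: measurable_funM; first exact: measurable_funTS.
  by apply: measurable_funM => //; exact: measurable_k.
- by move=> y yD; rewrite mule_ge0 ?lee_fin ?Uint_ge0.
- apply: emeasurable_funM; last exact: measurable_Uint.
  by apply/measurable_EFinP; exact: measurable_funTS.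
Qed.

End pairing.

End uniqueness.

Section pair_uniqueness.
Context {R : realType}.
Notation leb := (@lebesgue_measure R).
Notation meas := {measure set (measurableTypeR R) -> \bar R}.
Implicit Types (s t x y z : R).

Let mD := @measurable_D R.

(** Lipschitz functions that increase to the indicator function of the open
    interval from [b] to [c]. *)
Definition trapezoid (n : nat) (b c y : R) : R :=
  Num.min 1 (n%:R * Num.max 0 (Num.min (y - b) (c - y))).

Lemma trapezoid01 n b c y : 0 <= trapezoid n b c y <= 1.
Proof.
by rewrite /trapezoid le_min ge_min lexx ler01/= andbT mulr_ge0// le_max lexx.
Qed.

Lemma trapezoid_lip n b c x y :
  `|trapezoid n b c x - trapezoid n b c y| <= n%:R * `|x - y|.
Proof.
have h1 (u v : R) : `|Num.min 1 u - Num.min 1 v| <= `|u - v|.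
  by rewrite /Num.min; case: (ltP 1 u) => ?; case: (ltP 1 v) => ?; rewrite ler_norml;
    have := ler_norm (u - v); have := ler_norm (v - u); rewrite (distrC v); lra.
apply: (le_trans (h1 _ _)); rewrite -mulrBr normrM ger0_norm// ler_wpM2l//.
have h2 (u v : R) : `|Num.max 0 u - Num.max 0 v| <= `|u - v|.
  by rewrite /Num.max; case: (ltP 0 u) => ?; case: (ltP 0 v) => ?; rewrite ler_norml;
    have := ler_norm (u - v); have := ler_norm (v - u); rewrite (distrC v); lra.
apply: (le_trans (h2 _ _)); rewrite /Num.min.
by case: (ltP (x - b) (c - x)) => ?; case: (ltP (y - b) (c - y)) => ?; rewrite ler_norml;
  have := ler_norm (x - y); have := ler_norm (y - x); rewrite (distrC y); lra.
Qed.

Lemma trapezoid_out n b c y : ~~ (b <= y <= c) -> trapezoid n b c y = 0.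
Proof.
move=> bc; rewrite /trapezoid [Num.max _ _](_ : _ = 0) ?mulr0.
  by apply/min_idPr.
by apply/max_idPl; rewrite ge_min; move: bc; rewrite negb_and -!ltNge => /orP[]; lra.
Qed.

Lemma trapezoid_nd b c y : {homo (fun n => trapezoid n b c y) : n m / (n <= m)%N >-> n <= m}.
Proof.
move=> n m nm; rewrite /trapezoid le_min ge_min lexx/= ge_min; apply/orP; right.
by rewrite ler_wpM2r ?ler_nat// le_max lexx.
Qed.

Lemma trapezoid_cvg b c y :
  trapezoid n b c y @[n --> \oo] --> (\1_(`]b, c[%classic) y : R).
Proof.
rewrite indicE mem_setE in_itv/=.
have [/andP[by_ yc]|out] := boolP (b < y < c); last first.
  apply: cvg_near_cst; apply: nearW => n.
  rewrite /trapezoid [Num.max _ _](_ : _ = 0) ?mulr0; first by apply/min_idPr.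
  by apply/max_idPl; rewrite ge_min; move: out; rewrite negb_and -!leNgt => /orP[]; lra.
set d := Num.min (y - b) (c - y).
have d0 : 0 < d by rewrite lt_min; lra.
apply: cvg_near_cst; near=> n.
rewrite /trapezoid -/d; apply/min_idPl; rewrite (max_idPr (ltW d0)) -ler_pdivrMr// div1r.
by near: n; exact: nbhs_infty_ger.
Unshelve. all: by end_near. Qed.

Lemma continuous_trapezoid n b c : continuous (trapezoid n b c).
Proof.
move=> x; apply/cvgrPdist_le => e e0; exists (e / n.+1%:R); first by rewrite /= divr_gt0.
move=> y /= xy; apply: (le_trans (trapezoid_lip _ _ _ _ _)).
apply: (@le_trans _ _ (n.+1%:R * (e / n.+1%:R))); last by rewrite mulrC divfK.
by apply: ler_pM => //; [rewrite ler_nat|exact: ltW].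
Qed.

Local Open Scope ereal_scope.

Lemma integral_trapezoid_cvg (mu : meas) b c : (0 < b)%R ->
  \int[mu]_(z in D) (trapezoid n b c z)%:E @[n --> \oo] --> mu `]b, c[%classic.
Proof.
move=> b0.
have -> : mu `]b, c[%classic = \int[mu]_(z in D) (\1_(`]b, c[%classic) z)%:E.
  rewrite integral_indic//; congr (mu _); apply/esym/setIidPl => z /=.
  by rewrite D_gt0 in_itv/= => /andP[/(lt_trans b0)].
rewrite [X in _ --> X](_ : _ =
    \int[mu]_(z in D) limn (fun n => (trapezoid n b c z)%:E)).
  apply: cvg_monotone_convergence => //.
  - move=> n; apply/measurable_EFinP; apply: measurable_funTS.
    by apply: continuous_measurable_fun; exact: continuous_trapezoid.
  - by move=> n z _; rewrite lee_fin; case/andP: (trapezoid01 n b c z).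
  - by move=> z _ n m nm; rewrite lee_fin; exact: trapezoid_nd.
apply: eq_integral => z _; apply/esym/cvg_lim => //.
by apply: cvg_EFin; [exact: nearW|exact: trapezoid_cvg].
Qed.

Lemma le_wt (T T' z : R) : (0 < T -> T <= T' -> 0 < z -> wt T z <= wt T' z)%R.
Proof.
move=> T0 TT z0; have T'0 := lt_le_trans T0 TT.
rewrite ler_wpM2l ?(ltW z0)// ler_expR !mulNr lerN2.
rewrite ler_wpM2l ?sqr_ge0// lef_pV2 ?posrE ?mulr_gt0//.
by rewrite ler_pM2l.
Qed.

Lemma integral_wt_lty (mu : meas) (T T' : R) : (0 < T)%R -> (T <= T')%R ->
  \int[mu]_(z in D) (wt T' z)%:E < +oo -> \int[mu]_(z in D) (wt T z)%:E < +oo.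
Proof.
move=> T0 TT; apply: le_lt_trans.
have mw U : measurable_fun D (fun z : R => (wt U z)%:E).
  by apply/measurable_EFinP; apply: measurable_funTS; exact: measurable_wt.
apply: ge0_le_integral => //.
- by move=> z; rewrite D_gt0 => z0; rewrite lee_fin wt_ge0// ltW.
- exact: mw.
- exact: mw.
- by move=> z; rewrite D_gt0 => z0; rewrite lee_fin le_wt.
Qed.

Lemma tempered_itv_lty (mu : meas) T b c : (0 < T)%R -> (0 < b)%R ->
  \int[mu]_(z in D) (wt T z)%:E < +oo -> mu `]b, c[%classic < +oo.
Proof.
move=> T0 b0 wfin; pose m := (b * expR (- c ^+ 2 / (2 * T)))%R.
have m0 : (0 < m)%R by rewrite mulr_gt0 ?expR_gt0.
have mw : measurable_fun D (fun z : R => (wt T z)%:E).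
  by apply/measurable_EFinP; apply: measurable_funTS; exact: measurable_wt.
have w0 (z : R) : D z -> 0 <= (wt T z)%:E.
  by rewrite D_gt0 => z0; rewrite lee_fin wt_ge0// ltW.
apply: (@le_lt_trans _ _ (m^-1%:E * \int[mu]_(z in D) (wt T z)%:E)); last first.
  by apply: lte_mul_pinfty; rewrite ?lee_fin ?invr_ge0 ?(ltW m0).
rewrite -ge0_integralZl_EFin ?invr_ge0 ?(ltW m0)//.
have -> : mu `]b, c[%classic = \int[mu]_(z in D) (\1_(`]b, c[%classic) z)%:E.
  rewrite integral_indic//; congr (mu _); apply/esym/setIidPl => z /=.
  by rewrite D_gt0 in_itv/= => /andP[/(lt_trans b0)].
apply: ge0_le_integral => //.
- by apply/measurable_EFinP; exact: measurable_indic.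
- exact: emeasurable_funM.
move=> z zD; rewrite indicE mem_setE in_itv/= -EFinM lee_fin.
have [/andP[bz zc]|_] := boolP (_ && _); last first.
  by rewrite mulr_ge0 ?invr_ge0 ?(ltW m0)// -lee_fin w0.
have z0 := lt_trans b0 bz.
rewrite mulrC ler_pdivlMr// mul1r /wt ler_pM ?expR_ge0 ?(ltW b0) ?(ltW bz)//.
rewrite ler_expR !mulNr lerN2; apply: ler_wpM2r.
  by rewrite invr_ge0 mulr_ge0// ltW.
by rewrite lerXn2r ?nnegrE ?(ltW z0) ?(ltW (lt_trans z0 zc)) ?ltW.
Qed.

(** Restricted to one of the intervals that exhaust [D] the measures are finite
    and agree on a generating family stable under intersection. *)
Lemma measure_D_unique (mu nu : meas) :
  mu (~` D) = 0 -> nu (~` D) = 0 ->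
  (forall b c : R, (0 < b)%R -> mu `]b, c[%classic < +oo) ->
  (forall b c : R, (0 < b)%R -> mu `]b, c[%classic = nu `]b, c[%classic) ->
  forall A, measurable A -> mu A = nu A.
Proof.
move=> mu0 nu0 mufin munu A mA.
pose E n : set R := `](n.+1%:R^-1)%R, (n.+1%:R)%R[%classic.
have mE n : measurable (E n : set (measurableTypeR R)) by exact: measurable_itv.
have eqE n (B : set (measurableTypeR R)) : measurable B -> mu (B `&` E n) = nu (B `&` E n).
  move=> mB.
  apply: (@measure_unique _ R (measurableTypeR R) (@RGenOInfty.G R)
    (fun i => `](- i%:R)%R, +oo[%classic) _ _ _ _ (mrestr mu (mE n)) (mrestr nu (mE n))) => //.
  - exact: RGenOInfty.measurableE.
  - move=> _ _ [x ->] [y ->]; exists (Num.max x y).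
    by apply/seteqP; split => z /=; rewrite !in_itv/= !andbT gt_max => /andP.
  - by move=> i; exists (- i%:R)%R.
  - apply/seteqP; split => // x _; exists (Num.truncn (- x)).+1 => //=.
    by rewrite in_itv/= andbT ltrNl truncnS_gt.
  - move=> _ [x ->]; change (mu (`]x, +oo[%classic `&` E n) = nu (`]x, +oo[%classic `&` E n)).
    have -> : `]x, +oo[%classic `&` E n =
        `](Num.max x n.+1%:R^-1)%R, (n.+1%:R)%R[%classic :> set R.
      by apply/seteqP; split => z; rewrite /E/= !in_itv/= gt_max andbT;
        [move=> [-> /andP[-> ->]]|move=> /andP[/andP[-> ->] ->]].
    by apply: munu; rewrite lt_max invr_gt0 ltr0n orbT.
  - move=> k; rewrite /= /mrestr (le_lt_trans _ (mufin n.+1%:R^-1%R n.+1%:R%R _))//.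
    by rewrite le_measure ?inE//; exact: measurableI.
have lim (m : meas) : m (~` D) = 0 -> m (A `&` E n) @[n --> \oo] --> m A.
  move=> m0; have -> : m A = m (\bigcup_n (A `&` E n)).
    have -> : \bigcup_n (A `&` E n) = A `&` D.
      rewrite -setI_bigcupr; congr (_ `&` _); apply/seteqP; split => x.
        move=> [n _]; rewrite D_gt0 /E/= in_itv/= => /andP[+ _].
        by apply: lt_trans; rewrite invr_gt0.
      rewrite D_gt0 => x0.
      exists (maxn (Num.truncn x) (Num.truncn x^-1)) => //; rewrite /E/= in_itv/=.
      apply/andP; split.
        rewrite invf_plt ?posrE// (lt_le_trans (truncnS_gt _))//.
        by rewrite ler_nat ltnS leq_maxr.
      by rewrite (lt_le_trans (truncnS_gt _))// ler_nat ltnS leq_maxl.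
    rewrite -[in LHS](setIT A) -(setUv D) setIUr measureU//.
    - rewrite -[RHS]adde0; congr (_ + _); apply: (subset_measure0 _ _ _ m0) => //.
        by apply: measurableI => //; exact: measurableC.
      exact: measurableC.
    - exact: measurableI.
    - by apply: measurableI => //; exact: measurableC.
    - by rewrite setIACA setICr setI0.
  apply: nondecreasing_cvg_mu => //.
  - by move=> n; exact: measurableI.
  - by apply: bigcup_measurable => n _; exact: measurableI.
  - move=> n k nk; apply/subsetPset; apply: setIS; apply: subset_itv; rewrite bnd_simp.
      by rewrite lef_pV2 ?posrE// ler_nat.
    by rewrite ler_nat.
have := lim _ mu0; rewrite (_ : (fun n => _) = (fun n => nu (A `&` E n))).
  by move/cvg_unique => /(_ (@ereal_hausdorff R) _ (lim _ nu0)).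
by apply/funext => n; exact: eqE.
Qed.

(** The limit at time 0 of the pairings with test functions recovers the
    measure; the coefficient is then read off at one point where the potential
    is finite. *)
Lemma pair_unique (mu nu : {sigma_finite_measure set (measurableTypeR R) -> \bar R})
    (a a' T : R) : (0 <= a)%R -> (0 <= a')%R -> (0 < T)%R ->
  mu (~` D) = 0 -> nu (~` D) = 0 ->
  \int[mu]_(z in D) (wt T z)%:E < +oo -> \int[nu]_(z in D) (wt T z)%:E < +oo ->
  (forall s, (0 < s)%R -> {ae leb, forall y, D y ->
    Vint mu a s y = Vint nu a' s y}) ->
  a = a' /\ forall A, measurable A -> mu A = nu A.
Proof.
move=> a0 a'0 T0 mu0 nu0 muT nuT eqV.
have eqtrap n (b c : R) : (0 < b)%R ->
    \int[mu]_(z in D) (trapezoid n b c z)%:E = \int[nu]_(z in D) (trapezoid n b c z)%:E.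
  move=> b0.
  have H1 := pairing_cvg a0 T0 muT (ler0n R n) (trapezoid01 n b c)
    (trapezoid_lip n b c) b0 (@trapezoid_out n b c).
  have H2 := pairing_cvg a'0 T0 nuT (ler0n R n) (trapezoid01 n b c)
    (trapezoid_lip n b c) b0 (@trapezoid_out n b c).
  apply: (cvg_unique (@ereal_hausdorff R) H1); apply: cvg_trans H2.
  apply: near_eq_cvg; apply: nearW => i.
  have s0 : (0 < T / 4 / i.+1%:R)%R by rewrite !divr_gt0.
  have mt : measurable_fun D (fun y => (trapezoid n b c y)%:E).
    apply/measurable_EFinP; apply: measurable_funTS.
    by apply: continuous_measurable_fun; exact: continuous_trapezoid.
  have t0 y : 0 <= (trapezoid n b c y)%:E.
    by rewrite lee_fin; case/andP: (trapezoid01 n b c y).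
  apply: ge0_ae_eq_integral => //.
  - by apply: emeasurable_funM => //; exact: measurable_Vint.
  - by apply: emeasurable_funM => //; exact: measurable_Vint.
  - by move=> y yD; rewrite mule_ge0// Vint_ge0.
  - by move=> y yD; rewrite mule_ge0// Vint_ge0.
  - by apply: ae_mono (eqV _ s0) => y + yD => /(_ yD) ->.
have munu : forall A, measurable A -> mu A = nu A.
  apply: measure_D_unique => // b c b0; first exact: (tempered_itv_lty c T0 b0 muT).
  have := @integral_trapezoid_cvg mu b c b0.
  rewrite (_ : (fun n => _) = (fun n => \int[nu]_(z in D) (trapezoid n b c z)%:E)).
    by move/cvg_unique => /(_ (@ereal_hausdorff R) _ (@integral_trapezoid_cvg nu b c b0)).
  by apply/funext => n; exact: eqtrap.
split => //; have T20 : (0 < T / 2)%R by rewrite divr_gt0.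
have [y yD] := ae_D_ex (eqV _ T20).
rewrite /Vint; have -> : Uint mu (T / 2) y = Uint nu (T / 2) y.
  by apply: eq_measure_integral => A mA _; exact: munu.
have : Uint nu (T / 2) y \is a fin_num.
  by rewrite ge0_fin_numE ?Uint_ge0// (Uint_lty _ _ _ nuT)//; lra.
case: (Uint nu _ y) => // u _; rewrite -!EFinD => -[/addIr /mulIf] -> //.
by rewrite gt_eqF// k_gt0// -D_gt0.
Qed.

End pair_uniqueness.

(** * Existence of the representing pair *)

Section density_measure.
Local Open Scope ereal_scope.
Context d (T : measurableType d) (R : realType) (m : {measure set T -> \bar R}).
Variable h : T -> R.

(** The hypotheses are arguments so that the set function carries a measure
    structure. *)
Definition dens of (forall x, 0 <= h x)%R & measurable_fun setT h :=
  fun A : set T => \int[m]_(x in A) (h x)%:E.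

Variables (h0 : forall x, (0 <= h x)%R) (mh : measurable_fun setT h).

Let dens0 : dens h0 mh set0 = 0. Proof. exact: integral_set0. Qed.

Let dens_ge0 A : 0 <= dens h0 mh A.
Proof. by apply: integral_ge0 => x _; rewrite lee_fin. Qed.

Let dens_sigma_additive : semi_sigma_additive (dens h0 mh).
Proof.
apply: semi_sigma_additive_nng_induced; first exact/measurable_EFinP.
by move=> x; rewrite lee_fin.
Qed.

HB.instance Definition _ :=
  isMeasure.Build _ _ _ (dens h0 mh) dens0 dens_ge0 dens_sigma_additive.

Lemma density_exists : exists N : {measure set T -> \bar R},
  forall A, N A = \int[m]_(x in A) (h x)%:E.
Proof. by exists (dens h0 mh). Qed.

End density_measure.

(** The same set function, with sigma-finiteness recorded in its type, as
    Fubini's theorem requires. *)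
Definition with_sigma_finite d (T : measurableType d) (R : realType)
  (mu : {measure set T -> \bar R}) & sigma_finite setT mu : set T -> \bar R := mu.

Section with_sigma_finite.
Context d (T : measurableType d) (R : realType).
Variables (mu : {measure set T -> \bar R}) (sf : sigma_finite setT mu).

HB.instance Definition _ := Measure.copy (with_sigma_finite sf) mu.

HB.instance Definition _ := Measure_isSigmaFinite.Build _ _ _ (with_sigma_finite sf) sf.

End with_sigma_finite.

Section sigma_finite.
Context {R : realType}.
Notation meas := {measure set (measurableTypeR R) -> \bar R}.
Notation sfmeas := {sigma_finite_measure set (measurableTypeR R) -> \bar R}.
Local Open Scope ereal_scope.

(** The weight is bounded away from 0 on each of the intervals from [n.+1%:R^-1] to
    [n.+1%:R], which exhaust [D]. *)
Lemma tempered_sigma_finite (mu : meas) T : mu (~` D) = 0 -> (0 < T)%R ->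
  \int[mu]_(z in D) (wt T z)%:E < +oo ->
  exists m : sfmeas, (forall A, m A = mu A) /\ Uint mu = Uint m.
Proof.
move=> mu0 T0 wfin; have mD := @measurable_D R.
have sf : sigma_finite setT mu.
  exists (fun n => (~` D) `|` `](n.+1%:R^-1)%R, (n.+1%:R)%R[%classic).
    apply/esym/seteqP; split => // x _; have [xD|] := pselect (D x); last first.
      by exists 0%N => //; left.
    move: xD; rewrite D_gt0 => x0.
    exists (maxn (Num.truncn x) (Num.truncn x^-1)) => //; right.
    rewrite /= in_itv/=; apply/andP; split.
      rewrite invf_plt ?posrE// (lt_le_trans (truncnS_gt _))//.
      by rewrite ler_nat ltnS leq_maxr.
    by rewrite (lt_le_trans (truncnS_gt _))// ler_nat ltnS leq_maxl.
  move=> n; have mDC : measurable (~` D : set (measurableTypeR R)) by exact: measurableC.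
  split; first exact: measurableU.
  apply: (le_lt_trans (measureU2 _ _ _)) => //.
  rewrite [X in X + _](_ : _ = 0) ?add0e//.
  by apply: (tempered_itv_lty _ T0); rewrite ?invr_gt0.
by exists (with_sigma_finite sf).
Qed.

End sigma_finite.

Section existence.
Context {R : realType}.
Notation leb := (@lebesgue_measure R).
Notation meas := {measure set (measurableTypeR R) -> \bar R}.
Notation sfmeas := {sigma_finite_measure set (measurableTypeR R) -> \bar R}.
Implicit Types (s t x y z : R).

Let mD := @measurable_D R.

(** The kernel divided by the weight, with the value at 0 that makes it
    continuous: integrating it against a finite measure on the closed half-line
    produces both parts of the representation. *)
Definition ratio t z y : R :=
  (if y == 0 then 2 * k t z else p t z y / y) * expR (y ^+ 2).

Lemma ratioN t z y : ratio t z (- y) = ratio t z y.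
Proof.
rewrite /ratio oppr_eq0 sqrrN; case: ifPn => // y0.
by rewrite pNr invrN mulrNN.
Qed.

Lemma ratio0 t z : ratio t z 0 = 2 * k t z.
Proof. by rewrite /ratio eqxx expr0n/= expR0 mulr1. Qed.

Lemma ratio_wt t z y : 0 < y -> ratio t z y = p t z y / wt 2^-1 y.
Proof.
move=> y0; rewrite /ratio gt_eqF// /wt invfM -expRN mulrA; congr (_ * expR _).
by rewrite mulfV// divr1 opprK.
Qed.

Lemma ratio_ge0 t z y : 0 < t -> 0 < z -> 0 <= ratio t z y.
Proof.
move=> t0 z0; wlog y0 : y / 0 <= y => [h|].
  have [|/ltW y0] := leP 0 y; first exact: h.
  by rewrite -ratioN h// oppr_ge0.
rewrite mulr_ge0 ?expR_ge0//; case: ifPn => _.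
  by rewrite mulr_ge0// k_ge0// ltW.
by rewrite divr_ge0// p_ge0// ltW.
Qed.

Lemma continuous_ratio t z : 0 < t -> continuous (ratio t z).
Proof.
move=> t0; pose q w : R := if w == 0 then 2 * k t z else p t z w / w.
have cq : continuous q.
  move=> y; have [y0|y0] := eqVneq y 0.
    rewrite {y}y0; apply/continuous_withinNx; rewrite {2}/q eqxx.
    apply: cvg_trans (@p_slope0 R t z t0); apply: near_eq_cvg; near=> w.
    have w0 : w != 0 by near: w; exact: nbhs_dnbhs_neq.
    by rewrite /q (negbTE w0) pC.
  have qy : p t z w / w @[w --> y] --> q y.
    rewrite /q (negbTE y0); apply: cvgM; first exact: continuous_p.
    by apply: cvgV => //; exact: cvg_id.
  apply: cvg_trans qy; apply: near_eq_cvg; near=> w.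
  have w0 : w != 0 by near: w; apply: (@cvgr_neq0 _ _ _ _ _ id y) => //; exact: cvg_id.
  by rewrite /q (negbTE w0).
move=> y; apply: (@continuousM _ _ q (fun y => expR (y ^+ 2)) y); first exact: cq.
apply: (@continuous_comp _ _ _ (fun y : R => y ^+ 2) expR).
  exact: sqr_continuous.
exact: continuous_expR.
Unshelve. all: by end_near. Qed.

(** For [t < 1/2] the kernel decays faster than the weight [wt 2^-1]. *)
Lemma ratio_decay t z : 0 < t < 2^-1 -> 0 < z ->
  forall e, 0 < e -> exists A : R, forall y, A <= `|y| -> ratio t z y <= e.
Proof.
move=> /andP[t0 t1] z0 e e0; pose t' := (t + 2^-1) / 2.
have tt' : t < t' by rewrite /t'; lra.
have t'1 : t' < 2^-1 by rewrite /t'; lra.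
have t'0 : 0 < t' by lra.
have [C C0 hC] := p_le_wt t0 (lexx t) tt' z0.
pose kp := (2 * t')^-1 - 1.
have kp0 : 0 < kp by rewrite subr_gt0 invf_gt1 ?mulr_gt0//; lra.
pose A := 1 + C / (e * kp).
have A1 : 1 <= A by rewrite lerDl divr_ge0 ?mulr_ge0 ?ltW.
exists A => y Ay.
suff h : forall w, A <= w -> ratio t z w <= e.
  have [y0|y0] := leP 0 y; first by rewrite h// (le_trans Ay)// ger0_norm.
  by rewrite -ratioN h// (le_trans Ay)// ltr0_norm.
move=> w Aw; have w0 : 0 < w by lra.
rewrite ratio_wt// ler_pdivrMr ?wt_gt0// (le_trans (hC t w _ w0)) ?lexx//.
rewrite /wt mulrCA [leRHS]mulrCA ler_wpM2l ?(ltW w0)//.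
have -> : expR (- w ^+ 2 / (2 * t')) = expR (- w ^+ 2 / (2 * 2^-1)) * expR (- (kp * w ^+ 2)).
  rewrite -expRD /kp; congr expR; field.
  by rewrite gt_eqF.
rewrite mulrCA mulrC ler_wpM2r ?expR_ge0// expRN ler_pdivrMr ?expR_gt0//.
rewrite (@le_trans _ _ (e * (1 + kp * w ^+ 2)))//; last first.
  by rewrite ler_wpM2l ?expR_ge1Dx// ltW.
have : C <= e * kp * A.
  by rewrite /A mulrDr mulr1 (mulrC (e * kp)) divfK ?gt_eqF ?mulr_gt0// lerDr mulr_ge0// ltW.
have : A <= w ^+ 2 by nra.
by have := mulr_gt0 e0 kp0; nra.
Qed.

Local Open Scope ereal_scope.

Section path.
Variable f : R -> R -> R.
Hypothesis f0 : forall s y, (0 <= f s y)%R.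
Hypothesis mf : forall s, measurable_fun setT (f s).
Hypothesis ff : forall s, (0 < s)%R -> sqnorm (f s) < +oo.
Hypothesis fT : forall r t, (0 < r)%R -> (0 < t)%R ->
  {ae leb, forall y, D y -> (f (r + t) y)%:E = Tint t (f r) y}.

(** The path satisfies the semigroup equation almost everywhere only, but
    applying the semigroup once more turns it into an equation at every point. *)
Lemma Tint_path_lt q r q' r' x : (0 < q)%R -> (0 < r)%R -> (0 < q')%R -> (r < r')%R ->
  (r + q = r' + q')%R -> D x -> Tint q (f r) x = Tint q' (f r') x.
Proof.
move=> q0 r0 q'0 rr' e xD; have d0 : (0 < r' - r)%R by rewrite subr_gt0.
have -> : (q = q' + (r' - r))%R by lra.
rewrite -Tint_semigroup//; apply: ge0_ae_eq_integral => //.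
- apply: emeasurable_funM; last exact: measurable_Tint.
  by apply/measurable_EFinP; exact: measurable_p.
- exact: measurable_pM.
- by move=> y yD; rewrite mule_ge0 ?lee_fin ?D_p_ge0// Tint_ge0.
- by move=> y yD; rewrite lee_fin mulr_ge0// D_p_ge0.
- by apply: ae_mono (fT r0 d0) => y + yD => /(_ yD); rewrite subrKC EFinM => ->.
Qed.

Lemma Tint_path q r q' r' x : (0 < q)%R -> (0 < r)%R -> (0 < q')%R -> (0 < r')%R ->
  (r + q = r' + q')%R -> D x -> Tint q (f r) x = Tint q' (f r') x.
Proof.
move=> q0 r0 q'0 r'0 e xD; have [rr'|rr'|rr'] := ltgtP r r'.
- exact: Tint_path_lt.
- by apply/esym/Tint_path_lt.
- by move: e; rewrite rr' => /addrI ->.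
Qed.

(* the version of the path that is defined at every point *)
Let u t z := Tint (t / 2) (f (t / 2)) z.

Let uE q r t z : (0 < q)%R -> (0 < r)%R -> (t = r + q)%R -> D z -> u t z = Tint q (f r) z.
Proof.
by move=> q0 r0 -> zD; apply: Tint_path; rewrite ?divr_gt0 ?addr_gt0//; lra.
Qed.

Let u_fin t z : (0 < t)%R -> D z -> u t z \is a fin_num.
Proof. by move=> t0 zD; apply: Tint_fin_num; rewrite ?divr_gt0// ff// divr_gt0. Qed.

Let f_u t : (0 < t)%R -> {ae leb, forall y, D y -> (f t y)%:E = u t y}.
Proof.
move=> t0; have t20 : (0 < t / 2)%R by rewrite divr_gt0.
by apply: ae_mono (fT t20 t20) => y; rewrite (_ : t / 2 + t / 2 = t)%R//; lra.
Qed.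

Let s_ n : R := (n.+1%:R^-1)%R.

Let s_gt0 n : (0 < s_ n)%R. Proof. by rewrite invr_gt0. Qed.

Let s_01 n : (0 <= s_ n <= 1)%R.
Proof. by rewrite ltW//= invf_le1// ler1n. Qed.

Let h n y : R := (wt 2^-1 y * f (s_ n) y * \1_(@D R) y)%R.

Let h0 n y : (0 <= h n y)%R.
Proof.
rewrite /h indicE; have [|_] := boolP (y \in D); last by rewrite mulr0.
by rewrite inE D_gt0 => /ltW y0; apply: mulr_ge0 => //; apply: mulr_ge0 => //; exact: wt_ge0.
Qed.

Let mh n : measurable_fun setT (h n).
Proof.
apply: measurable_funM; last exact: measurable_indic.
by apply: measurable_funM => //; exact: measurable_wt.
Qed.

Let integral_h n (g : R -> R) :
  \int[leb]_y ((h n y)%:E * (g y)%:E) = \int[leb]_(y in D) (wt 2^-1 y * f (s_ n) y * g y)%:E.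
Proof.
rewrite [RHS]integral_mkcond; apply: eq_integral => y _.
rewrite epatch_indic /h -EFinM -EFinM; congr EFin; ring.
Qed.

(* By [p_ge_k], the weighted mass of [f (s_ n)] is at most a multiple of the
   value at 1 of the path at time [s_ n + 2^-1]. *)
Let bounded_mass : exists C : R, forall n, \int[leb]_y (h n y)%:E <= C%:E.
Proof.
have h4 : (0 < 4^-1 :> R)%R by rewrite invr_gt0.
have h2 : (0 < 2^-1 :> R)%R by rewrite invr_gt0.
have oneD : D (1%R : R) by rewrite D_gt0.
have h14 : (4^-1 <= 4^-1 + 1 :> R)%R by rewrite lerDl.
have [C hC] := Tint_bounded (f0 _) (mf _) h4 h14 oneD (ff h4).
have k0 : (0 < k 2^-1 (1%R : R))%R by rewrite k_gt0.
have kV0 : (0 <= (k 2^-1 (1%R : R))^-1)%R by rewrite invr_ge0 ltW.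
exists ((k 2^-1 1)^-1 * C)%R => n.
apply: (@le_trans _ _ (((k 2^-1 1)^-1)%:E * Tint 2^-1 (f (s_ n)) 1)); last first.
  rewrite EFinM; apply: lee_wpmul2l; first by rewrite lee_fin.
  rewrite (@Tint_path _ _ (4^-1 + s_ n)%R 4^-1%R)// ?addr_gt0//; last first.
    have e4 : (2^-1 = 4^-1 + 4^-1 :> R)%R by field.
    by rewrite e4; ring.
  by apply: hC; have /andP[s0 s1] := s_01 n; rewrite lerDl s0 lerD2l.
under eq_integral do rewrite -[X in X%:E]mulr1 EFinM.
rewrite (integral_h n (cst 1%R)) /Tint -ge0_integralZl_EFin//; last 2 first.
- by move=> y yD; rewrite lee_fin mulr_ge0// D_p_ge0.
- exact: measurable_pM.
apply: ge0_le_integral => //.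
- move=> y; rewrite D_gt0 => /ltW y0; rewrite lee_fin mulr1.
  by apply: mulr_ge0 => //; exact: wt_ge0.
- apply/measurable_EFinP; apply: measurable_funTS; apply: measurable_funM => //.
  by apply: (@measurable_funM _ R R setT (wt 2^-1)) => //; exact: measurable_wt.
- apply: emeasurable_funM; first exact: measurable_cst.
  exact: measurable_pM.
- move=> y; rewrite D_gt0 => y0; rewrite -EFinM lee_fin /cst mulr1 mulrA ler_wpM2r//.
  rewrite ler_pdivlMl//.
  by apply: p_ge_k => //; exact: ltW.
Qed.

Let vague_limit : exists nu : meas, [/\ nu setT < +oo, nu `]-oo, 0%R[%classic = 0 &
  forall t z, (0 < t < 2^-1)%R -> D z -> \int[nu]_y (ratio t z y)%:E = u t z].
Proof.
have /choice[N hN] n := density_exists leb (@h0 n) (@mh n).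
have [C hC] := bounded_mass.
have NC n : N n setT <= C%:E by rewrite hN.
have N0 n : N n `]-oo, 0%R[%classic = 0.
  rewrite hN integral0_eq// => y /=; rewrite in_itv/= => y0.
  rewrite /h indicE memNset ?mulr0//.
  by rewrite D_gt0 => y1; have := lt_trans y0 y1; rewrite ltxx.
have [nu [nuC nu0 hnu]] := vague_compact NC N0.
exists nu; split => //; first exact: le_lt_trans nuC (ltry _).
move=> t z /andP[t0 t2] zD; have z0 : (0 < z)%R by rewrite -D_gt0.
have th0 : (0 < t / 2)%R by rewrite divr_gt0.
have cr : continuous (ratio t z) by exact: continuous_ratio.
have mr := continuous_measurable_fun cr.
have NE n : \int[N n]_y (ratio t z y)%:E = Tint (t / 2 + s_ n) (f (t / 2)) z.
  rewrite (@integral_density _ (measurableTypeR R) R (N n) leb (h n) (@h0 n) (@mh n) (fun A _ => hN n A))//.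
  - rewrite integral_h -(@Tint_path t (s_ n))//; last 2 first.
    + by rewrite addr_gt0.
    + lra.
    apply: eq_integral => y /[!inE]; rewrite D_gt0 => y0; congr EFin.
    rewrite ratio_wt//; field.
    by rewrite gt_eqF// wt_gt0.
  - by move=> y; rewrite lee_fin ratio_ge0.
  - exact/measurable_EFinP.
rewrite (hnu _ cr _ _ (fine (u t z))).
- by rewrite fineK// u_fin.
- by move=> y; exact: ratio_ge0.
- by move=> e e0; apply: ratio_decay => //; rewrite t0.
- under eq_fun do rewrite NE.
  apply: fine_cvg; rewrite fineK ?u_fin//.
  apply: Tint_right_cvg => //; first exact: ff.
  exact: cvg_harmonic.
Qed.

(** Twice the mass that the limit of the measures [wt 2^-1 y * f s y * dy] has
    at 0 is the coefficient of [k]; its part on [D], divided by the weight, is the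
    measure of the pair. *)
Lemma entrance_path_representation : exists a (mu : meas),
  [/\ (0 <= a)%R, mu (~` D) = 0,
      exists2 T, (0 < T)%R & \int[mu]_(z in D) (wt T z)%:E < +oo &
      forall s, (0 < s)%R -> {ae leb, forall y, D y ->
        (f s y)%:E = Vint mu a s y}].
Proof.
have [nu [nuoo nu0 nuE]] := vague_limit.
pose w : R -> R := (fun y => expR (- ln (wt 2^-1 y))) \_ (@D R).
have w0 y : (0 <= w y)%R by rewrite /w patchE; case: ifP => // _; exact: expR_ge0.
have wD y : (0 < y)%R -> w y = (wt 2^-1 y)^-1%R.
  move=> y0; rewrite /w patchE mem_set ?D_gt0//.
  by rewrite expRN lnK// posrE wt_gt0.
have mw : measurable_fun setT w.
  apply/(measurable_restrictT _ _).1 => //; apply: measurable_funTS.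
  apply: measurableT_comp => //; apply: measurableT_comp => //.
  by apply: measurableT_comp; [exact: measurable_ln|exact: measurable_wt].
have [mu muE] := density_exists nu w0 mw.
have mu0 : mu (~` D) = 0.
  by rewrite muE integral0_eq// => y yD; rewrite /w patchE memNset.
have UE t z : (0 < t)%R -> D z -> Uint mu t z = \int[nu]_(y in D) (ratio t z y)%:E.
  move=> t0 zD; rewrite /Uint integral_mkcond.
  rewrite (@integral_density _ (measurableTypeR R) R mu nu w w0 mw (fun A _ => muE A))//.
  - rewrite [RHS]integral_mkcond; apply: eq_integral => y _; rewrite !patchE.
    case: ifPn => [|_]; last by rewrite mule0.
    by rewrite inE D_gt0 => y0; rewrite wD// ratio_wt// pC -EFinM mulrC.
  - by move=> y; apply: erestrict_ge0 => x xD; rewrite lee_fin D_p_ge0.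
  - by apply/(measurable_restrictT _ _).1 => //; apply/measurable_EFinP; exact: measurable_p.
(* the value of [ratio] at 0 is twice [k] *)
pose a := (2 * fine (nu [set 0%R]))%R.
have a0 : (0 <= a)%R by rewrite mulr_ge0// fine_ge0.
have nuE' t z : (0 < t < 2^-1)%R -> D z -> u t z = Vint mu a t z.
  move=> t02 zD; have t0 : (0 < t)%R by case/andP: t02.
  have z0 : (0 < z)%R by rewrite -D_gt0.
  have mr : measurable_fun setT (fun y => (ratio t z y)%:E).
    apply/measurable_EFinP; apply: continuous_measurable_fun.
    by have := continuous_ratio t0; apply.
  have r0 y : 0 <= (ratio t z y)%:E by rewrite lee_fin ratio_ge0.
  have m1 : measurable (`]-oo, 0%R[%classic : set (measurableTypeR R)) by exact: measurable_itv.
  have m2 : measurable ([set 0%R] : set (measurableTypeR R)) by exact: measurable_set1.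
  rewrite -nuE//.
  have -> : [set: R] = `]-oo, 0%R[%classic `|` ([set 0%R] `|` D).
    apply/esym/seteqP; split => // x _; rewrite /D /= !in_itv/= andbT.
    by have [x0|x0|x0] := ltgtP x 0%R; [left|right; right|right; left].
  rewrite ge0_integral_setU//; last 3 first.
  - exact: measurableU.
  - exact: measurable_funTS.
  - apply/disj_setPS => x [] /=; rewrite in_itv/= => x0 [x1|]; last first.
      by rewrite D_gt0 => /(lt_trans x0); rewrite ltxx.
    by move: x0; rewrite x1 ltxx.
  rewrite ge0_integral_setU//; last 2 first.
  - exact: measurable_funTS.
  - by apply/disj_setPS => x [] /= ->; rewrite D_gt0 ltxx.
  rewrite null_set_integral ?add0e//; last exact: measurable_funTS.
  rewrite /Vint UE//; congr (_ + _).
  rewrite (eq_integral (cst (2 * k t z)%:E)); last first.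
    by move=> y; rewrite inE => /= ->; rewrite ratio0.
  rewrite integral_cst// /a mulrAC [in RHS]EFinM fineK// ge0_fin_numE//.
  by rewrite (le_lt_trans _ nuoo)// le_measure ?inE.
have h4 : (0 < 4^-1 :> R)%R by rewrite invr_gt0.
have h42 : (0 < (4^-1 : R) < 2^-1)%R by apply/andP; split; lra.
have oneD : D (1%R : R) by rewrite D_gt0.
have wfin : \int[mu]_(z in D) (wt 4^-1 z)%:E < +oo.
  apply: (wt_lty h4 oneD).
  have := u_fin h4 oneD; rewrite nuE'// /Vint fin_numD => /andP[_].
  by rewrite ge0_fin_numE ?Uint_ge0.
exists a, mu; split => //; first by exists (4^-1)%R.
have [m [_ UmuE]] := tempered_sigma_finite mu0 h4 wfin.
have VmuE t z : Vint mu a t z = Vint m a t z by rewrite /Vint UmuE.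
(* for [s >= 1/2] the representation is propagated from time 1/4 *)
move=> s s0; apply: ae_mono (f_u s0) => z + zD => /(_ zD) ->.
have [s2|s2] := ltP s (2^-1)%R; first by rewrite nuE'// s0.
have d0 : (0 < s - 4^-1)%R by rewrite subr_gt0 (lt_le_trans _ s2)//; case/andP: h42.
rewrite (@uE (s - 4^-1)%R 4^-1%R)//; last by rewrite subrKC.
rewrite -[s in RHS](subrK 4^-1)%R VmuE -Vint_semigroup//.
apply: ge0_ae_eq_integral => //.
- exact: measurable_pM.
- apply: emeasurable_funM; last exact: measurable_Vint.
  by apply/measurable_EFinP; exact: measurable_p.
- by move=> y yD; rewrite lee_fin mulr_ge0// D_p_ge0.
- by move=> y yD; rewrite mule_ge0 ?lee_fin ?D_p_ge0// Vint_ge0.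
- by apply: ae_mono (f_u h4) => y + yD => /(_ yD) fE; rewrite EFinM fE nuE'// VmuE.
Qed.

End path.

End existence.

(** * Classes of square integrable functions *)

Section square_integrable.
Context {R : realType}.
Notation leb := (@lebesgue_measure R).
Notation gamma := (@gamma R).
Local Open Scope ereal_scope.

Let mD := @measurable_D R.

Lemma ae_eq_sqnorm (f g : R -> R) : measurable_fun setT f -> measurable_fun setT g ->
  {ae leb, forall y, D y -> f y = g y} -> sqnorm f = sqnorm g.
Proof.
move=> mf mg fg; apply: ae_eq_integral => //.
- by apply/measurable_EFinP; apply: measurable_funTS; exact: measurable_hwsqr.
- by apply/measurable_EFinP; apply: measurable_funTS; exact: measurable_hwsqr.
- by apply: ae_mono fg => y fgy yD; rewrite fgy.
Qed.

Lemma sqre_poweR (x : \bar R) : 0 <= x -> x ^+ 2 = x `^ 2.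
Proof.
case: x => [x| |]// x0; first by rewrite poweR_EFin powR_mulrn// EFin_expe.
by rewrite poweRyr// expeS expe1 mulyy.
Qed.

Lemma sqr_Lnorm (f : R -> R) : measurable_fun setT f ->
  'N[gamma]_2%:E[EFin \o f] ^+ 2 = sqnorm f.
Proof.
move=> mf; rewrite sqre_poweR ?Lnorm_ge0// poweR_Lnorm//.
have fE y : `|(EFin \o f) y| `^ 2 = (f y ^+ 2)%:E.
  by rewrite [abse _]/= poweR_EFin powR_mulrn// real_normK ?num_real.
under eq_integral do rewrite fE.
rewrite integral_gamma// => [y|]; first by rewrite lee_fin sqr_ge0.
by apply/measurable_EFinP; exact: measurable_funX.
Qed.

Let mfun_ext (f g : {mfun_ gamma, measurableTypeR R >-> measurableTypeR R}) :
  {ae leb, forall y, D y -> f y = g y} -> f = g.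
Proof.
move=> /ae_gammaP fg; rewrite -[f]reprK -[g]reprK.
by apply/eqmodP/asboolP; apply: ae_mono fg => x + _.
Qed.

Lemma L2_ext (f g : @L2 R) : {ae leb, forall y, D y -> f y = g y} -> f = g.
Proof.
case: f => f [[pf]]; case: g => g [[pg]] fg.
have {fg} fg : f = g by exact: mfun_ext fg.
by case: _ / fg pg => pg; rewrite (Prop_irrelevance pf pg).
Qed.

Lemma L2_class (f : R -> R) : measurable_fun setT f -> sqnorm f < +oo ->
  exists g : @L2 R, {ae leb, forall y, D y -> g y = f y}.
Proof.
move=> mf foo.
pose f' : {mfun (measurableTypeR R) >-> (measurableTypeR R)} :=
  HB.pack f (isMeasurableFun.Build _ _ (measurableTypeR R) (measurableTypeR R) f mf).
pose q : {mfun_ gamma, measurableTypeR R >-> measurableTypeR R} := (\pi f')%qT.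
have qf : {ae leb, forall y, D y -> q y = f y}.
  apply/ae_gammaP; have /eqmodP/asboolP := reprK q.
  by apply: ae_mono => x /(_ I).
have mq : measurable_fun setT (q : R -> R) by exact: (@measurable_funPT _ _ _ _ (repr q)).
have qoo : finite_norm gamma 2%:E q.
  rewrite /finite_norm.
  have : 'N[gamma]_2%:E[EFin \o q] ^+ 2 < +oo.
    rewrite sqr_Lnorm//.
    by rewrite (@ae_eq_sqnorm _ f).
  by case: ('N[gamma]_2%:E[EFin \o q]) => [x| |]//; rewrite ?ltry// expeS expe1 mulyy.
pose g : @L2 R := HB.pack_for (@L2 R) q (isFinLebesgue.Build _ _ _ gamma 2%:E (lee1n 2) q qoo).
by exists g.
Qed.

Lemma measurable_L2 (f : @L2 R) : measurable_fun setT (f : R -> R).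
Proof. exact: (@measurable_funPT _ _ _ _ (repr (f : {mfun_ gamma, _ >-> _}))). Qed.

Lemma sqnorm_L2_lty (f : @L2 R) : sqnorm f < +oo.
Proof.
rewrite -sqr_Lnorm; last exact: measurable_L2.
have : finite_norm gamma 2%:E f by exact: Lebesgue_finite.
rewrite /finite_norm.
have := Lnorm_ge0 gamma 2%:E (EFin \o f).
by case: ('N[gamma]_2%:E[EFin \o f]) => [x| |]// _ _; rewrite -EFin_expe ltry.
Qed.

End square_integrable.

(** * The path of a pair *)

Section square_function.
Context {R : realType}.
Notation leb := (@lebesgue_measure R).
Notation gamma := (@gamma R).
Notation meas := {measure set (measurableTypeR R) -> \bar R}.
Notation sfmeas := {sigma_finite_measure set (measurableTypeR R) -> \bar R}.
Local Open Scope ereal_scope.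

Let mD := @measurable_D R.

Let mA l : measurable (`]0%R, l[%classic : set R). Proof. exact: measurable_itv. Qed.

Lemma Vint0 (mu : meas) : Vint mu 0 = Uint mu.
Proof. by apply/funext => t; apply/funext => y; rewrite /Vint mul0r add0e. Qed.

Definition Vsq (mu : meas) (a s : R) : \bar R :=
  \int[leb]_(y in D) ((hw y)%:E * Vint mu a s y ^+ 2).

Lemma hw_Vint_ge0 (mu : meas) a s (y : R) : (0 <= a)%R -> (0 < s)%R -> D y ->
  0 <= (hw y)%:E * Vint mu a s y ^+ 2.
Proof.
move=> a0 s0 yD; rewrite mule_ge0 ?lee_fin ?hw_ge0//.
by rewrite mule_ge0// Vint_ge0.
Qed.

Lemma measurable_hw_Vint (m : sfmeas) a s : (0 < s)%R ->
  measurable_fun D (fun y => (hw y)%:E * Vint m a s y ^+ 2).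
Proof.
move=> s0; have mV := measurable_Vint m a s0.
apply: emeasurable_funM; last exact: (emeasurable_funM mV mV).
by apply/measurable_EFinP; apply: measurable_funTS; exact: measurable_hw.
Qed.

Lemma Vsq_ge0 mu a s : (0 <= a)%R -> (0 < s)%R -> 0 <= Vsq mu a s.
Proof. by move=> a0 s0; apply: integral_ge0 => y yD; exact: hw_Vint_ge0. Qed.

Lemma measurable_Vint_prod (m : sfmeas) a (l : R) :
  measurable_fun (`]0%R, l[%classic `*` @D R) (fun z : R * R => Vint m a z.1 z.2).
Proof.
have mAD : measurable (`]0%R, l[%classic `*` @D R) by exact: measurableX.
have A0 (z : R * R) : (`]0%R, l[%classic `*` @D R) z -> (0 < z.1)%R.
  by move=> [] /=; rewrite in_itv/= => /andP[].
apply: emeasurable_funD.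
  apply/measurable_EFinP; apply: measurable_funM => //; apply: measurable_k => //.
    exact: measurable_funTS.
  exact: measurable_funTS.
apply: (@measurable_integral_on _ _ _ _ _ m (`]0%R, l[%classic `*` @D R) (@D R)
  (fun z x => (p z.1 x z.2)%:E)) => //.
  apply/measurable_EFinP; apply: (@measurable_p R _ _ _ (fun w => w.1.1) snd (fun w => w.1.2)).
  - exact: measurableX.
  - by apply: measurable_funTS; apply: measurableT_comp.
  - exact: measurable_funTS.
  - by apply: measurable_funTS; apply: measurableT_comp.
  - by move=> w [/A0].
move=> z x zA xD; rewrite lee_fin D_p_ge0//; first exact: A0 zA.
by case: zA.
Qed.

Lemma measurable_Vsq (m : sfmeas) a (l : R) : (0 <= a)%R ->
  measurable_fun `]0%R, l[%classic (Vsq m a).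
Proof.
move=> a0; apply: (@measurable_integral_on _ _ _ _ _ leb) => //.
  apply: emeasurable_funM.
    apply/measurable_EFinP; apply: measurable_funTS; apply: measurableT_comp => //.
    exact: measurable_hw.
  have mV := @measurable_Vint_prod m a l.
  exact: (emeasurable_funM mV mV).
by move=> s y; rewrite /= in_itv/= => /andP[s0 _] yD; exact: hw_Vint_ge0.
Qed.

Lemma integral_gamma_on (f : R -> \bar R) : (forall x, D x -> 0 <= f x) ->
  measurable_fun D f ->
  \int[gamma]_(x in D) f x = \int[leb]_(x in D) ((hw x)%:E * f x).
Proof.
move=> f0 mf; rewrite integral_mkcond integral_gamma.
- by apply: eq_integral => x xD; rewrite patchE xD.
- by move=> x; apply: erestrict_ge0.
- exact/(measurable_restrictT _ _).1.
Qed.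

Lemma gamma_D_gt0 : 0 < gamma D.
Proof.
rewrite lt0e measure_ge0 andbT; apply/eqP => g0.
have : {ae gamma, forall x : R, False}.
  exists setT; split => //.
  have -> : [set: R] = D `|` ~` D by rewrite setUv.
  have mDC : measurable (~` D : set R) by exact: measurableC.
  by apply: null_set_setU => //; exact: gamma_setCD.
by move=> /ae_gammaP /ae_D_ex[].
Qed.

Lemma integral_itv_pinfty (l : R) : (0 < l)%R ->
  \int[leb]_(s in `]0%R, l[) cst +oo s = +oo.
Proof.
move=> l0; transitivity (+oo * leb `]0%R, l[%classic); first exact: integral_cst.
by rewrite lebesgue_measure_itv/= lte_fin l0 oppr0 adde0 gt0_mulye ?lte_fin.
Qed.

(** Otherwise, by [wt_lty], the potential would be infinite at all times and
    points. *)
Lemma S_plus_tempered (mu : meas) : S_plus mu ->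
  exists2 T, (0 < T)%R & \int[mu]_(z in D) (wt T z)%:E < +oo.
Proof.
move=> [mu0 [l l0 Soo]]; apply: contrapT => nT.
have Uoo s y : (0 < s)%R -> D y -> Uint mu s y = +oo.
  move=> s0 yD; apply/eqP; rewrite -leye_eq leNgt; apply/negP => U.
  by apply: nT; exists s => //; exact: wt_lty U.
move: Soo; rewrite (eq_integral (cst +oo)).
  by rewrite integral_itv_pinfty.
move=> s; rewrite inE/= in_itv/= => /andP[s0 _].
rewrite (eq_integral (cst +oo)).
  by rewrite integral_cst// gt0_mulye//; exact: gamma_D_gt0.
by move=> y /[!inE] yD; rewrite -/(Uint mu s y) Uoo// expeS expe1 mulyy.
Qed.

Lemma S_plus_Vsq (m : sfmeas) (mu : meas) (l : R) : Uint mu = Uint m ->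
  \int[leb]_(s in `]0%R, l[)
       \int[gamma]_(y in D) (\int[mu]_(x in D) (p s x y)%:E) ^+ 2 =
  \int[leb]_(s in `]0%R, l[) Vsq m 0 s.
Proof.
move=> Umu; apply: eq_integral => s; rewrite inE/= in_itv/= => /andP[s0 _].
rewrite /Vsq Vint0 -Umu integral_gamma_on// => [y yD|].
  by rewrite mule_ge0//; exact: Uint_ge0.
have mU := measurable_Uint m s0; rewrite -Umu in mU.
exact: (emeasurable_funM mU mU).
Qed.

(** At 0 the Gaussian density is a multiple of [s^(-1/2)]. *)
Lemma integral_g1_time_lty (l : R) : (0 < l)%R -> \int[leb]_(s in `]0%R, l[) (g1 s 0)%:E < +oo.
Proof.
move=> l0; have mg A : measurable A -> A `<=` (@D R) -> measurable_fun A (fun s => (g1 s (0%R : R))%:E).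
  move=> mAA AD; apply/measurable_EFinP; apply: measurable_g1 => //.
  by move=> s /AD; rewrite D_gt0.
pose c : R := ((Num.sqrt (2 * pi))^-1)%R.
have c0 : (0 <= c)%R by rewrite invr_ge0 sqrtr_ge0.
pose F n : set R := `[(n.+1%:R^-1)%R, l]%classic.
have FD n : F n `<=` @D R.
  move=> x; rewrite /F /= in_itv/= D_gt0 => /andP[+ _]; apply: lt_le_trans.
  by rewrite invr_gt0.
have Fle n : \int[leb]_(s in F n) (g1 s 0)%:E <= (c * (2 * Num.sqrt l))%:E.
  have [nl|nl] := ltP (n.+1%:R^-1)%R l; last first.
    rewrite (@le_trans _ _ 0)//; last by rewrite lee_fin !mulr_ge0.
    rewrite (@le_trans _ _ (\int[leb]_(s in [set l]) (g1 s 0)%:E))//; last by rewrite integral_set1.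
    apply: ge0_subset_integral => //; first exact: measurable_itv.
    + apply: mg; first exact: measurable_set1.
      by move=> x /= ->; rewrite D_gt0.
    + by move=> s _; rewrite lee_fin g1_ge0.
    + by move=> s; rewrite /F /= in_itv/= => /andP[ns sl]; apply/eqP; rewrite eq_le sl (le_trans nl).
  have -> : \int[leb]_(s in F n) (g1 s 0)%:E = \int[leb]_(s in F n) (c * (Num.sqrt s)^-1)%:E.
    apply: eq_integral => s /[!inE] /FD; rewrite D_gt0 => s0; congr EFin.
    by rewrite /g1 expr0n/= oppr0 mul0r expR0 mulr1 sqrtrM ?invfM// mulr_ge0// pi_ge0.
  have sc : continuous (fun s : R => c * (2 * Num.sqrt s))%R.
    move=> s; apply: cvgM; first exact: cvg_cst.
    by apply: cvgM; [exact: cvg_cst|exact: sqrt_continuous].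
  have is_deriveD (s : R) : (0 < s)%R -> is_derive s 1%R (fun s : R => c * (2 * Num.sqrt s) : R)%R
      (c * (2 * (2 * Num.sqrt s)^-1))%R.
    move=> s0; have ds := is_derive1_sqrt s0.
    by apply: is_derive_eq.
  rewrite /F (@continuous_FTC2 R (fun s : R => c / Num.sqrt s)%R (fun s : R => c * (2 * Num.sqrt s))%R)//.
  - by rewrite -EFinB lee_fin gerBl !mulr_ge0.
  - apply: continuous_in_subspaceT => s /[!inE] /FD; rewrite D_gt0 => s0.
    apply: cvgM; first exact: cvg_cst.
    by apply: cvgV; [rewrite gt_eqF// sqrtr_gt0|exact: sqrt_continuous].
  - split.
    + move=> s; rewrite in_itv/= => /andP[ns _].
      have s0 : (0 < s)%R by apply: lt_trans ns; rewrite invr_gt0.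
      have dF := is_deriveD s s0.
      by case: dF.
    + apply: cvg_at_right_filter; exact: sc.
    + apply: cvg_at_left_filter; exact: sc.
  - move=> s; rewrite in_itv/= => /andP[ns _].
    have s0 : (0 < s)%R by apply: lt_trans ns; rewrite invr_gt0.
    have dF := is_deriveD s s0; rewrite derive1E derive_val; field.
    by rewrite gt_eqF// sqrtr_gt0.
have Fcvg : \int[leb]_(s in F n) (g1 s 0)%:E @[n --> \oo] -->
    \int[leb]_(s in \bigcup_n F n) (g1 s 0)%:E.
  apply: ge0_nondecreasing_set_cvg_integral.
  - move=> i j ij; apply/subsetPset => x; rewrite /F /= !in_itv/= => /andP[ix ->].
    by rewrite andbT (le_trans _ ix)// lef_pV2 ?posrE// ler_nat ltnS.
  - by move=> n; exact: measurable_itv.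
  - by move=> n; apply: mg => //; exact: measurable_itv.
  - by move=> n s _; rewrite lee_fin g1_ge0.
apply: (@le_lt_trans _ _ (c * (2 * Num.sqrt l))%:E); last exact: ltry.
apply: (@le_trans _ _ (\int[leb]_(s in \bigcup_n F n) (g1 s 0)%:E)).
  apply: ge0_subset_integral => //.
  - by apply: bigcup_measurable => n _; exact: measurable_itv.
  - apply: mg; first by apply: bigcup_measurable => n _; exact: measurable_itv.
    by move=> x [n _ /FD].
  - by move=> s _; rewrite lee_fin g1_ge0.
  - move=> s /=; rewrite in_itv/= => /andP[s0 sl].
    exists (Num.truncn s^-1) => //; rewrite /F /= in_itv/= (ltW sl) andbT ltW//.
    by rewrite invf_plt ?posrE// truncnS_gt.
rewrite -(cvg_lim _ Fcvg)//; apply: lime_le; first by apply/cvg_ex; eexists; exact: Fcvg.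
exact: nearW.
Qed.

Lemma sqnorm_add_le (f g h : R -> R) c : measurable_fun setT f -> measurable_fun setT g ->
  (forall y, D y -> h y = c * f y + g y)%R ->
  sqnorm h <= (2 * c ^+ 2)%:E * sqnorm f + 2%:E * sqnorm g.
Proof.
move=> mf mg hE.
have n0 (u : R -> R) y : D y -> 0 <= (hw y * u y ^+ 2)%:E.
  by move=> _; rewrite lee_fin mulr_ge0 ?hw_ge0 ?sqr_ge0.
have mn (u : R -> R) : measurable_fun setT u -> measurable_fun D (fun y => (hw y * u y ^+ 2)%:E).
  by move=> mu; apply/measurable_EFinP; apply: measurable_funTS; exact: measurable_hwsqr.
have c20 : (0 <= 2 * c ^+ 2)%R by rewrite mulr_ge0 ?sqr_ge0.
rewrite /sqnorm -!ge0_integralZl_EFin//; try exact: n0; try exact: mn.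
rewrite -ge0_integralD//; last 4 first.
- by move=> y yD; rewrite mule_ge0// n0.
- by apply: measurable_funeM; exact: mn.
- by move=> y yD; rewrite mule_ge0// n0.
- by apply: measurable_funeM; exact: mn.
have -> : \int[leb]_(y in D) (hw y * h y ^+ 2)%:E =
    \int[leb]_(y in D) (hw y * (c * f y + g y) ^+ 2)%:E.
  by apply: eq_integral => y /[!inE] yD; rewrite hE.
apply: ge0_le_integral => //.
- exact: n0.
- apply: mn; apply: measurable_funD => //; exact: measurable_funM.
- apply: emeasurable_funD; apply: measurable_funeM; exact: mn.
- move=> y _; rewrite -!EFinM -EFinD lee_fin -subr_ge0.
  rewrite [leRHS](_ : _ = hw y * (c * f y - g y) ^+ 2)%R; last by ring.
  by rewrite mulr_ge0 ?hw_ge0 ?sqr_ge0.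
Qed.

End square_function.

Section pair_path.
Context {R : realType}.
Notation leb := (@lebesgue_measure R).
Variables (m : {sigma_finite_measure set (measurableTypeR R) -> \bar R}) (a l : R).
Hypotheses (a0 : (0 <= a)%R) (l0 : (0 < l)%R).
Local Open Scope ereal_scope.
Hypothesis moo : \int[leb]_(s in `]0%R, l[) Vsq m 0 s < +oo.

Let mD := @measurable_D R.

Definition Vfin b s : R -> R := (fine \o Vint m b s) \_ (@D R).

Lemma Vfin_ge0 b s y : (0 <= b)%R -> (0 < s)%R -> (0 <= Vfin b s y)%R.
Proof.
move=> b0 s0; rewrite /Vfin patchE; case: ifPn => // /[!inE] yD.
by rewrite fine_ge0// Vint_ge0.
Qed.

Lemma measurable_Vfin b s : (0 < s)%R -> measurable_fun setT (Vfin b s).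
Proof.
move=> s0; apply/(measurable_restrictT _ _).1 => //.
by apply: measurableT_comp => //; exact: measurable_Vint.
Qed.

Let Vsq_lty_small d : (0 < d)%R -> exists2 r, (0 < r < d)%R & Vsq m 0 r < +oo.
Proof.
move=> d0; apply: contrapT => nr; pose e := Num.min l d.
have e0 : (0 < e)%R by rewrite lt_min l0.
have := integral_itv_pinfty e0; apply/eqP; rewrite lt_eqF//.
apply: le_lt_trans moo.
have -> : \int[leb]_(s in `]0%R, e[) cst +oo s = \int[leb]_(s in `]0%R, e[) Vsq m 0 s.
  apply: eq_integral => s; rewrite inE /= in_itv/= lt_min => /and3P[s0 _ sd]; apply/esym/eqP; rewrite -leye_eq leNgt.
  by apply/negP => V; apply: nr; exists s => //; rewrite s0.
apply: ge0_subset_integral => //.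
- exact: measurable_Vsq.
- by move=> s /=; rewrite in_itv/= => /andP[s0 _]; exact: Vsq_ge0.
- by move=> s /=; rewrite !in_itv/= lt_min => /and3P[-> ->].
Qed.

Let Uint_ae_fin r : (0 < r)%R -> Vsq m 0 r < +oo ->
  {ae leb, forall y, D y -> Uint m r y = (Vfin 0 r y)%:E}.
Proof.
move=> r0 roo.
have : leb.-integrable D (fun y => (hw y)%:E * Vint m 0 r y ^+ 2).
  apply/integrableP; split; first exact: measurable_hw_Vint.
  rewrite [ltLHS](_ : _ = Vsq m 0 r)//; apply: eq_integral => y /[!inE] yD.
  by rewrite gee0_abs// hw_Vint_ge0.
move=> iV.
have : {ae leb, forall y, D y -> (hw y)%:E * Vint m 0 r y ^+ 2 \is a fin_num}.
  exact: integrable_ae iV.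
apply: ae_mono => y + yD => /(_ yD).
rewrite /Vfin patchE mem_set//= Vint0.
have := Uint_ge0 m r0 yD; case: (Uint m r y) => [x| |]// _.
have h0 : (0 < hw y)%R by rewrite hw_gt0// -D_gt0.
by rewrite mulyy gt0_muley ?lte_fin.
Qed.

Let sqnorm_Uint r : (0 < r)%R -> Vsq m 0 r < +oo -> sqnorm (Vfin 0 r) = Vsq m 0 r.
Proof.
move=> r0 roo; apply: ge0_ae_eq_integral => //.
- by apply/measurable_EFinP; apply: measurable_funTS; apply: measurable_hwsqr; exact: measurable_Vfin.
- exact: measurable_hw_Vint.
- by move=> y _; rewrite lee_fin mulr_ge0 ?hw_ge0 ?sqr_ge0.
- by move=> y yD; exact: hw_Vint_ge0.
- by apply: ae_mono (Uint_ae_fin r0 roo) => y + yD => /(_ yD) E; rewrite Vint0 E.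
Qed.

(* At arbitrarily small times the path of the pair is square integrable, hence
   almost everywhere finite, and all later values come from it by the
   semigroup. *)
Let start s : (0 < s)%R -> exists (r : R) (u : R -> R), [/\ (0 < r < s)%R, forall y, (0 <= u y)%R,
  measurable_fun setT u, sqnorm u < +oo &
  forall t y, (0 < t)%R -> D y -> Vint m a (t + r) y = Tint t u y].
Proof.
move=> s0; have [r rs roo] := Vsq_lty_small s0; have r0 : (0 < r)%R by case/andP: rs.
have mk : measurable_fun setT (k r : R -> R) by exact: measurable_k.
(* [k r y] is negative for [y < 0]; the absolute value keeps [u] nonnegative *)
pose u y : R := (`|a * k r y| + Vfin 0 r y)%R.
have u0 y : (0 <= u y)%R by rewrite addr_ge0// Vfin_ge0.
have mu : measurable_fun setT u.
  apply: measurable_funD; last exact: measurable_Vfin.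
  by apply: measurableT_comp => //; exact: measurable_funM.
have uE y : D y -> u y = (a * k r y + Vfin 0 r y)%R.
  by rewrite D_gt0 => y0; rewrite /u ger0_norm// mulr_ge0// k_ge0// ltW.
exists r, u; split => //.
  apply: le_lt_trans (sqnorm_add_le mk (measurable_Vfin 0 r0) uE) _.
  rewrite lte_add_pinfty//; apply: lte_mul_pinfty; rewrite ?lee_fin ?mulr_ge0 ?sqr_ge0//.
    by rewrite (le_lt_trans (sqnorm_k_le r0))// ltry.
  by rewrite sqnorm_Uint.
move=> t y t0 yD; rewrite -Vint_semigroup//; apply: ge0_ae_eq_integral => //.
- apply: emeasurable_funM; last exact: measurable_Vint.
  by apply/measurable_EFinP; exact: measurable_p.
- exact: measurable_pM.
- by move=> z zD; rewrite mule_ge0 ?lee_fin ?D_p_ge0// Vint_ge0.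
- by move=> z zD; rewrite lee_fin mulr_ge0// D_p_ge0.
- apply: ae_mono (Uint_ae_fin r0 roo) => z + zD => /(_ zD) E.
  by rewrite EFinM uE// /Vint E -EFinD.
Qed.

Lemma Vint_fin s y : (0 < s)%R -> D y -> Vint m a s y = (Vfin a s y)%:E.
Proof.
move=> s0 yD; have [r [u [/andP[r0 rs] u0 mu uoo uE]]] := start s0.
have sr : (0 < s - r)%R by rewrite subr_gt0.
rewrite /Vfin patchE mem_set//= fineK// -[s](subrK r) uE//.
exact: Tint_fin_num.
Qed.

Lemma sqnorm_Vfin_lty s : (0 < s)%R -> sqnorm (Vfin a s) < +oo.
Proof.
move=> s0; have [r [u [/andP[r0 rs] u0 mu uoo uE]]] := start s0.
have sr : (0 < s - r)%R by rewrite subr_gt0.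
have -> : Vfin a s = (fine \o Tint (s - r) u) \_ (@D R).
  apply/funext => y; rewrite /Vfin !patchE; case: ifPn => // /[!inE] yD /=.
  by rewrite -(uE _ _ sr yD) subrK.
have [C C0 hC] := sqnorm_Tint_le sr.
apply: (le_lt_trans (hC _ u0 mu uoo)).
by rewrite lte_mul_pinfty ?lee_fin ?(ltW C0).
Qed.

Lemma Tint_Vfin r t y : (0 < r)%R -> (0 < t)%R -> D y ->
  Tint t (Vfin a r) y = (Vfin a (r + t) y)%:E.
Proof.
move=> r0 t0 yD; rewrite -Vint_fin ?addr_gt0// addrC -Vint_semigroup//.
by apply: eq_integral => z /[!inE] zD; rewrite EFinM Vint_fin.
Qed.

Lemma integral_sqnorm_Vfin_lty : \int[leb]_(s in `]0%R, l[) sqnorm (Vfin a s) < +oo.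
Proof.
have s_gt0 s : `]0%R, l[%classic s -> (0 < s)%R by rewrite /= in_itv/= => /andP[].
have U_fin s y : (0 < s)%R -> D y -> Vint m 0 s y = (Vfin 0 s y)%:E.
  move=> s0 yD; rewrite /Vfin patchE mem_set//= fineK// Vint0.
  have : Vint m a s y \is a fin_num by rewrite Vint_fin.
  by rewrite fin_numD => /andP[].
have VE b s : (forall y, D y -> Vint m b s y = (Vfin b s y)%:E) ->
    sqnorm (Vfin b s) = Vsq m b s.
  by move=> H; apply: eq_integral => y /[!inE] yD; rewrite H// -EFin_expe -EFinM.
have mitv : measurable (`]0%R, l[%classic : set R) by exact: measurable_itv.
have c0 : (0 <= 16 * a ^+ 2)%R by rewrite mulr_ge0// sqr_ge0.
have g0 s : 0 <= (16 * a ^+ 2)%:E * (g1 s (0%R : R))%:E by rewrite mule_ge0// lee_fin g1_ge0.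
have mg : measurable_fun `]0%R, l[%classic (fun s => (g1 s (0%R : R))%:E).
  by apply/measurable_EFinP; exact: measurable_g1.
apply: (@le_lt_trans _ _ (\int[leb]_(s in `]0%R, l[)
   ((16 * a ^+ 2)%:E * (g1 s 0)%:E + 2%:E * Vsq m 0 s))).
  apply: ge0_le_integral => //.
  - move=> s /s_gt0 s0; apply: integral_ge0 => y _.
    by rewrite lee_fin mulr_ge0 ?hw_ge0 ?sqr_ge0.
  - apply: (eq_measurable_fun (Vsq m a)) => [s /[!inE] /s_gt0 s0|]; last exact: measurable_Vsq.
    by rewrite VE// => y yD; exact: Vint_fin.
  - apply: emeasurable_funD; apply: measurable_funeM => //; exact: measurable_Vsq.
  - move=> s /s_gt0 s0.
    have mk : measurable_fun setT (k s : R -> R) by exact: measurable_k.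
    have VfinE y : D y -> Vfin a s y = (a * k s y + Vfin 0 s y)%R.
      move=> yD; apply: EFin_inj.
      by rewrite -Vint_fin// EFinD -U_fin// Vint0.
    apply: (le_trans (sqnorm_add_le mk (measurable_Vfin 0 s0) VfinE)).
    rewrite (VE 0%R); last by move=> y; exact: U_fin.
    rewrite leeD2r// -EFinM.
    apply: (@le_trans _ _ ((2 * a ^+ 2)%:E * (8 / Num.sqrt (2 * pi * s))%:E)).
      by apply: lee_wpmul2l; rewrite ?sqnorm_k_le// lee_fin mulr_ge0// sqr_ge0.
    rewrite -EFinM lee_fin /g1 expr0n/= oppr0 mul0r expR0 mulr1.
    by rewrite le_eqVlt; apply/orP; left; apply/eqP; ring.
rewrite ge0_integralD//.
- rewrite !ge0_integralZl_EFin//.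
  + apply: lte_add_pinfty; apply: lte_mul_pinfty => //.
    exact: integral_g1_time_lty.
  + by move=> s /s_gt0 s0; exact: Vsq_ge0.
  + exact: measurable_Vsq.
  + by move=> s _; rewrite lee_fin g1_ge0.
- by apply: measurable_funeM.
- by move=> s /s_gt0 s0; rewrite mule_ge0// Vsq_ge0.
- by apply: measurable_funeM; exact: measurable_Vsq.
Qed.

End pair_path.

(** * The correspondence *)

Section correspondence.
Context {R : realType}.
Notation leb := (@lebesgue_measure R).
Notation meas := {measure set (measurableTypeR R) -> \bar R}.
Notation sfmeas := {sigma_finite_measure set (measurableTypeR R) -> \bar R}.
Local Open Scope ereal_scope.

Let mD := @measurable_D R.

Lemma representsP a (mu : meas) (x : R -> @L2 R) : represents a mu x <->
  forall s, (0 < s)%R -> {ae leb, forall y, D y -> (x s y)%:E = Vint mu a s y}.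
Proof.
split=> H s s0.
  by apply/ae_gammaP; apply: ae_mono (H s s0) => y; exact.
by move/ae_gammaP : (H s s0); apply: ae_mono => y E _.
Qed.

Lemma T_Tint t (f g : R -> R) y : (0 < t)%R -> measurable_fun setT f ->
  measurable_fun setT g -> {ae leb, forall z, D z -> f z = g z} ->
  T t f y = fine (Tint t g y).
Proof. by move=> t0 mf mg fg; rewrite -(ae_eq_Tint y t0 mf mg fg). Qed.

Lemma pair_to_path a (mu : meas) : (0 <= a)%R -> S_plus mu ->
  exists2 x : R -> @L2 R, Ltilde2_plus x & represents a mu x.
Proof.
move=> a0 muS; have [mu0 [l l0 muoo]] := muS.
have [T0 T00 Tfin] := S_plus_tempered muS.
have [m [_ Um]] := tempered_sigma_finite mu0 T00 Tfin.
have moo : \int[leb]_(s in `]0%R, l[) Vsq m 0 s < +oo by rewrite -(S_plus_Vsq l Um).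
have foo s := sqnorm_Vfin_lty a0 l0 moo (s := s).
have mV s := measurable_Vfin m a (s := s).
have /choice[x xE] : forall s : R, exists g : @L2 R, (0 < s)%R ->
    {ae leb, forall y, D y -> g y = Vfin m a s y}.
  move=> s; have [s0|s0] := ltP 0%R s.
    by have [g gE] := L2_class (mV s s0) (foo s s0); exists g.
  by have [g _] := L2_class (mV _ ltr01) (foo _ ltr01); exists g.
exists x.
  split; last first.
    move=> s s0; apply/ae_gammaP; apply: ae_mono (xE s s0) => y + yD => /(_ yD) ->.
    exact: Vfin_ge0.
  split.
    move=> r t r0 t0; have rt0 : (0 < r + t)%R by rewrite addr_gt0.
    have : {ae gamma, forall y, x (r + t)%R y = T t (x r) y}.
      apply/ae_gammaP; apply: ae_mono (xE _ rt0) => y + yD => /(_ yD) ->.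
      rewrite (T_Tint _ t0 (measurable_L2 _) (mV r r0) (xE r r0)).
      by rewrite (Tint_Vfin a0 l0 moo).
    by apply: ae_mono => y E _.
  exists l => //.
  rewrite [ltLHS](_ : _ = \int[leb]_(s in `]0%R, l[) sqnorm (Vfin m a s)).
    exact: integral_sqnorm_Vfin_lty.
  apply: eq_integral => s; rewrite inE/= in_itv/= => /andP[s0 _].
  transitivity (sqnorm (x s)); first exact: sqr_Lnorm (measurable_L2 _).
  by apply: ae_eq_sqnorm; [exact: measurable_L2|exact: mV|exact: xE].
apply/representsP => s s0; apply: ae_mono (xE s s0) => y + yD => /(_ yD) ->.
by rewrite -(Vint_fin a0 l0 moo)// /Vint Um.
Qed.

Lemma path_to_pair (x : R -> @L2 R) : Ltilde2_plus x ->
  exists a (mu : meas), [/\ (0 <= a)%R, S_plus mu & represents a mu x].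
Proof.
move=> [[xT [l l0 xoo]] x0].
pose f (s y : R) : R := `|x s y|%R.
have mx s : measurable_fun setT (x s : R -> R) by exact: measurable_L2.
have mf s : measurable_fun setT (f s) by apply: measurableT_comp => //; exact: mx.
have f0 s y : (0 <= f s y)%R by rewrite normr_ge0.
have fx s : (0 < s)%R -> {ae leb, forall y, D y -> x s y = f s y}.
  by move=> s0; move/ae_gammaP : (x0 s s0); apply: ae_mono => y + yD => /(_ yD) ?; rewrite /f ger0_norm.
have ff s : (0 < s)%R -> sqnorm (f s) < +oo.
  by move=> s0; rewrite -(ae_eq_sqnorm (mx s) (mf s) (fx s s0)) sqnorm_L2_lty.
have fT r t : (0 < r)%R -> (0 < t)%R ->
    {ae leb, forall y, D y -> (f (r + t) y)%:E = Tint t (f r) y}.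
  move=> r0 t0; have rt0 : (0 < r + t)%R by rewrite addr_gt0.
  have xrt : {ae leb, forall y, D y -> x (r + t)%R y = T t (x r) y}.
    by apply/ae_gammaP; apply: ae_mono (xT r t r0 t0) => y; exact.
  apply: ae_mono2 (fx _ rt0) xrt => y /[swap] + + yD => /(_ yD) E /(_ yD) <-.
  rewrite E (T_Tint _ t0 (mx r) (mf r) (fx r r0)) fineK//.
  by apply: Tint_fin_num => //; exact: ff.
have [a [mu [a0 mu0 [T0 T00 Tfin] fE]]] := entrance_path_representation f0 mf ff fT.
have [m [_ Um]] := tempered_sigma_finite mu0 T00 Tfin.
have xE s : (0 < s)%R -> {ae leb, forall y, D y -> (x s y)%:E = Vint mu a s y}.
  by move=> s0; apply: ae_mono2 (fx s s0) (fE s s0) => y + + yD => /(_ yD) -> /(_ yD) ->.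
exists a, mu; split => //; last exact/representsP.
split => //; exists l => //; rewrite (S_plus_Vsq l Um).
have s_gt0 s : `]0%R, l[%classic s -> (0 < s)%R by rewrite /= in_itv/= => /andP[].
apply: le_lt_trans xoo.
rewrite [leRHS](_ : _ = \int[leb]_(s in `]0%R, l[) Vsq m a s); last first.
  apply: eq_integral => s /[!inE] /s_gt0 s0.
  transitivity (sqnorm (x s)); first exact: sqr_Lnorm (mx s).
  apply: ge0_ae_eq_integral => //.
  - by apply/measurable_EFinP; apply: measurable_funTS; exact: measurable_hwsqr.
  - exact: measurable_hw_Vint.
  - by move=> y _; rewrite lee_fin mulr_ge0 ?hw_ge0 ?sqr_ge0.
  - by move=> y yD; exact: hw_Vint_ge0.
  - apply: ae_mono (xE s s0) => y + yD => /(_ yD) E.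
    by rewrite EFinM EFin_expe E /Vint Um.
apply: ge0_le_integral => //.
- by move=> s /s_gt0 s0; exact: Vsq_ge0.
- exact: measurable_Vsq.
- exact: measurable_Vsq.
- move=> s /s_gt0 s0; apply: ge0_le_integral => //.
  + by move=> y yD; exact: hw_Vint_ge0.
  + exact: measurable_hw_Vint.
  + exact: measurable_hw_Vint.
  + move=> y yD; apply: lee_wpmul2l; first by rewrite lee_fin hw_ge0.
    have le0a : Vint m 0 s y <= Vint m a s y.
      rewrite Vint0 leeDr// lee_fin mulr_ge0// k_ge0// ltW//.
      by rewrite -D_gt0.
    by apply: lee_pmul => //; exact: Vint_ge0.
Qed.

Lemma pair_unique_of_path (x : R -> @L2 R) a a' (mu mu' : meas) :
  (0 <= a)%R -> S_plus mu -> represents a mu x ->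
  (0 <= a')%R -> S_plus mu' -> represents a' mu' x ->
  a' = a /\ forall A, measurable A -> mu' A = mu A.
Proof.
move=> a0 muS /representsP xE a'0 mu'S /representsP xE'.
have [T0 T00 Tfin] := S_plus_tempered muS; have [T1 T10 T1fin] := S_plus_tempered mu'S.
have [mu0 _] := muS; have [mu'0 _] := mu'S.
have [m [mE Um]] := tempered_sigma_finite mu0 T00 Tfin.
have [m' [m'E Um']] := tempered_sigma_finite mu'0 T10 T1fin.
pose T2 := Num.min T0 T1; have T20 : (0 < T2)%R by rewrite lt_min T00.
have tempered_min (n : sfmeas) (nu : meas) t : (forall A, n A = nu A) -> (T2 <= t)%R ->
    \int[nu]_(z in D) (wt t z)%:E < +oo -> \int[n]_(z in D) (wt T2 z)%:E < +oo.
  move=> nE T2t fin; apply: (integral_wt_lty T20 T2t).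
  by rewrite (eq_measure_integral nu)// => A _ _; exact: nE.
have [||||s s0|-> mm] := @pair_unique R m' m a' a T2 a'0 a0 T20.
- by rewrite m'E.
- by rewrite mE.
- by apply: tempered_min m'E _ T1fin; rewrite ge_min lexx orbT.
- by apply: tempered_min mE _ Tfin; rewrite ge_min lexx.
- apply: ae_mono2 (xE s s0) (xE' s s0) => y + + yD => /(_ yD) E /(_ yD).
  by rewrite E /Vint Um Um'.
- by split=> // A mA; rewrite -m'E -mE mm.
Qed.

End correspondence.

Theorem theorem5p2 (R : realType) :
  (forall (a : R) (mu : {measure set (measurableTypeR R) -> \bar R}),
      0 <= a -> S_plus mu ->
      exists x : R -> L2,
        [/\ Ltilde2_plus x, represents a mu x &
            forall x' : R -> L2, Ltilde2_plus x' -> represents a mu x' ->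
              forall s : R, 0 < s -> x' s = x s]) /\
  (forall x : R -> L2, Ltilde2_plus x ->
      exists (a : R) (mu : {measure set (measurableTypeR R) -> \bar R}),
        [/\ 0 <= a, S_plus mu, represents a mu x &
            forall (a' : R) (mu' : {measure set (measurableTypeR R) -> \bar R}),
              0 <= a' -> S_plus mu' -> represents a' mu' x ->
              a' = a /\ forall A, measurable A -> mu' A = mu A]).
Proof.
split=> [a mu a0 muS|x xL].
  have [x xL xr] := pair_to_path a0 muS; exists x; split => // x' _ x'r s s0.
  apply: L2_ext.
  move/representsP : xr => /(_ s s0) E; move/representsP : x'r => /(_ s s0) E'.
  apply: ae_mono2 E E' => y + + yD => /(_ yD) E /(_ yD) E'.
  by apply: EFin_inj; rewrite E E'.
have [a [mu [a0 muS xr]]] := path_to_pair xL; exists a, mu; split => // a' mu' a'0 mu'S x'r.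
exact: pair_unique_of_path xr a'0 mu'S x'r.
Qed.
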